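(* Consider the peak-constrained Gaussian broadcast channel $Y_i=X+Z_i$, $i=1,2$, with input constrained to $X\in[0,A]$ ($A>0$) and $Z_i\sim\mathcal{N}(0,\sigma_i^2)$, $0<\sigma_1<\sigma_2$, where the transmitter sends independent messages to receivers 1 and 2 at rates $R_1,R_2$. Let $K_1\ge 2$ and $K_2\ge1$ be integers. Then every pair $(R_1,R_2)\in\mathbb{R}_+^2$ satisfying $$R_1\le \mathsf{F}\Bigl(\tfrac{(K_1-1)A}{K_1K_2-1},K_1,\sigma_1\Bigr),\qquad R_2\le \mathsf{F}(A,K_1K_2,\sigma_2)-\mathsf{G}\Bigl(\tfrac{(K_1-1)A}{K_1K_2-1},K_1,\sigma_2\Bigr)$$ is achievable (in the standard Shannon sense: there exist codes with vanishing error probability at both receivers).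
   Context: All logarithms are base 2. $H(p)$ is the binary entropy, $\mathsf{Q}$ the standard Gaussian tail function. For $a>0,\sigma>0$: $\underline{C}(a,\sigma)=\frac12\log(1+\frac{a^2}{2\pi e\sigma^2})$; $\overline{C}(a,\sigma)=\min\{\frac12\log(1+\frac{a^2}{4\sigma^2}),\log(1+\frac{a}{\sqrt{2\pi e}\sigma})\}$; $\mathsf{E}(a,\sigma)=\min\{\overline{C}(a,\sigma),\frac12\log(1+\frac{a^2}{12\sigma^2})\}$. For $a>0$ and integer $K\ge2$: $\mathsf{F}(a,K,\sigma)=\max\{\mathsf{F}_1,\mathsf{F}_2,\mathsf{F}_3\}(a,K,\sigma)$ with $\mathsf{F}_1(a,K,\sigma)=\log K-H(\xi)-\xi\log(K-1)$, $\xi=\frac{2(K-1)}{K}\mathsf{Q}(\frac{a}{2(K-1)\sigma})$; $\mathsf{F}_2(a,K,\sigma)=\underline{C}(\frac{Ka}{K-1},\sigma)-\mathsf{E}(\frac{a}{K-1},\sigma)$; $\mathsf{F}_3(a,K,\sigma)=-\log\bigl(\sum_{i,j=1}^K\frac{\sqrt{e/2}}{K^2}e^{-\frac{(i-j)^2a^2}{4(K-1)^2\sigma^2}}\bigr)$. Also $\mathsf{G}(a,K,\sigma)=\min\{\log K,\overline{C}(a,\sigma),\frac12\log(2^{2\mathsf{E}(\frac{Ka}{K-1},\sigma)}-\frac{a^2}{2\pi e(K-1)^2\sigma^2})\}$. *)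

(* Defs.v *)
From HB Require Import structures.
From mathcomp Require Import all_boot all_order all_algebra.
From mathcomp Require Import all_classical all_reals all_analysis.
Set Implicit Arguments. Unset Strict Implicit. Unset Printing Implicit Defensive.
Import Order.TTheory GRing.Theory Num.Theory.
Local Open Scope classical_set_scope.
Local Open Scope ring_scope.

Section Defs.
Variable R : realType.

Definition log2 (x : R) : R := ln x / ln 2.

Definition xlog2 (p : R) : R := if p == 0 then 0 else p * log2 p.
Definition Hb (p : R) : R := - xlog2 p - xlog2 (1 - p).

Definition Qfun (x : R) : R := fine (normal_prob 0 1 `[x, +oo[).

Definition eul : R := expR 1.

Definition Clow (a s : R) : R :=
  log2 (1 + a ^+ 2 / (2 * pi * eul * s ^+ 2)) / 2.
Definition Cup (a s : R) : R :=
  Num.min (log2 (1 + a ^+ 2 / (4 * s ^+ 2)) / 2)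
          (log2 (1 + a / (Num.sqrt (2 * pi * eul) * s))).
Definition Efun (a s : R) : R :=
  Num.min (Cup a s) (log2 (1 + a ^+ 2 / (12 * s ^+ 2)) / 2).

Definition xi (a : R) (K : nat) (s : R) : R :=
  2 * (K%:R - 1) / K%:R * Qfun (a / (2 * (K%:R - 1) * s)).
Definition F1 (a : R) (K : nat) (s : R) : R :=
  log2 K%:R - Hb (xi a K s) - xi a K s * log2 (K%:R - 1).
Definition F2 (a : R) (K : nat) (s : R) : R :=
  Clow (K%:R * a / (K%:R - 1)) s - Efun (a / (K%:R - 1)) s.
Definition F3 (a : R) (K : nat) (s : R) : R :=
  - log2 (\sum_(1 <= i < K.+1) \sum_(1 <= j < K.+1)
      Num.sqrt (eul / 2) / (K%:R ^+ 2) *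
      expR (- ((i%:R - j%:R) ^+ 2 * a ^+ 2) / (4 * (K%:R - 1) ^+ 2 * s ^+ 2))).
Definition Ffun (a : R) (K : nat) (s : R) : R :=
  Num.max (F1 a K s) (Num.max (F2 a K s) (F3 a K s)).

Definition Gfun (a : R) (K : nat) (s : R) : R :=
  Num.min (log2 K%:R) (Num.min (Cup a s)
    (log2 (2 `^ (2 * Efun (K%:R * a / (K%:R - 1)) s)
           - a ^+ 2 / (2 * pi * eul * (K%:R - 1) ^+ 2 * s ^+ 2)) / 2)).

Definition boxes (n : nat) : set (set 'rV[R]_n) :=
  [set [set y : 'rV[R]_n | forall i, B i (y ord0 i)] |
     B in [set B : 'I_n -> set R | forall i, measurable (B i)]].
Definition borel_rV (n : nat) : set (set 'rV[R]_n) :=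
  smallest (sigma_algebra setT) (@boxes n).

Definition measurable_decoder (n k : nat) (g : 'rV[R]_n -> 'I_k) : Prop :=
  forall m : 'I_k, @borel_rV n (g @^-1` [set m]).

Definition vcons (z : R) (v : nat -> R) : nat -> R :=
  fun k => if k is k'.+1 then v k' else z.

Fixpoint gauss_iint (s : R) (n : nat) (f : (nat -> R) -> \bar R) : \bar R :=
  match n with
  | 0 => f (fun _ => 0)
  | n'.+1 => (\int[normal_prob 0 s]_z gauss_iint s n' (fun v => f (vcons z v)))%E
  end.

Definition noise_prob (s : R) (n : nat) (S : set 'rV[R]_n) : \bar R :=
  gauss_iint s n (fun v => (\1_S (\row_(i < n) v (val i)) : R)%:E).

Definition avg_err (s : R) (n k1 k2 k : nat)
  (enc : 'I_k1 -> 'I_k2 -> 'rV[R]_n) (pick : 'I_k1 -> 'I_k2 -> 'I_k)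
  (g : 'rV[R]_n -> 'I_k) : \bar R :=
  (((k1 * k2)%:R)^-1%:E *
   \sum_(m1 < k1) \sum_(m2 < k2)
      noise_prob s [set z : 'rV[R]_n | g (enc m1 m2 + z)%R != pick m1 m2])%E.

Definition achievable (A s1 s2 R1 R2 : R) : Prop :=
  forall eps : R, 0 < eps -> exists N : nat, forall n : nat, (N <= n)%N ->
  exists (k1 k2 : nat) (enc : 'I_k1 -> 'I_k2 -> 'rV[R]_n)
         (g1 : 'rV[R]_n -> 'I_k1) (g2 : 'rV[R]_n -> 'I_k2),
    [/\ 2 `^ (n%:R * R1) <= k1%:R < 2 `^ (n%:R * R1) + 1,
        2 `^ (n%:R * R2) <= k2%:R < 2 `^ (n%:R * R2) + 1,
        (forall m1 m2 t, 0 <= enc m1 m2 ord0 t <= A),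
        measurable_decoder g1 /\ measurable_decoder g2 &
        (avg_err s1 enc (fun m1 _ => m1) g1 <= eps%:E)%E /\
        (avg_err s2 enc (fun _ m2 => m2) g2 <= eps%:E)%E].

End Defs.

(* Main.v *)
(* Put d = A / (K1 K2 - 1) and send x = d (i + K1 j), where i < K1 carries the message of
   receiver 1 and j < K2 that of receiver 2.  Random coding with likelihood-ratio
   threshold tests achieves all rates (in nats) strictly below h(Y) - h(Z) for the
   K1-point PAM at noise s1 and, for receiver 2, below the difference of the output
   entropies of the K1 K2-point and the K1-point PAM at noise s2.  Receiver 1 decodes
   both messages: by data processing that difference only grows when the noise decreases.

   The rest compares these entropies with F and G.  F1 is a Fano bound, F3 a Renyi bound
   of order 2.  F2 and the last term of G come from dithering: a K-point PAM plus an
   independent uniform variable on [0, d] is uniform on [0, K d], and the entropy power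
   inequality for this sum is proved by Rioul's transport argument, through the monotone
   map from the PAM output density to the standard normal one.  The bounds Cup and Efun
   follow from Gibbs' inequality with explicit test densities.  As F1, F2 and F3 are
   strictly below the entropy difference, equality in the rate constraints is harmless. *)

Require Import Defs.
From HB Require Import structures.
From mathcomp Require Import all_boot all_order all_algebra.
From mathcomp Require Import all_classical all_reals all_analysis.
From mathcomp Require Import measurable_realfun ring lra.
Import Order.TTheory GRing.Theory Num.Theory.
Import numFieldNormedType.Exports.

Set Implicit Arguments.
Unset Strict Implicit.
Unset Printing Implicit Defensive.
Local Open Scope classical_set_scope.
Local Open Scope ring_scope.

(** One source of randomness, a standard normal X, serves throughout: scaled, it is the extra noise
    of the second channel, and [b * Phi x] makes it uniform on [0, b]. So a single operator [conv]
    and a single data-processing inequality cover both degradedness and dithering. The transport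
    argument uses the same X: it averages [ln G <= G - 1] over a product measure, so an inequality
    in the change of variables is enough and no entropy is differentiated along a flow. F2 needs
    strictness, which is obtained by carrying the gap of Jensen's inequality along as [delta].

    Entropies multiply densities by logarithms, and every manipulation asks for integrability; the
    function classes below settle this once. Block noise is an iterated integral whose inner layers
    are of unknown measurability. Error probabilities are therefore only bounded above, by sums of
    products over coordinates.

    No typical sets occur: a threshold test whose log-likelihood ratio has negative mean fails with
    probability at most th ^ n for some th < 1, and the sign of that mean is the entropy
    condition. *)

Section GaussianDomination.
Variable R : realType.
Local Notation mu := (@lebesgue_measure R).
Implicit Types (f g : R -> R) (a b c x y : R).

(** * Gaussian decay, quadratic growth and integrability *)

Definition J f : R := \int[mu]_x f x.

(* All densities below are [nice]; products of [gdom] and [qbd] functions, in particular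
   f ln g for nice f and g, are [gdom] and hence integrable. *)
Definition qbd g := measurable_fun setT g /\
  exists C, forall y, `|g y| <= C * (1 + y ^+ 2).

Definition gdom f := measurable_fun setT f /\
  exists C, exists2 c, 0 < c & forall y, `|f y| <= C * expR (- (c * y ^+ 2)).

Definition nice f := gdom f /\ exists C, forall y, expR (- (C * (1 + y ^+ 2))) <= f y.

Lemma qbd_bound g : qbd g -> exists2 C, 0 < C & forall y, `|g y| <= C * (1 + y ^+ 2).
Proof.
move=> [_ [C hC]]; exists (`|C| + 1); first by rewrite ltr_wpDl.
move=> y; apply: (le_trans (hC y)); rewrite ler_wpM2r//.
  by rewrite addr_ge0// sqr_ge0.
by apply: (le_trans (ler_norm _)); rewrite lerDl.
Qed.

Lemma gdom_bound f : gdom f -> exists2 C, 0 < C & exists2 c, 0 < c &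
  forall y, `|f y| <= C * expR (- (c * y ^+ 2)).
Proof.
move=> [_ [C [c c0 hC]]]; exists (`|C| + 1); first by rewrite ltr_wpDl.
exists c => // y; apply: (le_trans (hC y)); rewrite ler_wpM2r ?expR_ge0//.
by apply: (le_trans (ler_norm _)); rewrite lerDl.
Qed.

Lemma integrable_expRN_sqr c : 0 < c ->
  mu.-integrable setT (fun x => (expR (- (c * x ^+ 2)))%:E).
Proof.
(* The deviation for which [normal_pdf 0 s] is proportional to [expR (- (c * x ^+ 2))]. *)
move=> c0; pose s := Num.sqrt ((2 * c)^-1).
have s0 : s != 0 by rewrite gt_eqF// sqrtr_gt0 invr_gt0 mulr_gt0.
have /(integrableZl measurableT (normal_peak s)^-1) := integrable_normal_pdf 0 s.
apply: eq_integrable => // x _ /=.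
rewrite normal_pdfE// -EFinM mulKf; last by rewrite gt_eqF// normal_peak_gt0.
rewrite /normal_fun subr0 sqr_sqrtr ?invr_ge0 ?mulr_ge0 ?ltW//.
congr (expR _)%:E; rewrite mulNr; congr (- _).
have /eqP hc : c != 0 by rewrite gt_eqF.
by rewrite -mulr_natr; field; rewrite gt_eqF.
Qed.

Lemma gdom_integrable f : gdom f -> mu.-integrable setT (EFin \o f).
Proof.
move=> gf; have [mf _] := gf; have [C C0 [c c0 hf]] := gdom_bound gf.
apply: (le_integrable measurableT _ _
  (integrableZl measurableT C (integrable_expRN_sqr c0))).
- exact/measurable_EFinP.
- by move=> x _ /=; rewrite lee_fin (le_trans (hf x))// ler_norm.
Qed.

Lemma JD f g : gdom f -> gdom g -> J (fun x => f x + g x) = J f + J g.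
Proof. by move=> *; rewrite /J RintegralD//; exact: gdom_integrable. Qed.

Lemma JB f g : gdom f -> gdom g -> J (fun x => f x - g x) = J f - J g.
Proof. by move=> *; rewrite /J RintegralB//; exact: gdom_integrable. Qed.

Lemma JZ a f : gdom f -> J (fun x => a * f x) = a * J f.
Proof. by move=> *; rewrite /J RintegralZl//; exact: gdom_integrable. Qed.

Lemma eqJ f g : f =1 g -> J f = J g.
Proof. by move=> fg; apply: eq_Rintegral => x _. Qed.

Lemma leJ f g : gdom f -> gdom g -> (forall x, f x <= g x) -> J f <= J g.
Proof. by move=> *; apply: le_Rintegral => //; exact: gdom_integrable. Qed.

Lemma gdomD f g : gdom f -> gdom g -> gdom (fun x => f x + g x).
Proof.
move=> gf gg; split; first exact: measurable_funD gf.1 gg.1.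
have [C C0 [c c0 hf]] := gdom_bound gf; have [D D0 [d d0 hg]] := gdom_bound gg.
exists (C + D), (Num.min c d); first by rewrite lt_min c0 d0.
move=> y; apply: (le_trans (ler_normD _ _)); rewrite mulrDl lerD//.
  apply: (le_trans (hf y)); rewrite ler_wpM2l ?(ltW C0)// ler_expR lerN2.
  by rewrite ler_wpM2r ?sqr_ge0// ge_min lexx.
apply: (le_trans (hg y)); rewrite ler_wpM2l ?(ltW D0)// ler_expR lerN2.
by rewrite ler_wpM2r ?sqr_ge0// ge_min lexx orbT.
Qed.

Lemma gdomZ a f : gdom f -> gdom (fun x => a * f x).
Proof.
move=> gf; split; first by apply: measurable_funM => //; exact: gf.1.
have [C C0 [c c0 hf]] := gdom_bound gf.
by exists (`|a| * C), c => // y; rewrite normrM -mulrA ler_wpM2l.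
Qed.

Lemma gdomN f : gdom f -> gdom (fun x => - f x).
Proof.
by move=> /(gdomZ (-1)); congr gdom; apply/funext => x; rewrite mulN1r.
Qed.

Lemma gdomB f g : gdom f -> gdom g -> gdom (fun x => f x - g x).
Proof. by move=> gf /gdomN; exact: gdomD. Qed.

Lemma gdom0 : gdom (fun=> 0).
Proof. by split=> //; exists 0, 1 => // y; rewrite normr0 mul0r. Qed.

Lemma gdom_sum (I : Type) (r : seq I) (P : pred I) (F : I -> R -> R) :
  (forall i, P i -> gdom (F i)) -> gdom (fun x => \sum_(i <- r | P i) F i x).
Proof.
move=> gF; elim: r => [|i r IH].
  by under eq_fun do rewrite big_nil; exact: gdom0.
rewrite (_ : (fun x => _) = fun x => if P i then F i x + \sum_(j <- r | P j) F j x
    else \sum_(j <- r | P j) F j x); last by apply/funext => x; rewrite big_cons.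
by case: (boolP (P i)) => // Pi; apply: gdomD => //; exact: gF.
Qed.

Lemma J0 : J (fun=> 0) = 0.
Proof. by rewrite /J /Rintegral integral0. Qed.

Lemma J_sum (I : Type) (r : seq I) (P : pred I) (F : I -> R -> R) :
  (forall i, P i -> gdom (F i)) ->
  J (fun x => \sum_(i <- r | P i) F i x) = \sum_(i <- r | P i) J (F i).
Proof.
move=> gF; elim: r => [|i r IH].
  by rewrite big_nil; under eq_fun do rewrite big_nil; exact: J0.
rewrite (_ : (fun x => _) = fun x => if P i then F i x + \sum_(j <- r | P j) F j x
    else \sum_(j <- r | P j) F j x); last by apply/funext => x; rewrite big_cons.
by rewrite big_cons; case: (boolP (P i)) => // Pi; rewrite JD ?IH//; [exact: gF|exact: gdom_sum].
Qed.

(** Half of the Gaussian exponent is spent on the quadratic factor: [1 + y^2 <= (1 + 2/c) (1 + c/2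
    y^2) <= (1 + 2/c) exp (c/2 y^2)]. *)
Lemma gdomM f g : gdom f -> qbd g -> gdom (fun x => f x * g x).
Proof.
move=> gf qg; split; first exact: measurable_funM gf.1 qg.1.
have [C C0 [c c0 hf]] := gdom_bound gf; have [D D0 hg] := qbd_bound qg.
exists (C * D * (1 + 2 / c)), (c / 2); first by rewrite divr_gt0.
move=> y; rewrite normrM.
apply: (le_trans (ler_pM (normr_ge0 _) (normr_ge0 _) (hf y) (hg y))).
have -> : C * expR (- (c * y ^+ 2)) * (D * (1 + y ^+ 2)) =
  (C * D) * (expR (- (c * y ^+ 2)) * (1 + y ^+ 2)) by ring.
rewrite -[leRHS]mulrA ler_wpM2l//; first by rewrite mulr_ge0 ?ltW.
have -> : expR (- (c * y ^+ 2)) = expR (- (c / 2 * y ^+ 2)) * expR (- (c / 2 * y ^+ 2)).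
  by rewrite -expRD; congr expR; field.
rewrite mulrAC ler_wpM2r ?expR_ge0//.
have c2 : 0 <= 2 / c by rewrite divr_ge0// ltW.
have c3 : 0 <= c / 2 by rewrite divr_ge0// ltW.
rewrite expRN mulrC ler_pdivrMr ?expR_gt0//.
apply: (@le_trans _ _ ((1 + 2 / c) * (1 + c / 2 * y ^+ 2))); last first.
  by rewrite ler_wpM2l ?expR_ge1Dx// addr_ge0.
have -> : (1 + 2 / c) * (1 + c / 2 * y ^+ 2) = 1 + y ^+ 2 + (2 / c + c / 2 * y ^+ 2).
  by field; rewrite gt_eqF.
by rewrite lerDl addr_ge0// mulr_ge0 ?sqr_ge0.
Qed.

Lemma qbd_cst a : qbd (fun=> a).
Proof.
by split=> //; exists `|a| => y; rewrite ler_peMr// lerDl sqr_ge0.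
Qed.

Lemma qbd_bounded g (C : R) : measurable_fun setT g -> (forall y, `|g y| <= C) -> qbd g.
Proof.
move=> mg hg; split=> //; exists C => y; apply: (le_trans (hg y)).
by rewrite ler_peMr ?lerDl ?sqr_ge0// (le_trans _ (hg 0)).
Qed.

Lemma qbd_id : qbd (fun y => y).
Proof.
split; first exact: measurable_id.
exists 1 => y; rewrite mul1r -real_normK ?num_real//.
by have := sqr_ge0 (`|y| - 1); have := normr_ge0 y; nra.
Qed.

Lemma qbdD g h : qbd g -> qbd h -> qbd (fun x => g x + h x).
Proof.
move=> [mg [C hC]] [mh [D hD]]; split; first exact: measurable_funD.
by exists (C + D) => y; rewrite mulrDl (le_trans (ler_normD _ _))// lerD.
Qed.

Lemma qbdZ a g : qbd g -> qbd (fun x => a * g x).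
Proof.
move=> [mg [C hC]]; split; first exact: measurable_funM.
by exists (`|a| * C) => y; rewrite normrM -mulrA ler_wpM2l.
Qed.

Lemma qbdN g : qbd g -> qbd (fun x => - g x).
Proof.
by move=> /(qbdZ (-1)); congr qbd; apply/funext => x; rewrite mulN1r.
Qed.

Lemma qbdB g h : qbd g -> qbd h -> qbd (fun x => g x - h x).
Proof. by move=> qg /qbdN; exact: qbdD. Qed.

Lemma qbd_sqr : qbd (fun y => y ^+ 2).
Proof.
split; first exact: measurable_funX.
by exists 1 => y; rewrite mul1r ger0_norm ?sqr_ge0// lerDr.
Qed.

Lemma qbd_quad a b c : qbd (fun y => a + b * y + c * y ^+ 2).
Proof.
by apply: qbdD; [apply: qbdD; [exact: qbd_cst|apply: qbdZ; exact: qbd_id]|apply: qbdZ;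
  exact: qbd_sqr].
Qed.

Lemma measurable_affine a b : measurable_fun setT (fun x : R => a * x + b).
Proof. by apply: measurable_funD => //; apply: (@measurable_funM _ _ _ _ (cst a)). Qed.

Lemma qbd_affine a b g : qbd g -> qbd (fun x => g (a * x + b)).
Proof.
move=> qg; split.
  exact: (measurableT_comp qg.1 (measurable_affine a b)).
have [C C0 hg] := qbd_bound qg.
exists (C * (1 + 2 * a ^+ 2 + 2 * b ^+ 2)) => y.
apply: (le_trans (hg _)); rewrite -mulrA ler_wpM2l ?(ltW C0)//.
have h1 := sqr_ge0 (a * y - b); have h2 := sqr_ge0 (b * y); have h3 := sqr_ge0 a.
have h4 := sqr_ge0 y; have h5 := sqr_ge0 b.
have -> : (1 + 2 * a ^+ 2 + 2 * b ^+ 2) * (1 + y ^+ 2) = 1 + (a * y + b) ^+ 2 +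
  (a * y - b) ^+ 2 + 2 * (b * y) ^+ 2 + y ^+ 2 + 2 * a ^+ 2 by ring.
lra.
Qed.

(** The bound is [(a y + b)^2 >= a^2 y^2 / 2 - b^2], the difference being [(a y + 2 b)^2 / 2]. *)
Lemma gdom_affine a b f : a != 0 -> gdom f -> gdom (fun x => f (a * x + b)).
Proof.
move=> a0 gf; split.
  exact: (measurableT_comp gf.1 (measurable_affine a b)).
have [C C0 [c c0 hf]] := gdom_bound gf.
exists (C * expR (c * b ^+ 2)), (c * a ^+ 2 / 2).
  by rewrite divr_gt0// mulr_gt0// exprn_even_gt0.
move=> y; apply: (le_trans (hf _)); rewrite -[leRHS]mulrA ler_wpM2l ?(ltW C0)//.
rewrite -expRD ler_expR.
have : 0 <= c * (a * y + 2 * b) ^+ 2 by rewrite mulr_ge0 ?sqr_ge0 ?(ltW c0).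
by rewrite !expr2; lra.
Qed.

Lemma gdom_opp f : gdom f -> gdom (fun x => f (- x)).
Proof.
move=> /(@gdom_affine (-1) 0 _); rewrite oppr_eq0 oner_eq0 => /(_ isT).
by congr gdom; apply/funext => x; rewrite mulN1r addr0.
Qed.

Lemma gdom_shift a f : gdom f -> gdom (fun x => f (x - a)).
Proof.
move=> /(@gdom_affine 1 (- a) _ (oner_neq0 R)).
by congr gdom; apply/funext => x; rewrite mul1r.
Qed.

Lemma qbd_shift a g : qbd g -> qbd (fun x => g (x - a)).
Proof. by move=> /(qbd_affine 1 (- a)); congr qbd; apply/funext => x; rewrite mul1r. Qed.

Lemma nice_gt0 f x : nice f -> 0 < f x.
Proof. by move=> [_ [C /(_ x)]]; apply: lt_le_trans; exact: expR_gt0. Qed.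

(** This is what the lower bound in [nice] is for: it keeps [ln f] above a negative quadratic, while
    [ln f < f] and boundedness of f control it from above. *)
Lemma qbd_ln f : nice f -> qbd (fun x => ln (f x)).
Proof.
move=> nf; have fp x := nice_gt0 x nf; move: nf => [gf [C hC]].
have [D D0 [d d0 hD]] := gdom_bound gf.
split; first exact: (measurableT_comp (@measurable_ln _)) gf.1.
exists (`|C| + D) => y; rewrite ler_norml; apply/andP; split.
  have : - (C * (1 + y ^+ 2)) <= ln (f y) by rewrite -[leLHS]expRK ler_ln ?posrE ?expR_gt0.
  apply: le_trans; rewrite lerN2 ler_wpM2r ?addr_ge0 ?sqr_ge0//.
  by apply: (le_trans (ler_norm C)); rewrite lerDl ltW.
apply: (@le_trans _ _ D); last first.
  apply: (@le_trans _ _ (`|C| + D)); first by rewrite lerDr.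
  by rewrite ler_peMr ?lerDl ?sqr_ge0// addr_ge0// (ltW D0).
apply: (@le_trans _ _ (f y)).
  exact/ltW/ln_sublinear/fp.
apply: (le_trans (ler_norm _)); apply: (le_trans (hD y)).
by rewrite ger_pMr// -expR0 ler_expR oppr_le0 mulr_ge0 ?sqr_ge0// (ltW d0).
Qed.

End GaussianDomination.

(** * Affine changes of variable for Lebesgue measure *)

Section Affine.
Variable R : realType.
Local Notation mu := (@lebesgue_measure R).
Implicit Types (a b : R).

(** The pushforward of Lebesgue measure scaled by a agrees with it on the intervals []u, v]], hence
    everywhere. *)
Lemma ge0_integral_affine_pos a b (f : R -> \bar R) : 0 < a ->
  measurable_fun setT f -> (forall x, 0 <= f x)%E ->
  (\int[mu]_x f x = a%:E * \int[mu]_x f (a * x + b)%R)%E.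
Proof.
move=> a0 mf f0.
pose phi : measurableTypeR R -> measurableTypeR R := fun x => a * x + b.
have mphi : measurable_fun setT phi := measurable_affine a b.
have preE u v : phi @^-1` `]u, v]%classic = `](u - b) / a, (v - b) / a]%classic.
  apply/seteqP; split=> x /=; rewrite !in_itv/= ltr_pdivrMr// ler_pdivlMr//;
    by rewrite ltrBlDr lerBrDr mulrC.
have key A : measurable A -> mu A = (a%:E * pushforward mu phi A)%E.
  move=> mA.
  have -> : (a%:E * pushforward mu phi A)%E =
    mscale (NngNum (ltW a0)) (pushforward mu phi) A by [].
  apply: lebesgue_measure_unique => // _ [[u v]] _ <-.
  rewrite [RHS](_ : _ = (a%:E * mu (phi @^-1` `]u, v]%classic))%E)// preE.
  rewrite !lebesgue_measure_itv/= !lte_fin.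
  rewrite ltr_pM2r ?invr_gt0// ltrD2r; case: ifP => uv; last by rewrite mule0.
  by congr (_%:E); field; rewrite gt_eqF.
rewrite (@eq_measure_integral _ _ _ _
  (mscale (NngNum (ltW a0)) (pushforward mu phi))); last first.
  by move=> A mA _; exact: key.
rewrite ge0_integral_mscale//.
by rewrite ge0_integral_pushforward.
Qed.

Lemma ge0_integral_opp (f : R -> \bar R) :
  measurable_fun setT f -> (forall x, 0 <= f x)%E ->
  (\int[mu]_x f (- x)%R = \int[mu]_x f x)%E.
Proof.
move=> mf f0.
have := @ge0_integral_pushforward _ _ (measurableTypeR R) (measurableTypeR R) R (-%R) (@oppr_measurable R setT)
 mu setT f measurableT mf.
rewrite preimage_setT => <-; last by move=> *; exact: f0.
by apply: eq_measure_integral => A mA _; exact: lebesgue_measureN.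
Qed.

End Affine.

(** * Translation, reflection, positivity and Gibbs' inequality *)

Section Gibbs.
Variable R : realType.
Local Notation mu := (@lebesgue_measure R).
Implicit Types (f g p q : R -> R) (a b c m s x y : R).

Lemma EFin_J f : gdom f -> ((J f)%:E = \int[mu]_x (f x)%:E)%E.
Proof. by move=> gf; rewrite /J fineK//; apply: integrable_fin_num => //;
  exact: gdom_integrable. Qed.

Lemma gdom_norm f : gdom f -> gdom (fun x => `|f x|).
Proof.
move=> [mf [C [c c0 hf]]]; split; first exact: measurableT_comp.
by exists C, c => // y; rewrite normr_id.
Qed.

(** Reduces an identity between functionals that respect differences to nonnegative functions, by
    [f = (f + |f|) - |f|]; there it can be read off extended-valued integrals. *)
Lemma gdom_split f (L : (R -> R) -> R) : gdom f ->
  (forall g h, gdom g -> gdom h -> L (fun x => g x - h x) = L g - L h) ->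
  (forall g, gdom g -> (forall x, 0 <= g x) -> J g = L g) -> J f = L f.
Proof.
move=> gf LB L0; have gn := gdom_norm gf; have gD := gdomD gf gn.
have -> : f = fun x => (f x + `|f x|) - `|f x| by apply/funext => x; rewrite addrK.
rewrite JB// LB// -!L0// => x; rewrite -lerBlDr sub0r lerNl -normrN; exact: ler_norm.
Qed.

Lemma J_affine a b f : 0 < a -> gdom f -> J f = a * J (fun x => f (a * x + b)).
Proof.
move=> a0; have an0 : a != 0 by rewrite gt_eqF.
move=> gf; apply: (gdom_split (L := fun f => a * J (fun x => f (a * x + b)))) gf _ _.
  by move=> g h gg gh; rewrite JB ?mulrBr//; exact: gdom_affine.
move=> g gg g0; apply/EFin_inj; rewrite EFinM !EFin_J//; last exact: gdom_affine.
apply: (@ge0_integral_affine_pos R a b (EFin \o g)) => //.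
by apply/measurable_EFinP; exact: gg.1.
Qed.

Lemma J_shift a f : gdom f -> J (fun x => f (x - a)) = J f.
Proof.
move=> gf; rewrite [RHS](J_affine (- a) ltr01 gf) mul1r.
by apply: eqJ => x; rewrite mul1r.
Qed.

Lemma J_opp f : gdom f -> J (fun x => f (- x)) = J f.
Proof.
move=> gf; apply/esym; apply: (gdom_split (L := fun f => J (fun x => f (- x)))) gf _ _.
  by move=> g h gg gh; rewrite JB//; exact: gdom_opp.
move=> g gg g0; apply/EFin_inj; rewrite !EFin_J//; last exact: gdom_opp.
apply/esym; apply: (@ge0_integral_opp R (EFin \o g)) => //.
by apply/measurable_EFinP; exact: gg.1.
Qed.

Lemma J_ge0 f : (forall x, 0 <= f x) -> 0 <= J f.
Proof. by move=> f0; apply: Rintegral_ge0. Qed.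

Lemma J_gt0 f a b : a < b -> gdom f -> (forall x, 0 <= f x) ->
  (forall x, a < x < b -> 0 < f x) -> 0 < J f.
Proof.
move=> ab gf f0 fp; rewrite lt_neqAle J_ge0// andbT; apply/eqP => J0.
have : (\int[mu]_(x in setT) `|(EFin \o f) x| = 0)%E.
  rewrite (_ : 0%E = (J f)%:E) -?J0// J0 EFin_J//; apply: eq_integral => x _ /=.
  by rewrite ger0_norm.
move/ae_eq_integral_abs => /(_ measurableT)[]; first by apply/measurable_EFinP; exact: gf.1.
move=> N [mN N0 hN].
have : (mu `]a, b[%classic <= mu N)%E.
  apply: le_measure; rewrite ?inE// => x; rewrite /= in_itv/= => xab;
    apply: hN => /= /(_ Logic.I) /= [].
  by move=> fx0; have := fp x xab; rewrite fx0 ltxx.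
rewrite N0 lebesgue_measure_itv/= lte_fin ab -EFinB lee_fin subr_le0.
by rewrite leNgt ab.
Qed.

Lemma ltJ f g a b : a < b -> gdom f -> gdom g -> (forall x, f x <= g x) ->
  (forall x, a < x < b -> f x < g x) -> J f < J g.
Proof.
move=> ab gf gg fg fgab; rewrite -subr_gt0 -JB//; apply: (J_gt0 ab).
- exact: gdomB.
- by move=> x; rewrite subr_ge0.
- by move=> x xab; rewrite subr_gt0 fgab.
Qed.

Lemma ln_leB1 x : 0 < x -> ln x <= x - 1.
Proof. by move=> x0; have := @le_ln1Dx R (x - 1); rewrite (_ : 1 + (x - 1) = x); [apply;
  lra|ring]. Qed.

(* [ln x = 2 ln (sqrt x) <= 2 (sqrt x - 1) = x - 1 - (sqrt x - 1)^2] *)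
Lemma ln_ltB1 x : 0 < x -> x != 1 -> ln x < x - 1.
Proof.
move=> x0 x1; have s0 : 0 < Num.sqrt x by rewrite sqrtr_gt0.
have xE : x = Num.sqrt x ^+ 2 by rewrite sqr_sqrtr// ltW.
rewrite {1}xE expr2 lnM ?posrE//.
have h := ln_leB1 s0.
have : 0 < (Num.sqrt x - 1) ^+ 2.
  rewrite exprn_even_gt0//= subr_eq0; apply: contra x1 => /eqP s1.
  by rewrite xE s1 expr1n.
by rewrite !expr2 => h2; have := xE; rewrite expr2 => h3; lra.
Qed.

Lemma mul_ln_ratio_le (p q : R) : 0 < p -> 0 < q -> p * (ln q - ln p) <= q - p.
Proof.
move=> p0 q0; rewrite -ln_div ?posrE//.
have : p * ln (q / p) <= p * (q / p - 1) by rewrite ler_pM2l// ln_leB1// divr_gt0.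
by rewrite mulrBr mulr1 mulrCA divff ?gt_eqF// mulr1.
Qed.

Lemma mul_ln_ratio_lt (p q : R) : 0 < p -> 0 < q -> p != q ->
  p * (ln q - ln p) < q - p.
Proof.
move=> p0 q0 pq; rewrite -ln_div ?posrE//.
have : p * ln (q / p) < p * (q / p - 1).
  rewrite ltr_pM2l// ln_ltB1// ?divr_gt0//.
  apply: contra pq => /eqP h; have : q = q / p * p by rewrite divfK ?gt_eqF//.
  by rewrite h mul1r => ->.
by rewrite mulrBr mulr1 mulrCA divff ?gt_eqF// mulr1.
Qed.

(** The test function q may have less mass than p, so a test density need not be normalised
    exactly. *)
Lemma gibbs p q : nice p -> gdom q -> (forall x, 0 < q x) -> qbd (fun x => ln (q x)) ->
  J q <= J p -> J (fun x => p x * ln (q x)) <= J (fun x => p x * ln (p x)).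
Proof.
move=> np gq q0 lq qp; have lp := qbd_ln np; have gp := np.1.
rewrite -subr_le0 -JB; [|exact: gdomM..].
apply: (@le_trans _ _ (J (fun x => q x - p x))); last by rewrite JB// subr_le0.
apply: leJ; [by apply: gdomB; exact: gdomM|exact: gdomB|move=> x].
by rewrite -mulrBr mul_ln_ratio_le// nice_gt0.
Qed.

End Gibbs.

(** * Moments of the standard normal law *)

Section GaussianMoments.
Variable R : realType.
Implicit Types (f g p q : R -> R) (a b c m s x y : R).

Definition phi : R -> R := normal_pdf 0 1.

Lemma normal_peak_div s : 0 < s -> normal_peak s = normal_peak 1 / s.
Proof.
move=> s0; rewrite /normal_peak expr1n mul1r -mulrnAr sqrtrM ?sqr_ge0// sqrtr_sqr gtr0_norm//.
by rewrite invfM mulrC.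
Qed.

Lemma ln_normal_pdf m s x : 0 < s ->
  ln (normal_pdf m s x) = ln (normal_peak 1) - ln s - (x - m) ^+ 2 / (2 * s ^+ 2).
Proof.
move=> s0; rewrite normal_pdfE ?gt_eqF// normal_peak_div// lnM ?posrE ?expR_gt0//.
  rewrite /normal_fun expRK ln_div ?posrE ?normal_peak_gt0// mulNr.
  by rewrite -(mulr_natl (s ^+ 2)).
by rewrite divr_gt0// normal_peak_gt0.
Qed.

Lemma normal_pdf_gt0 m s x : 0 < s -> 0 < normal_pdf m s x.
Proof.
by move=> s0; rewrite normal_pdfE ?gt_eqF// mulr_gt0 ?normal_peak_gt0 ?gt_eqF ?expR_gt0.
Qed.

Lemma normal_pdf_affine m s x : 0 < s -> s * normal_pdf m s (s * x + m) = phi x.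
Proof.
move=> s0; rewrite /phi !normal_pdfE ?gt_eqF ?oner_eq0// normal_peak_div// mulrA.
rewrite [s * _]mulrC divfK ?gt_eqF//; congr (_ * expR _).
by rewrite addrK subr0 expr1n exprMn; field; rewrite gt_eqF.
Qed.

Lemma gdom_normal m s : 0 < s -> gdom (normal_pdf m s).
Proof.
move=> s0; have : gdom phi.
  split; first exact: measurable_normal_pdf.
  exists (normal_peak 1), (2^-1) => // y.
  rewrite /phi normal_pdfE ?oner_eq0// normrM !ger0_norm ?expR_ge0 ?normal_peak_ge0//.
  rewrite ler_wpM2l ?normal_peak_ge0// ler_expR subr0 expr1n mulNr lerN2.
  by rewrite mulrC.
move=> /(@gdom_affine _ s^-1 (- m / s) _); rewrite invr_eq0 gt_eqF// => /(_ isT).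
move=> /(gdomZ s^-1); congr gdom; apply/funext => x.
by rewrite -(@normal_pdf_affine m s)// mulrA mulVf ?gt_eqF// mul1r; congr normal_pdf; field;
  rewrite gt_eqF.
Qed.

Lemma nice_normal m s : 0 < s -> nice (normal_pdf m s).
Proof.
move=> s0; split; first exact: gdom_normal.
have lo : qbd (fun x => - ln (normal_peak 1) + ln s + (2 * s ^+ 2)^-1 * (1 * x + (- m)) ^+ 2).
  by apply: qbdD; [exact: qbd_cst|apply: qbdZ; apply: (qbd_affine 1 (- m) (@qbd_sqr R))].
have [C C0 hC] := qbd_bound lo; exists C => y.
rewrite -[leRHS]lnK ?posrE ?normal_pdf_gt0// ler_expR ln_normal_pdf// lerNl.
apply: le_trans (hC y); apply: le_trans (ler_norm _).
by rewrite le_eqVlt; apply/orP; left; apply/eqP; ring.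
Qed.

Lemma J_normal m s : J (normal_pdf m s) = 1.
Proof. by rewrite /J /Rintegral integral_normal_pdf. Qed.

Lemma J_normalM m s g : 0 < s -> qbd g ->
  J (fun x => normal_pdf m s x * g x) = J (fun x => phi x * g (s * x + m)).
Proof.
move=> s0 qg; rewrite (@J_affine _ s m)//; last by apply: gdomM => //; exact: gdom_normal.
rewrite -JZ.
  by apply: eqJ => x; rewrite mulrA normal_pdf_affine.
apply: (@gdom_affine _ s m (fun x => normal_pdf m s x * g x)); first by rewrite gt_eqF.
by apply: gdomM => //; exact: gdom_normal.
Qed.

Let gphi : gdom phi := @gdom_normal 0 1 ltr01.
Let nphi : nice phi := @nice_normal 0 1 ltr01.

(** The moments come from Gibbs' inequality instead of integration by parts. The expression is the
    divergence of phi from the normal law (m, s), written with unknown first and second moments;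
    suitable m and s then force their values. *)
Let gibbs_phi m s : 0 < s -> 0 <= ln s - J (fun x => phi x * x ^+ 2) / 2 +
  (J (fun x => phi x * x ^+ 2) - 2 * m * J (fun x => phi x * x) + m ^+ 2) / (2 * s ^+ 2).
Proof.
move=> s0; have := @gibbs _ phi (normal_pdf m s) nphi (gdom_normal m s0)
  (fun x => normal_pdf_gt0 m x s0) (qbd_ln (nice_normal m s0)).
rewrite !J_normal lexx => /(_ isT).
set M := J (fun x => phi x * x ^+ 2); set E := J (fun x => phi x * x).
have gM : gdom (fun x => phi x * x ^+ 2) by apply: gdomM => //; exact: qbd_sqr.
have gE : gdom (fun x => phi x * x) by apply: gdomM => //; exact: qbd_id.
have quad c0 c1 c2 : J (fun x => phi x * (c0 + c1 * x + c2 * x ^+ 2)) = c0 + c1 * E + c2 * M.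
  transitivity (J (fun x => (c0 * phi x + c1 * (phi x * x)) + c2 * (phi x * x ^+ 2))).
    by apply: eqJ => x; ring.
  rewrite JD ?JD ?JZ ?J_normal ?mulr1//; [exact: gdomZ|exact: gdomZ|by apply: gdomD;
    exact: gdomZ|exact: gdomZ].
pose K : R := ln (normal_peak 1).
have -> : J (fun x => phi x * ln (phi x)) = K + 0 * E + (- 2^-1) * M.
  rewrite -quad; apply: eqJ => x; rewrite {2}/phi ln_normal_pdf// ln1 -/K.
  by congr (_ * _); field.
have -> : J (fun x => phi x * ln (normal_pdf m s x)) =
   (K - ln s - m ^+ 2 / (2 * s ^+ 2)) + (m / s ^+ 2) * E + (- (2 * s ^+ 2)^-1) * M.
  rewrite -quad; apply: eqJ => x; rewrite ln_normal_pdf// -/K.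
  by congr (_ * _); field; rewrite gt_eqF.
rewrite -subr_ge0; by congr (0 <= _); field; rewrite gt_eqF.
Qed.

Lemma J_phi_id : J (fun x => phi x * x) = 0.
Proof.
(* Centring at the unknown mean leaves [- E^2 / 2 >= 0]. *)
set E := J _; have := @gibbs_phi E 1 ltr01; rewrite ln1 -/E expr1n => h.
have h2 : E * E <= 0 by rewrite expr2 in h; lra.
by apply/eqP; rewrite -[_ == 0]orbb -mulf_eq0 eq_le h2 -expr2 sqr_ge0.
Qed.

Lemma J_phi_sqr : J (fun x => phi x * x ^+ 2) = 1.
Proof.
set M := J _; have gM : gdom (fun x => phi x * x ^+ 2) by apply: gdomM => //; exact: qbd_sqr.
have M0 : 0 < M.
  apply: (@J_gt0 _ _ 0 1) => // [x|x /andP[x0 _]].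
    by rewrite mulr_ge0 ?sqr_ge0 ?normal_pdf_ge0.
  by rewrite mulr_gt0 ?normal_pdf_gt0// exprn_gt0.
apply/eqP; apply: contraT => M1; have := ln_ltB1 M0 M1.
have s0 : 0 < Num.sqrt M by rewrite sqrtr_gt0.
have sE : Num.sqrt M ^+ 2 = M by rewrite sqr_sqrtr// ltW.
(* Taking the unknown second moment as variance leaves [ln M >= M - 1], which forces M = 1. *)
have := @gibbs_phi 0 (Num.sqrt M) s0; rewrite J_phi_id sE -/M.
have -> : ln M = ln (Num.sqrt M) + ln (Num.sqrt M).
  by rewrite -lnM ?posrE// -expr2 sE.
have -> : (M - 2 * 0 * 0 + 0 ^+ 2) / (2 * M) = 2^-1 by field; rewrite gt_eqF.
by move=> h1 h2; lra.
Qed.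

Lemma J_phi_quad (c0 c1 c2 : R) :
  J (fun x => phi x * (c0 + c1 * x + c2 * x ^+ 2)) = c0 + c2.
Proof.
have gM : gdom (fun x => phi x * x ^+ 2) by apply: gdomM => //; exact: qbd_sqr.
have gE : gdom (fun x => phi x * x) by apply: gdomM => //; exact: qbd_id.
transitivity (J (fun x => (c0 * phi x + c1 * (phi x * x)) + c2 * (phi x * x ^+ 2))).
  by apply: eqJ => x; ring.
rewrite JD ?JD ?JZ ?J_phi_sqr ?J_phi_id ?J_normal ?mulr1 ?mulr0 ?addr0//;
  [exact: gdomZ|exact: gdomZ|by apply: gdomD; exact: gdomZ|exact: gdomZ].
Qed.

End GaussianMoments.

(** * Adding an independent variable t(X); divergence decreases *)

Section Noise.
Variable R : realType.
Local Notation mu := (@lebesgue_measure R).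
Local Notation phi := (@phi R).
Implicit Types (f g p q t : R -> R) (a b c m s x y : R).

(** At most linear growth, in squared form to match [qbd]: functions of quadratic growth keep it
    after the shift by [t x]. *)
Definition lgrow t := measurable_fun setT t /\
  exists C, forall x, t x ^+ 2 <= C * (1 + x ^+ 2).

(* the density of Y + t(X) when Y has density f and X is standard normal *)
Definition conv f t : R -> R := fun y => J (fun x => phi x * f (y - t x)).

(** The Markov operator dual to [conv]: the expected value of g at the output when the input is
    y. *)
Definition avg g t : R -> R := fun y => J (fun x => phi x * g (y + t x)).

Let phi_ge0 x : 0 <= phi x. Proof. exact: normal_pdf_ge0. Qed.
Let gphi : gdom phi. Proof. exact: gdom_normal. Qed.

Lemma gdom_bounded f : gdom f -> exists2 C, 0 < C & forall y, `|f y| <= C.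
Proof.
move=> /gdom_bound[C C0 [c c0 h]]; exists C => // y; apply: (le_trans (h y)).
by rewrite ger_pMr// -expR0 ler_expR oppr_le0 mulr_ge0 ?sqr_ge0 ?(ltW c0).
Qed.

Lemma qbd_comp_bound g t : qbd g -> lgrow t ->
  exists2 D, 0 < D & forall x y, `|g (y + t x)| <= D * (1 + x ^+ 2) * (1 + y ^+ 2).
Proof.
move=> /qbd_bound[C C0 hg] [_ [E hE]].
exists (C * (2 + 2 * `|E|)); first by rewrite mulr_gt0// ltr_wpDr// mulr_ge0.
move=> x y; apply: (le_trans (hg _)); rewrite -!mulrA ler_wpM2l ?(ltW C0)//.
have hEx : t x ^+ 2 <= `|E| * (1 + x ^+ 2).
  by apply: (le_trans (hE x)); rewrite ler_wpM2r ?ler_norm// addr_ge0// sqr_ge0.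
have h1 := sqr_ge0 (y - t x); have h2 := sqr_ge0 x; have h3 := sqr_ge0 y.
have h4 : 0 <= `|E| by [].
have h5 : 0 <= x ^+ 2 * y ^+ 2 by rewrite mulr_ge0.
have h6 : 0 <= `|E| * (x ^+ 2 * y ^+ 2) by rewrite mulr_ge0.
have h7 : 0 <= `|E| * y ^+ 2 by rewrite mulr_ge0.
have h8 : (y + t x) ^+ 2 + (y - t x) ^+ 2 = 2 * y ^+ 2 + 2 * t x ^+ 2 by ring.
have -> : (2 + 2 * `|E|) * ((1 + x ^+ 2) * (1 + y ^+ 2)) =
  2 + 2 * x ^+ 2 + 2 * y ^+ 2 + 2 * (x ^+ 2 * y ^+ 2) + 2 * (`|E| * (1 + x ^+ 2)) +
  2 * (`|E| * y ^+ 2) + 2 * (`|E| * (x ^+ 2 * y ^+ 2)) by ring.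
lra.
Qed.

Lemma qbd_comp g t y : qbd g -> lgrow t -> qbd (fun x => g (y + t x)).
Proof.
move=> qg lt; have [D D0 hD] := qbd_comp_bound qg lt; split.
  apply: (measurableT_comp qg.1); apply: measurable_funD => //; exact: lt.1.
exists (D * (1 + y ^+ 2)) => x; by rewrite mulrAC.
Qed.

Lemma measurable_phi_comp g t : measurable_fun setT g -> measurable_fun setT t ->
  measurable_fun setT (fun z : R * R => phi z.1 * g (z.2 + t z.1)).
Proof.
move=> mg mt; apply: measurable_funM.
  by apply: (measurableT_comp gphi.1); exact: measurable_fst.
apply: (measurableT_comp mg); apply: measurable_funD; first exact: measurable_snd.
by apply: (measurableT_comp mt); exact: measurable_fst.
Qed.

(** Tonelli's theorem is applied to nonnegative integrands; adding the quadratic bound of g makes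
    both parts nonnegative without leaving the class. *)
Lemma qbd_split g : qbd g ->
  exists h1 h2, [/\ qbd h1, qbd h2, (forall x, 0 <= h1 x), (forall x, 0 <= h2 x)
    & g = fun x => h1 x - h2 x].
Proof.
move=> qg; have [C C0 hC] := qbd_bound qg.
have q2 : qbd (fun x => C * (1 + x ^+ 2)).
  by apply: qbdZ; apply: qbdD; [exact: qbd_cst|exact: qbd_sqr].
exists (fun x => g x + C * (1 + x ^+ 2)), (fun x => C * (1 + x ^+ 2)).
split=> //; first exact: qbdD.
- by move=> x; have := hC x; rewrite ler_norml => /andP[h _]; lra.
- by move=> x; rewrite mulr_ge0 ?addr_ge0 ?sqr_ge0 ?(ltW C0).
- by apply/funext => x; rewrite addrK.
Qed.

Lemma gdom_phi_comp g t y : qbd g -> lgrow t -> gdom (fun x => phi x * g (y + t x)).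
Proof. by move=> qg lt; apply: gdomM => //; exact: qbd_comp. Qed.

Lemma avgB g h t y : qbd g -> qbd h -> lgrow t ->
  avg (fun x => g x - h x) t y = avg g t y - avg h t y.
Proof.
move=> qg qh lt; rewrite /avg -JB; [|exact: gdom_phi_comp..].
by apply: eqJ => x; rewrite mulrBr.
Qed.

Lemma measurable_avg g t : qbd g -> lgrow t -> measurable_fun setT (avg g t).
Proof.
move=> qg lt; have [h1 [h2 [q1 q2 h10 h20 ->]]] := qbd_split qg.
have pos h : qbd h -> (forall x, 0 <= h x) -> measurable_fun setT (avg h t).
  move=> qh h0; rewrite /avg /J /Rintegral.
  apply: (measurableT_comp (@fine_measurable _ setT measurableT)).
  apply: (@measurable_fun_fubini_tonelli_G _ _ _ _ _ mu
    (fun z : R * R => (phi z.1 * h (z.2 + t z.1))%:E)).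
    by apply/measurable_EFinP; exact: (measurable_phi_comp qh.1 lt.1).
  by move=> z; rewrite lee_fin mulr_ge0.
rewrite (_ : avg _ _ = fun y => avg h1 t y - avg h2 t y); last first.
  by apply/funext => y; exact: avgB.
by apply: measurable_funB; exact: pos.
Qed.

Lemma qbd_avg g t : qbd g -> lgrow t -> qbd (avg g t).
Proof.
move=> qg lt; split; first exact: measurable_avg.
have [D D0 hD] := qbd_comp_bound qg lt; exists (D * 2) => y.
have gt := gdom_phi_comp y qg lt.
apply: (@le_trans _ _ (J (fun x => `|phi x * g (y + t x)|))).
  by apply: le_normr_Rintegral => //; exact: gdom_integrable.
apply: (@le_trans _ _ (J (fun x => (D * (1 + y ^+ 2)) * (phi x * (1 + 0 * x + 1 * x ^+ 2))))).
  apply: leJ; [exact: gdom_norm| |move=> x].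
    by apply: gdomZ; apply: gdomM => //; exact: qbd_quad.
  rewrite normrM (ger0_norm (phi_ge0 x)) mulrCA ler_wpM2l//.
  by apply: (le_trans (hD x y)); rewrite mul0r addr0 mul1r mulrAC.
rewrite JZ ?J_phi_quad; last first.
  by apply: gdomM => //; exact: qbd_quad.
by rewrite mulrAC -mulrA [1 + 1]addrC.
Qed.

Lemma gdom_phi_shift f t y : gdom f -> lgrow t -> gdom (fun x => phi x * f (y - t x)).
Proof.
move=> gf lt; have [C C0 hC] := gdom_bounded gf.
apply: gdomM => //; apply: (@qbd_bounded _ _ C) => //.
apply: (measurableT_comp gf.1); apply: measurable_funB => //; exact: lt.1.
Qed.

Lemma measurable_phi_mul_comp f g t : measurable_fun setT f -> measurable_fun setT g ->
  measurable_fun setT t ->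
  measurable_fun setT (fun z : R * R => (phi z.1 * (f z.2 * g (z.2 + t z.1)))%:E).
Proof.
move=> mf mg mt; apply/measurable_EFinP; apply: (eq_measurable_fun (fun z : R * R =>
  f z.2 * (phi z.1 * g (z.2 + t z.1)))); first by move=> z _; ring.
apply: (@measurable_funM _ _ _ _ (fun z : R * R => f z.2)).
  by apply: (measurableT_comp mf); exact: measurable_snd.
exact: (measurable_phi_comp mg mt).
Qed.

Lemma EFin_J_avg f g t : gdom f -> (forall x, 0 <= f x) -> qbd g -> (forall x, 0 <= g x) ->
  lgrow t -> ((J (fun y => f y * avg g t y))%:E =
    \int[mu]_x \int[mu]_y (phi x * (f y * g (y + t x)))%:E)%E.
Proof.
move=> gf f0 qg g0 lt; have mF := measurable_phi_mul_comp gf.1 qg.1 lt.1.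
rewrite EFin_J; last by apply: gdomM => //; exact: qbd_avg.
transitivity (\int[mu]_y \int[mu]_x (phi x * (f y * g (y + t x)))%:E)%E.
  apply: eq_integral => y _.
  rewrite /avg -JZ ?EFin_J; last exact: gdom_phi_comp.
    by apply: eq_integral => x _; congr EFin; ring.
  by apply: gdomZ; exact: gdom_phi_comp.
rewrite -(@fubini_tonelli _ _ _ _ _ mu mu
   (fun z : R * R => (phi z.1 * (f z.2 * g (z.2 + t z.1)))%:E) mF)//.
by move=> z; rewrite lee_fin !mulr_ge0.
Qed.

(* Tonelli and the translation invariance of Lebesgue measure: if Y has density f
   and X is standard Gaussian, both sides are E[g(Y + t(X))]. *)
Lemma J_conv f g t : gdom f -> (forall x, 0 <= f x) -> lgrow t -> gdom (conv f t) ->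
  qbd g -> J (fun y => f y * avg g t y) = J (fun v => conv f t v * g v).
Proof.
move=> gf f0 lt gc qg; have [h1 [h2 [q1 q2 h10 h20 ->]]] := qbd_split qg.
suff pos h : qbd h -> (forall x, 0 <= h x) ->
    J (fun y => f y * avg h t y) = J (fun v => conv f t v * h v).
  transitivity (J (fun y => f y * avg h1 t y - f y * avg h2 t y)).
    by apply: eqJ => y; rewrite avgB// mulrBr.
  rewrite JB ?pos//; [|by apply: gdomM => //; exact: qbd_avg..].
  by rewrite -JB; [apply: eqJ => y; rewrite mulrBr|exact: gdomM..].
move=> qh h0; have mt := lt.1; have mh := qh.1; have mf := gf.1.
apply/EFin_inj; rewrite EFin_J_avg// EFin_J; last exact: gdomM.
transitivity (\int[mu]_x \int[mu]_y (phi x * (f (y - t x) * h y))%:E)%E.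
  apply: eq_integral => x _.
  rewrite (@ge0_integral_affine_pos R 1 (t x)
    (fun y => (phi x * (f (y - t x) * h y))%:E)) ?mul1e//.
  - by apply: eq_integral => y _; rewrite mul1r addrK.
  - apply/measurable_EFinP; apply: measurable_funM => //; apply: measurable_funM => //.
    by apply: (measurableT_comp mf); exact: measurable_funB.
  - by move=> y; rewrite lee_fin !mulr_ge0.
have mG : measurable_fun setT (fun z : R * R => (phi z.1 * (f (z.2 - t z.1) * h z.2))%:E).
  apply/measurable_EFinP; apply: measurable_funM.
    by apply: (measurableT_comp gphi.1); exact: measurable_fst.
  apply: measurable_funM; last by apply: (measurableT_comp mh); exact: measurable_snd.
  apply: (measurableT_comp mf); apply: measurable_funB; first exact: measurable_snd.
  by apply: (measurableT_comp mt); exact: measurable_fst.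
rewrite (@fubini_tonelli _ _ _ _ _ mu mu
   (fun z : R * R => (phi z.1 * (f (z.2 - t z.1) * h z.2))%:E) mG); last first.
  by move=> z; rewrite lee_fin !mulr_ge0.
apply: eq_integral => y _; rewrite /conv.
rewrite [J _ * _]mulrC -JZ ?EFin_J; last exact: gdom_phi_shift.
  by apply: eq_integral => x _; congr EFin; ring.
by apply: gdomZ; exact: gdom_phi_shift.
Qed.

Lemma avg_cst c t y : avg (fun=> c) t y = c.
Proof.
by rewrite /avg -[RHS](addr0 c) -(@J_phi_quad _ c 0 0); apply: eqJ => x; ring.
Qed.

Lemma J_conv1 f t : gdom f -> (forall x, 0 <= f x) -> lgrow t -> gdom (conv f t) ->
  J (conv f t) = J f.
Proof.
move=> gf f0 lt gc; transitivity (J (fun v => conv f t v * 1)).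
  by apply: eqJ => v; rewrite mulr1.
rewrite -J_conv//; last exact: qbd_cst.
by apply: eqJ => v; rewrite avg_cst mulr1.
Qed.

Definition kl p q := J (fun y => p y * (ln (p y) - ln (q y))).

(* With v = y + t x, r = ln (pt/qt) and rho = pt/qt, the tangent-line bound
   p ln (p/q) >= p r(v) + p - q rho(v) is averaged over x and then over y. *)
Lemma kl_conv_le p q t c : nice p -> nice q -> lgrow t -> J p = J q ->
  nice (conv p t) -> nice (conv q t) -> (forall x, p x <= c * q x) ->
  kl (conv p t) (conv q t) <= kl p q.
Proof.
move=> np nq lt Jpq npt nqt pq.
have p0 x : 0 < p x := nice_gt0 x np. have q0 x : 0 < q x := nice_gt0 x nq.
have pt0 x : 0 < conv p t x := nice_gt0 x npt.
have qt0 x : 0 < conv q t x := nice_gt0 x nqt.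
have gp := np.1; have gq := nq.1; have gpt := npt.1; have gqt := nqt.1.
pose r v := ln (conv p t v) - ln (conv q t v).
have qr : qbd r by apply: qbdB; exact: qbd_ln.
pose rho v := expR (r v).
have rho0 x : 0 < rho x by exact: expR_gt0.
have rhoE v : rho v = conv p t v / conv q t v.
  by rewrite /rho /r -ln_div ?posrE// lnK// posrE divr_gt0.
(* The domination of p by [c * q] passes to the outputs. It bounds rho, which is thereby admissible
   as a test function for q. *)
have ptqt v : conv p t v <= c * conv q t v.
  rewrite /conv -JZ; last exact: gdom_phi_shift.
  apply: leJ; [exact: gdom_phi_shift|by apply: gdomZ; exact: gdom_phi_shift|move=> x].
  by rewrite mulrCA ler_wpM2l.
have qrho : qbd rho.
  apply: (@qbd_bounded _ _ c); first exact: (measurableT_comp (@measurable_expR _) qr.1).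
  by move=> v; rewrite gtr0_norm// rhoE ler_pdivrMr.
(* The two added terms cancel: [q * avg rho] integrates to the mass of [conv q t * rho = conv p t],
   which is the mass of p. *)
have -> : kl (conv p t) (conv q t) =
    J (fun y => (p y * avg r t y + p y) - q y * avg rho t y).
  rewrite JB ?JD; last 4 first.
  - by apply: gdomM => //; exact: qbd_avg.
  - exact: gp.
  - by apply: gdomD => //; apply: gdomM => //; exact: qbd_avg.
  - by apply: gdomM => //; exact: qbd_avg.
  rewrite !J_conv// => [|x|x]; [|exact: ltW|exact: ltW].
  rewrite -/(kl _ _) -(@J_conv1 p t)// => [|x]; last exact: ltW.
  rewrite -[LHS]addr0 -addrA; congr (_ + _); apply/esym/eqP; rewrite subr_eq0; apply/eqP.
  by apply: eqJ => v; rewrite rhoE mulrC divfK// gt_eqF.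
apply: leJ.
- apply: gdomB; last by apply: gdomM => //; exact: qbd_avg.
  by apply: gdomD => //; apply: gdomM => //; exact: qbd_avg.
- by apply: gdomM => //; apply: qbdB; exact: qbd_ln.
move=> y; rewrite -[leRHS](avg_cst _ t y) /avg.
have gr := gdom_phi_comp y qr lt; have grh := gdom_phi_comp y qrho lt.
rewrite -{2}[p y](avg_cst _ t y) /avg -!JZ// -?JD// -?JB//.
- apply: leJ.
  + apply: gdomB; last exact: gdomZ.
    apply: gdomD; first exact: gdomZ.
    by apply: gdomM => //; exact: qbd_cst.
  + by apply: gdomM => //; exact: qbd_cst.
  move=> x; have := mul_ln_ratio_le (p0 y) (mulr_gt0 (q0 y) (rho0 (y + t x))).
  rewrite lnM ?posrE// expRK => h.
  have -> : p y * (phi x * r (y + t x)) + phi x * p y - q y * (phi x * rho (y + t x)) =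
    phi x * (p y * r (y + t x) + p y - q y * rho (y + t x)) by ring.
  by rewrite ler_wpM2l//; lra.
- apply: gdomD; first exact: gdomZ.
  by apply: gdomM => //; exact: qbd_cst.
- exact: gdomZ.
- exact: gdomZ.
- by apply: gdomM => //; exact: qbd_cst.
Qed.

End Noise.

(** * Calculus on the line and the normal distribution function *)

Section LineCalculus.
Variable R : realType.
Local Notation mu := (@lebesgue_measure R).
Implicit Types (f F g : R -> R) (a b c m s v x y : R).

Lemma is_derive_comp1 f g (df dg : R) x :
  is_derive x 1 f df -> is_derive (f x) 1 g dg -> is_derive x 1 (g \o f) (dg * df).
Proof.
move=> [f1 f2] [g1 g2]; apply: DeriveDef.
  apply/derivable1_diffP/differentiable_comp; apply/derivable1_diffP; [exact: f1|exact: g1].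
by rewrite -derive1E (derive1_comp f1 g1) !derive1E f2 g2.
Qed.

Lemma is_derive_continuous F f : (forall x, is_derive x 1 F (f x)) -> continuous F.
Proof. by move=> dF x; apply/differentiable_continuous/derivable1_diffP; case: (dF x). Qed.

Definition prim g : R -> R := fun v => \int[mu]_(x in `]-oo, v]) g x.

Lemma is_derive_prim g v : gdom g -> continuous g -> is_derive v 1 (prim g) (g v).
Proof.
move=> gg cg.
have ig : mu.-integrable `]-oo, v + 1] (EFin \o g).
  by apply: integrableS (gdom_integrable gg).
have vv : v < v + 1 by rewrite ltrDl.
have [d1 d2] := @continuous_FTC1 R g -oo%O v (v + 1) vv ig (ltNyr _) (cg v).
by apply: DeriveDef; [exact: d1|rewrite -derive1E; exact: d2].
Qed.

Lemma prim_ge0 g v : (forall x, 0 <= g x) -> 0 <= prim g v.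
Proof. by move=> g0; apply: Rintegral_ge0. Qed.

Lemma prim_leJ g v : gdom g -> (forall x, 0 <= g x) -> prim g v <= J g.
Proof.
move=> gg g0; rewrite /prim /J /Rintegral fine_le//.
- apply: integrable_fin_num => //; apply: integrableS (gdom_integrable gg) => //.
- apply: integrable_fin_num => //; exact: gdom_integrable.
- apply: ge0_subset_integral => //.
  + by apply/measurable_EFinP; exact: gg.1.
  + by move=> x _; rewrite lee_fin.
Qed.

Lemma integral_line_cvg f : measurable_fun setT f -> (forall x, 0 <= f x) ->
  (\int[mu]_(x in `[(- n%:R)%R, n%:R%R]) (f x)%:E)%E @[n --> \oo] --> (\int[mu]_x (f x)%:E)%E.
Proof.
move=> mf f0.
have -> : [set: R] = \bigcup_n `[- (n%:R : R), n%:R]%classic.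
  apply/seteqP; split=> // x _; have h := ltW (archi_boundP (normr_ge0 x)).
  by exists (Num.bound `|x|) => //=; rewrite in_itv/= -ler_norml.
apply: ge0_nondecreasing_set_cvg_integral => //.
- move=> m n mn; apply/subsetPset => x /=; rewrite !in_itv/= => /andP[h1 h2].
  by rewrite (le_trans _ h1) ?lerN2 ?ler_nat// (le_trans h2)// ler_nat.
- by move=> n; apply/measurable_EFinP; exact: measurable_funS mf.
- by move=> i x _; rewrite lee_fin.
Qed.

Lemma integral_seg f F a b : a <= b -> continuous f -> (forall x, is_derive x 1 F (f x)) ->
  (\int[mu]_(x in `[a, b]) (f x)%:E = (F b - F a)%:E)%E.
Proof.
move=> ab cf dF; move: ab; rewrite le_eqVlt => /predU1P[<-|ab].
  by rewrite set_itv1 integral_set1 subrr.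
have cF : continuous F := is_derive_continuous dF.
rewrite (@continuous_FTC2 _ f F)//.
- exact: continuous_subspaceT.
- split.
  + by move=> x _; case: (dF x).
  + exact/cvg_at_right_filter/cF.
  + exact/cvg_at_left_filter/cF.
- by move=> x _; rewrite derive1E; case: (dF x).
Qed.

Lemma integral_line f F (l : R) : continuous f -> (forall x, 0 <= f x) ->
  (forall x, is_derive x 1 F (f x)) ->
  (F n%:R - F (- n%:R)) @[n --> \oo] --> l -> (\int[mu]_x (f x)%:E = l%:E)%E.
Proof.
move=> cf f0 dF Fl.
have := integral_line_cvg (continuous_measurable_fun cf) f0.
under eq_fun => n do rewrite (@integral_seg f F)// ?(le_trans _ (ler0n R n)) ?oppr_le0//.
move=> h; apply: (cvg_unique _ h) => //.
apply: cvg_EFin => //; first by near=> n.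
Unshelve. all: by end_near. Qed.

Lemma integral_line_le f F (c : R) : continuous f -> (forall x, 0 <= f x) ->
  (forall x, is_derive x 1 F (f x)) ->
  (forall x y, F x - F y <= c) -> (\int[mu]_x (f x)%:E <= c%:E)%E.
Proof.
move=> cf f0 dF Fl.
have := integral_line_cvg (continuous_measurable_fun cf) f0.
under eq_fun => n do rewrite (@integral_seg f F)// ?(le_trans _ (ler0n R n)) ?oppr_le0//.
move=> h; rewrite -(cvg_lim _ h)//; apply: lime_le.
  by apply/cvg_ex; eexists; exact: h.
by near=> n; rewrite lee_fin.
Unshelve. all: by end_near. Qed.

(** The integral over a segment is an increment of [prim g] along th, hence at most [J g]. Since th
    may miss part of the line, only an inequality is claimed. *)
Lemma integral_subst_le g (th dth : R -> R) : gdom g -> continuous g -> (forall x, 0 <= g x) ->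
  (forall x, is_derive x 1 th (dth x)) -> continuous dth -> (forall x, 0 <= dth x) ->
  (\int[mu]_x (g (th x) * dth x)%:E <= (J g)%:E)%E.
Proof.
move=> gg cg g0 dt ct t0.
have cth : continuous th := is_derive_continuous dt.
apply: (@integral_line_le _ (prim g \o th)).
- move=> x; apply: cvgM; last exact: ct.
  by apply: continuous_comp; [exact: cth|exact: cg].
- by move=> x; rewrite mulr_ge0.
- move=> x; have dp := is_derive_prim (th x) gg cg.
  exact: is_derive_comp1.
- by move=> x y /=; rewrite (le_trans (_ : _ <= prim g (th x)))// ?prim_leJ// gerBl prim_ge0.
Qed.

Local Notation phi := (@phi R).

Definition Phi : R -> R := prim phi.

Lemma phi_gt0 x : 0 < phi x. Proof. exact: normal_pdf_gt0. Qed.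

Lemma phiN x : phi (- x) = phi x.
Proof. by rewrite /phi !normal_pdfE ?oner_eq0// /normal_fun !subr0 sqrrN. Qed.

Lemma continuous_phi : continuous phi. Proof. by apply: continuous_normal_pdf;
  rewrite oner_eq0. Qed.

Lemma is_derive_Phi x : is_derive x 1 Phi (phi x).
Proof. by apply: is_derive_prim; [exact: gdom_normal|exact: continuous_phi]. Qed.

Lemma continuous_Phi : continuous Phi.
Proof. exact: is_derive_continuous is_derive_Phi. Qed.

Lemma Phi_incr : {homo Phi : x y / x < y}.
Proof.
move=> x y xy.
have cP : {within `[x, y], continuous Phi} by apply: continuous_subspaceT; exact: continuous_Phi.
have [z _ e] := @MVT _ Phi phi x y xy (fun z _ => is_derive_Phi z) cP.
by rewrite -subr_gt0 e mulr_gt0 ?phi_gt0// subr_gt0.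
Qed.

Lemma Phi_inj : injective Phi.
Proof.
move=> x y; have [/Phi_incr h|/Phi_incr h|//] := ltgtP x y; move=> e; by rewrite e ltxx in h.
Qed.

Lemma Phi_le : {mono Phi : x y / x <= y}.
Proof. by apply: le_mono; exact: Phi_incr. Qed.

Lemma Phi_gt0 x : 0 < Phi x.
Proof.
apply: (@le_lt_trans _ _ (Phi (x - 1))); last by apply: Phi_incr; rewrite gtrBl.
by apply: prim_ge0 => y; exact/ltW/phi_gt0.
Qed.

Lemma Phi_lt1 x : Phi x < 1.
Proof.
apply: (@lt_le_trans _ _ (Phi (x + 1))); first by apply: Phi_incr; rewrite ltrDl.
by rewrite -(@J_normal R 0 1); apply: prim_leJ; [exact: gdom_normal|move=> y; exact/ltW/phi_gt0].
Qed.

Lemma cvg_Phi_diff : (Phi n%:R - Phi (- n%:R)) @[n --> \oo] --> (1 : R).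
Proof.
have := integral_line_cvg (continuous_measurable_fun continuous_phi) (fun x => ltW (phi_gt0 x)).
under eq_fun => n do rewrite (@integral_seg phi Phi _ _ _ continuous_phi is_derive_Phi) ?(le_trans _ (ler0n R n)) ?oppr_le0//.
rewrite integral_normal_pdf => h; exact: (fine_cvg h).
Qed.

Lemma cvg_Phi_pinfty : Phi n%:R @[n --> \oo] --> (1 : R).
Proof.
apply: (squeeze_cvgr _ cvg_Phi_diff); last exact: cvg_cst.
near=> n; rewrite (ltW (Phi_lt1 _)) andbT gerBl; exact/ltW/Phi_gt0.
Unshelve. all: by end_near. Qed.

Lemma cvg_Phi_ninfty : Phi (- n%:R) @[n --> \oo] --> (0 : R).
Proof.
have := cvgB cvg_Phi_pinfty cvg_Phi_diff; rewrite subrr.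
by move=> /(_ _); rewrite (_ : _ - _ = fun n : nat => Phi (- n%:R)) => [h|];
  [exact: h|apply/funext => n; rewrite !fctE opprB addrC subrK].
Qed.

Lemma PhiN x : Phi (- x) = 1 - Phi x.
Proof.
pose h := fun y => Phi y + Phi (- y).
have dh y : is_derive y 1 h 0.
  have d1 := is_derive_Phi y; have d2 := is_derive_Phi (- y).
  have d3 : is_derive y (1 : R) (Phi \o -%R) (-1 * phi (- y)).
    by rewrite mulrC; apply: is_derive_comp1.
  have -> : 0 = phi y + -1 * phi (- y) by rewrite phiN mulN1r subrr.
  exact: is_deriveD.
have hc y : h y = h 0 by apply: is_derive_0_is_cst dh.
(* As h is constant, its value is the limit of [h n%:R], namely 1 + 0. *)
have h1 : h 0 = 1.
  have : h n%:R @[n --> \oo] --> (1 + 0 : R).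
    by apply: cvgD; [exact: cvg_Phi_pinfty|exact: cvg_Phi_ninfty].
  under eq_fun do rewrite hc.
  rewrite addr0 => h1; apply: (cvg_unique _ _ h1) => //; exact: cvg_cst.
by rewrite -h1 -(hc x) /h [Phi x + _]addrC addrK.
Qed.

(** Phi(X) is uniform on [0, 1], so the left side is the integral of h over that interval, with
    primitive H. *)
Lemma J_Phi_comp (h H : R -> R) : continuous h -> (forall x, is_derive x 1 H (h x)) ->
  (forall u, 0 <= u <= 1 -> 0 <= h u) ->
  J (fun x => phi x * h (Phi x)) = H 1 - H 0.
Proof.
move=> ch dH h0.
have cH : continuous H := is_derive_continuous dH.
have cf : continuous (fun x => phi x * h (Phi x)).
  move=> x; apply: cvgM; first exact: continuous_phi.
  by apply: continuous_comp; [exact: continuous_Phi|exact: ch].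
have f0 x : 0 <= phi x * h (Phi x).
  by rewrite mulr_ge0 ?(ltW (phi_gt0 _))// h0// !ltW ?Phi_gt0 ?Phi_lt1.
have dF x : is_derive x 1 (H \o Phi) (phi x * h (Phi x)).
  by rewrite mulrC; exact: is_derive_comp1 (is_derive_Phi x) (dH (Phi x)).
have Fl : ((H \o Phi) n%:R - (H \o Phi) (- n%:R)) @[n --> \oo] --> H 1 - H 0.
  apply: cvgB.
    by apply: continuous_cvg; [exact: cH|exact: cvg_Phi_pinfty].
  by apply: continuous_cvg; [exact: cH|exact: cvg_Phi_ninfty].
by rewrite /J /Rintegral (integral_line cf f0 dF Fl).
Qed.

Lemma Qfun_Phi x : Qfun x = 1 - Phi x.
Proof.
rewrite /Qfun /normal_prob -PhiN /Phi /prim /Rintegral; congr fine.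
rewrite (_ : `]-oo, - x]%classic = (-%R : R -> R) @^-1` `[x, +oo[%classic); last first.
  by rewrite opp_preimage_itvbndy.
rewrite [RHS]integral_mkcond [LHS]integral_mkcond.
rewrite -(@ge0_integral_opp R (((fun x => (normal_pdf 0 1 x)%:E) \_ `[x, +oo[))%E).
- apply: eq_integral => y _; rewrite /patch /phi.
  have -> : ((- y) \in `[x, +oo[%classic) = (y \in -%R @^-1` `[x, +oo[%classic).
    by apply/idP/idP; rewrite !inE.
  by case: ifP => // _; congr EFin; exact: (phiN y).
- apply/(measurable_restrictT _ _).1 => //; apply/measurable_EFinP.
  exact: measurable_funS (measurable_normal_pdf 0 1).
- by move=> y; rewrite /patch; case: ifP => // _; rewrite lee_fin normal_pdf_ge0.
Qed.

End LineCalculus.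

(** * Entropy, PAM densities and uniform dither *)

Section Densities.
Variable R : realType.
Local Notation phi := (@phi R).
Local Notation Phi := (@Phi R).
Implicit Types (f g p q t : R -> R) (a b c d m s v x y : R) (K : nat).

Definition ent f := - J (fun y => f y * ln (f y)).

Lemma nice_ge f g c : 0 < c -> nice f -> gdom g -> (forall y, c * f y <= g y) -> nice g.
Proof.
move=> c0 [gf [C hC]] gg fg; split=> //; exists (C + `|ln c|) => y.
apply: le_trans (fg y); rewrite -[c in leRHS]lnK ?posrE//.
apply: (@le_trans _ _ (expR (ln c) * expR (- (C * (1 + y ^+ 2))))); last first.
  by rewrite ler_wpM2l ?expR_ge0.
rewrite -expRD ler_expR mulrDl opprD addrC lerD2r lerNl.
apply: (@le_trans _ _ `|ln c|); first by rewrite -normrN ler_norm.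
by rewrite ler_peMr// lerDl sqr_ge0.
Qed.

Lemma lgrow_bounded t b : measurable_fun setT t -> (forall x, `|t x| <= b) -> lgrow t.
Proof.
move=> mt tb; split=> //; exists (b ^+ 2) => x.
apply: (@le_trans _ _ (b ^+ 2)); last by rewrite ler_peMr ?sqr_ge0// lerDl sqr_ge0.
by rewrite -(real_normK (num_real (t x))) lerXn2r ?nnegrE// (le_trans _ (tb x)).
Qed.

Lemma lgrow_scale b : lgrow (fun x => b * x).
Proof.
split; first exact: (@measurable_funM _ _ _ _ (cst b)).
by exists (b ^+ 2) => x; rewrite exprMn ler_wpM2l ?sqr_ge0// lerDr.
Qed.

Lemma conv_shift f t m y : conv (fun z => f (z - m)) t y = conv f t (y - m).
Proof. by apply: eqJ => x; rewrite addrAC. Qed.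

(** A shift bounded by b costs only constants, since [(y - t)^2] lies between [y^2 / 2 - b^2] and
    [2 y^2 + 2 b^2]. *)
Lemma nice_conv f t b : nice f -> measurable_fun setT t -> (forall x, `|t x| <= b) ->
  nice (conv f t).
Proof.
move=> nf mt tb; have gf := nf.1.
have lt : lgrow t := lgrow_bounded mt tb.
have lNt : lgrow (fun x => - t x).
  by apply: (@lgrow_bounded _ b); [exact: measurableT_comp|move=> x; rewrite normrN].
have [C1 C10 fC1] := gdom_bounded gf.
have qf : qbd f by apply: (@qbd_bounded _ _ C1) => //; exact: gf.1.
have [D D0 [c c0 hD]] := gdom_bound gf.
have gpt y : gdom (fun x => phi x * f (y - t x)) by exact: gdom_phi_shift.
have gphi : gdom phi by exact: gdom_normal.
have b0 : 0 <= b by apply: le_trans (tb 0).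
have t2 x : t x ^+ 2 <= b ^+ 2.
  by rewrite -(real_normK (num_real (t x))) lerXn2r ?nnegrE// (le_trans _ (tb x)).
have phi0 x : 0 <= phi x by exact/ltW/phi_gt0.
split; first split; first exact: (measurable_avg qf lNt).
  exists (D * expR (c * b ^+ 2)), (c / 2); first by rewrite divr_gt0.
  move=> y; rewrite ger0_norm; last first.
    by apply: J_ge0 => x; rewrite mulr_ge0// ltW// nice_gt0.
  rewrite -[leRHS]mulr1 -[X in _ <= _ * X](@J_normal R 0 1) -JZ//.
  apply: leJ => //; first exact: gdomZ.
  move=> x; rewrite mulrC ler_wpM2r//.
  apply: (le_trans (ler_norm _)); apply: (le_trans (hD _)).
  rewrite -[leRHS]mulrA ler_wpM2l ?(ltW D0)// -expRD ler_expR.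
  have h1 : 0 <= c * (y - 2 * t x) ^+ 2 by rewrite mulr_ge0 ?sqr_ge0 ?(ltW c0).
  have h2 : 0 <= c * (b ^+ 2 - t x ^+ 2) by rewrite mulr_ge0 ?subr_ge0 ?(ltW c0).
  have -> : c * b ^+ 2 + - (c / 2 * y ^+ 2) =
    - (c * (y - t x) ^+ 2) + (c * (y - 2 * t x) ^+ 2) / 2 + c * (b ^+ 2 - t x ^+ 2) by field.
  by rewrite -addrA lerDl addr_ge0// divr_ge0.
have [_ [C hC]] := nf.
exists (`|C| * (2 + 2 * b ^+ 2)) => y.
rewrite -[leLHS]mulr1 -[X in _ * X <= _](@J_normal R 0 1) -JZ//.
apply: leJ => //; first exact: gdomZ.
move=> x; rewrite mulrC -[normal_pdf 0 1 x]/(phi x) ler_wpM2l//.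
apply: (le_trans _ (hC _)).
rewrite ler_expR lerN2.
apply: (@le_trans _ _ (`|C| * (1 + (y - t x) ^+ 2))).
  by rewrite ler_wpM2r ?ler_norm// addr_ge0// sqr_ge0.
rewrite -mulrA ler_wpM2l//.
have h1 := sqr_ge0 (y + t x); have h2 := t2 x.
have h3 : 0 <= b ^+ 2 * y ^+ 2 by rewrite mulr_ge0 ?sqr_ge0.
have h4 : (y - t x) ^+ 2 + (y + t x) ^+ 2 = 2 * y ^+ 2 + 2 * t x ^+ 2 by ring.
have -> : (2 + 2 * b ^+ 2) * (1 + y ^+ 2) =
  2 + 2 * y ^+ 2 + 2 * b ^+ 2 + 2 * (b ^+ 2 * y ^+ 2) by ring.
lra.
Qed.

Lemma ent_shift f m : nice f -> ent (fun y => f (y - m)) = ent f.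
Proof.
move=> nf; congr (- _); apply: (J_shift m (f := fun y => f y * ln (f y))).
by apply: gdomM; [exact: nf.1|exact: qbd_ln].
Qed.

Lemma conv_sum n (c : R) (p : 'I_n -> R -> R) t y : (forall i, gdom (p i)) -> lgrow t ->
  conv (fun z => c * \sum_(i < n) p i z) t y = c * \sum_(i < n) conv (p i) t y.
Proof.
move=> gp lt; rewrite /conv -J_sum => [|i _]; last exact: gdom_phi_shift.
rewrite -JZ; last by apply: gdom_sum => i _; exact: gdom_phi_shift.
by apply: eqJ => x; rewrite mulrCA mulr_sumr.
Qed.

(* Jensen-Shannon form of the mutual information between a uniform index and
   the output: it equals the average of the divergences kl (p i) q. *)
Lemma avg_kl n (p : 'I_n -> R -> R) q : (0 < n)%N -> (forall i, nice (p i)) -> nice q ->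
  (forall y, q y = n%:R^-1 * \sum_(i < n) p i y) ->
  ent q - n%:R^-1 * (\sum_(i < n) ent (p i)) = n%:R^-1 * (\sum_(i < n) kl (p i) q).
Proof.
move=> n0 np nq qE; have lq := qbd_ln nq.
have gpl i : gdom (fun y => p i y * ln (p i y)).
  by apply: gdomM; [exact: (np i).1|exact: qbd_ln].
have gpq i : gdom (fun y => p i y * ln (q y)) by apply: gdomM; [exact: (np i).1|].
have -> : ent q = - (n%:R^-1 * \sum_(i < n) J (fun y => p i y * ln (q y))).
  rewrite /ent; congr (- _); rewrite -J_sum => [|i _]; last exact: gpq.
  rewrite -JZ; last by apply: gdom_sum => i _; exact: gpq.
  by apply: eqJ => y; rewrite {1}qE -mulrA mulr_suml.
rewrite -mulrN -mulrBr; congr (_ * _); rewrite -sumrN -sumrB; apply: eq_bigr => i _.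
rewrite /ent opprK addrC -JB => [|//|//].
by apply: eqJ => y; rewrite mulrBr.
Qed.

(** By [avg_kl] both sides are averages of divergences, compared one by one with [kl_conv_le]; its
    domination constant is n because each component has weight 1/n in q. *)
Lemma data_processing n (p : 'I_n -> R -> R) q t : (0 < n)%N -> lgrow t ->
  (forall i, nice (p i)) -> nice q -> (forall i, J (p i) = 1) ->
  (forall i, nice (conv (p i) t)) -> nice (conv q t) ->
  (forall y, q y = n%:R^-1 * \sum_(i < n) p i y) ->
  ent (conv q t) - n%:R^-1 * (\sum_(i < n) ent (conv (p i) t)) <=
  ent q - n%:R^-1 * (\sum_(i < n) ent (p i)).
Proof.
move=> n0 lt np nq Jp npt nqt qE.
have gp i : gdom (p i) by exact: (np i).1.
have nn0 : n%:R != 0 :> R by rewrite pnatr_eq0 -lt0n.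
have Jq : J q = 1.
  transitivity (J (fun y => n%:R^-1 * \sum_(i < n) p i y)); first exact: eqJ.
  rewrite JZ ?J_sum//; last by apply: gdom_sum.
  by under eq_bigr do rewrite Jp; rewrite sumr_const card_ord mulVf.
rewrite !avg_kl//; last first.
  move=> y; rewrite -conv_sum//; apply: eqJ => x; by rewrite qE.
rewrite ler_wpM2l ?invr_ge0//; apply: ler_sum => i _.
apply: (@kl_conv_le _ _ _ _ n%:R) => //; first by rewrite Jp Jq.
move=> x; rewrite qE mulrA divff// mul1r (bigD1 i)//= lerDl sumr_ge0// => j _.
exact/ltW/nice_gt0.
Qed.

(** The entropy of N(0, s^2) in nats, [ln (s * sqrt (2 pi e))]: here [normal_peak 1] is
    [1 / sqrt (2 pi)]. *)
Definition gent s : R := 2^-1 + ln s - ln (normal_peak 1).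

Lemma J_normal_quad m s (c0 c1 c2 : R) : 0 < s ->
  J (fun x => normal_pdf m s x * (c0 + c1 * x + c2 * x ^+ 2)) =
  c0 + c1 * m + c2 * (m ^+ 2 + s ^+ 2).
Proof.
move=> s0; rewrite J_normalM//; last exact: qbd_quad.
transitivity (J (fun x => phi x * ((c0 + c1 * m + c2 * m ^+ 2) +
    (c1 * s + 2 * c2 * s * m) * x + (c2 * s ^+ 2) * x ^+ 2))).
  by apply: eqJ => x; congr (_ * _); ring.
by rewrite J_phi_quad; ring.
Qed.

Lemma ent_normal m s : 0 < s -> ent (normal_pdf m s) = gent s.
Proof.
move=> s0; pose k : R := ln (normal_peak 1).
have -> : ent (normal_pdf m s) = - J (fun x => normal_pdf m s x * ((k - ln s - m ^+ 2 / (2 * s ^+ 2)) +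
   (m / s ^+ 2) * x + (- (2 * s ^+ 2)^-1) * x ^+ 2)).
  congr (- _); apply: eqJ => x; congr (_ * _); rewrite ln_normal_pdf// -/k.
  by field; rewrite gt_eqF.
by rewrite J_normal_quad// /gent -/k; field; rewrite gt_eqF.
Qed.

(** Gibbs' inequality against a normal density, whose logarithm is quadratic. The centre m is free,
    so the second moment may be bounded about any convenient point. *)
Lemma max_entropy f m s : 0 < s -> nice f -> J f = 1 ->
  J (fun y => f y * (y - m) ^+ 2) <= s ^+ 2 -> ent f <= gent s.
Proof.
move=> s0 nf Jf var; have gf := nf.1.
have := gibbs nf (gdom_normal m s0) (fun x => normal_pdf_gt0 m x s0)
  (qbd_ln (nice_normal m s0)).
rewrite J_normal Jf lexx => /(_ isT) h; rewrite /ent.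
apply: (le_trans (_ : _ <= - J (fun x => f x * ln (normal_pdf m s x)))); first by rewrite lerN2.
have qv : qbd (fun y => (y - m) ^+ 2) := qbd_shift m (@qbd_sqr R).
have -> : J (fun x => f x * ln (normal_pdf m s x)) =
  (ln (normal_peak 1) - ln s) * J f - (2 * s ^+ 2)^-1 * J (fun y => f y * (y - m) ^+ 2).
  rewrite -JZ// -[X in _ - X]JZ; last exact: gdomM.
  rewrite -JB; [|exact: gdomZ|by apply: gdomZ; exact: gdomM].
  by apply: eqJ => x; rewrite ln_normal_pdf//; ring.
rewrite Jf /gent mulr1 opprB addrC [leLHS]addrC.
have : (2 * s ^+ 2)^-1 * J (fun y => f y * (y - m) ^+ 2) <= (2 * s ^+ 2)^-1 * s ^+ 2.
  by rewrite ler_wpM2l// invr_ge0 mulr_ge0// sqr_ge0.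
have -> : (2 * s ^+ 2)^-1 * s ^+ 2 = 2^-1 by field; rewrite gt_eqF.
lra.
Qed.

Definition pam K d s : R -> R := fun y => K%:R^-1 * \sum_(i < K) normal_pdf (d * i%:R) s y.

Lemma gdom_pam K d s : 0 < s -> gdom (pam K d s).
Proof. by move=> s0; apply: gdomZ; apply: gdom_sum => i _; exact: gdom_normal. Qed.

Lemma nice_pam K d s : (0 < K)%N -> 0 < s -> nice (pam K d s).
Proof.
move=> K0 s0; apply: (@nice_ge (normal_pdf 0 s) _ K%:R^-1).
- by rewrite invr_gt0 ltr0n.
- exact: nice_normal.
- exact: gdom_pam.
move=> y; rewrite ler_wpM2l ?invr_ge0//.
case: K K0 => // K _; rewrite big_ord_recl/= mulr0 lerDl sumr_ge0// => i _.
exact: normal_pdf_ge0.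
Qed.

Lemma J_pam K d s : (0 < K)%N -> 0 < s -> J (pam K d s) = 1.
Proof.
move=> K0 s0; rewrite JZ ?J_sum//; last 2 first.
- by move=> i _; exact: gdom_normal.
- by apply: gdom_sum => i _; exact: gdom_normal.
under eq_bigr do rewrite J_normal.
by rewrite sumr_const card_ord mulVf// pnatr_eq0 -lt0n.
Qed.

Lemma normal_pdf_shift m c s y : 0 < s -> normal_pdf (m + c) s y = normal_pdf m s (y - c).
Proof.
move=> s0; rewrite !normal_pdfE ?gt_eqF// /normal_fun.
by have -> : y - (m + c) = y - c - m by ring.
Qed.

(* the density of U + Z with U uniform on [0, b] and Z ~ N(0, s^2) independent *)
Definition um b s : R -> R := conv (normal_pdf 0 s) (fun x => b * Phi x).

Lemma scale_Phi_bounded b x : 0 < b -> `|b * Phi x| <= b.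
Proof.
move=> b0; rewrite ger0_norm ?mulr_ge0 ?(ltW b0) ?(ltW (Phi_gt0 x))//.
by rewrite ger_pMr// ltW// Phi_lt1.
Qed.

Lemma measurable_scale_Phi b : measurable_fun setT (fun x => b * Phi x).
Proof.
apply: (@measurable_funM _ _ _ _ (cst b)) => //.
by apply: continuous_measurable_fun; exact: continuous_Phi.
Qed.

Lemma lgrow_scale_Phi b : 0 < b -> lgrow (fun x => b * Phi x).
Proof.
by move=> b0; apply: (@lgrow_bounded _ b); [exact: measurable_scale_Phi|move=> x;
  exact: scale_Phi_bounded].
Qed.

Lemma nice_conv_Phi f b : 0 < b -> nice f -> nice (conv f (fun x => b * Phi x)).
Proof.
move=> b0 nf; apply: (@nice_conv _ _ b) => //; first exact: measurable_scale_Phi.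
by move=> x; exact: scale_Phi_bounded.
Qed.

(** With [u = Phi x] the average becomes an integral over [0, 1] of a normal density in an affine
    function of u, whose primitive is again an affine image of Phi. *)
Lemma conv_normal_Phi m s b y : 0 < b -> 0 < s ->
  conv (normal_pdf m s) (fun x => b * Phi x) y =
  (Phi ((y - m) / s) - Phi ((y - m - b) / s)) / b.
Proof.
move=> b0 s0.
pose h u := normal_pdf m s (y - b * u).
pose l u := (- b / s) * u + (y - m) / s.
have dl u : is_derive u (1 : R) l (- b / s).
  have h1 := is_deriveD (is_deriveZ (- b / s) (is_derive_id u (1 : R)))
    (is_derive_cst ((y - m) / s) u (1 : R)).
  by apply: (is_derive_eq h1); rewrite addr0 scaler1.
have -> : (Phi ((y - m) / s) - Phi ((y - m - b) / s)) / b =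
  (fun u => (- b^-1) * Phi (l u)) 1 - (fun u => (- b^-1) * Phi (l u)) 0.
  rewrite /l /= mulr0 mulr1 add0r.
  have -> : - b / s + (y - m) / s = (y - m - b) / s by ring.
  by ring.
have c1 : continuous h.
  move=> u; apply: (@continuous_comp _ _ _ (fun u => y - b * u) (normal_pdf m s)).
    apply: (@cvgB _ R^o); first exact: cvg_cst.
    by apply: (@cvgM _ R^o); [exact: cvg_cst|exact: cvg_id].
  by apply: continuous_normal_pdf; rewrite gt_eqF.
have d1 u : is_derive u (1 : R) (fun u => (- b^-1) * Phi (l u)) (h u).
  have := is_derive_comp1 (dl u) (is_derive_Phi (l u)).
  move=> /(@is_deriveZ _ _ _ (Phi \o l) (- b^-1)).
  have -> // : (- b^-1) *: (phi (l u) * (- b / s)) = h u.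
  rewrite -(@normal_pdf_affine _ m s)// /h.
  have -> : s * l u + m = y - b * u by rewrite /l; field; rewrite gt_eqF.
  by rewrite /GRing.scale/=; field; rewrite !gt_eqF.
have h0 u : 0 <= u <= 1 -> 0 <= h u by move=> _; exact: normal_pdf_ge0.
exact: (J_Phi_comp c1 d1 h0).
Qed.

(** The intervals [[d i, d (i + 1)]] tile [[0, K d]]; on densities this is a telescoping sum of
    values of Phi. *)
Lemma conv_pam_Phi K d s y : (0 < K)%N -> 0 < d -> 0 < s ->
  conv (pam K d s) (fun x => d * Phi x) y = um (K%:R * d) s y.
Proof.
move=> K0 d0 s0; have K0' : 0 < K%:R :> R by rewrite ltr0n.
rewrite conv_sum; [|by move=> i; exact: gdom_normal|exact: lgrow_scale_Phi].
rewrite /um conv_normal_Phi ?mulr_gt0//.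
pose P i := Phi ((y - d * i%:R) / s).
under eq_bigr => i _.
  rewrite conv_normal_Phi// -/(P i).
  have -> : y - d * i%:R - d = y - d * i.+1%:R by rewrite -natr1; ring.
  rewrite -/(P i.+1) -opprB mulNr; over.
rewrite sumrN -mulr_suml -(big_mkord xpredT (fun i => P i.+1 - P i)) telescope_sumr//.
by rewrite /P mulr0 (mulrC d) subr0; field; rewrite !gt_eqF.
Qed.

End Densities.

(** * Upper bounds on output entropies *)

Section UpperBounds.
Variable R : realType.
Local Notation mu := (@lebesgue_measure R).
Local Notation phi := (@phi R).
Local Notation Phi := (@Phi R).
Implicit Types (f g p q t : R -> R) (a b c d m s v x y : R) (K : nat).

(** After exchanging the integrals, a bound uniform in the shift [t x] is averaged against phi. *)
Lemma J_avg_le f g t c : gdom f -> (forall x, 0 <= f x) -> qbd g -> (forall x, 0 <= g x) ->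
  lgrow t -> (forall x, gdom (fun y => f y * g (y + t x)) /\ J (fun y => f y * g (y + t x)) <= c) ->
  J (fun y => f y * avg g t y) <= c.
Proof.
move=> gf f0 qg g0 lt hc; have phi0 x : 0 <= phi x by exact/ltW/phi_gt0.
have mF := measurable_phi_mul_comp gf.1 qg.1 lt.1; rewrite -lee_fin EFin_J_avg//.
have gc : gdom (fun x => phi x * c) by apply: gdomM; [exact: gdom_normal|exact: qbd_cst].
have c0 : 0 <= c by apply: le_trans (hc 0).2; apply: J_ge0 => y; rewrite mulr_ge0.
apply: (@le_trans _ _ (\int[mu]_x (phi x * c)%:E)%E).
  apply: ge0_le_integral => //.
  - by move=> x _; apply: integral_ge0 => y _; rewrite lee_fin !mulr_ge0.
  - apply: (@measurable_fun_fubini_tonelli_F _ _ _ _ _ mu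
      (fun z : R * R => (phi z.1 * (f z.2 * g (z.2 + t z.1)))%:E)) => //.
    by move=> z; rewrite lee_fin !mulr_ge0.
  - by apply/measurable_EFinP; exact: gc.1.
  move=> x _; have [gx hx] := hc x.
  by rewrite /= -EFin_J; [rewrite JZ// lee_fin ler_wpM2l|exact: gdomZ].
rewrite -EFin_J// lee_fin.
have -> : J (fun x => phi x * c) = J (fun x => c * phi x) by apply: eqJ => x; rewrite mulrC.
by rewrite JZ ?J_normal ?mulr1//; exact: gdom_normal.
Qed.

(* f is the density of T + Z with T supported in [0, a] and Z ~ N(0, s^2) independent *)
Definition noisy_peak s a f := forall g c, qbd g -> (forall x, 0 <= g x) ->
  (forall m, 0 <= m <= a -> J (fun y => normal_pdf m s y * g y) <= c) ->
  J (fun y => f y * g y) <= c.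

Lemma noisy_peak_pam K d s : (0 < K)%N -> 0 <= d -> 0 < s ->
  noisy_peak s ((K%:R - 1) * d) (pam K d s).
Proof.
move=> K0 d0 s0 g c qg g0 hc.
have gi (i : 'I_K) : gdom (fun y => normal_pdf (d * i%:R) s y * g y).
  by apply: gdomM => //; exact: gdom_normal.
rewrite (_ : J _ = K%:R^-1 * \sum_(i < K) J (fun y => normal_pdf (d * i%:R) s y * g y)); last first.
  rewrite -J_sum// -JZ; last exact: gdom_sum.
  by apply: eqJ => y; rewrite -mulrA mulr_suml.
rewrite ler_pdivrMl ?ltr0n// mulr_natl.
have -> : c *+ K = \sum_(i < K) c by rewrite sumr_const card_ord.
apply: ler_sum => i _; apply: hc; rewrite mulr_ge0//= mulrC ler_wpM2r//.
by rewrite lerBrDr natr1 ler_nat.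
Qed.

Lemma noisy_peak_um b s : 0 < b -> 0 < s -> noisy_peak s b (um b s).
Proof.
move=> b0 s0 g c qg g0 hc.
have n0 x : 0 <= normal_pdf 0 s x by exact: normal_pdf_ge0.
have gn : gdom (normal_pdf 0 s) := gdom_normal 0 s0.
rewrite -J_conv//; [|exact: lgrow_scale_Phi|exact: (nice_conv_Phi b0 (nice_normal 0 s0)).1].
apply: J_avg_le => //; first exact: lgrow_scale_Phi.
move=> x; split.
  apply: gdomM => //; have := qbd_affine 1 (b * Phi x) qg.
  by congr qbd; apply/funext => y; rewrite mul1r.
apply: le_trans (hc (b * Phi x) _); last first.
  by rewrite mulr_ge0 ?(ltW b0) ?(ltW (Phi_gt0 x))//= ger_pMr// ltW// Phi_lt1.
rewrite le_eqVlt; apply/orP; left; apply/eqP.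
rewrite [RHS](@J_affine _ 1 (b * Phi x)) ?mul1r//; last by apply: gdomM => //; exact: gdom_normal.
apply: eqJ => y; rewrite !mul1r; congr (_ * _).
by rewrite -[X in _ = normal_pdf X _ _]add0r normal_pdf_shift// addrK.
Qed.

Let qbd_csqr m : qbd (fun y => (y - m) ^+ 2) := qbd_shift m (@qbd_sqr R).

Lemma J_normal_csqr m c s : 0 < s ->
  J (fun y => normal_pdf m s y * (y - c) ^+ 2) = (m - c) ^+ 2 + s ^+ 2.
Proof.
move=> s0; rewrite -[RHS](_ : c ^+ 2 + (- 2 * c) * m + 1 * (m ^+ 2 + s ^+ 2) = _); last by ring.
by rewrite -J_normal_quad//; apply: eqJ => y; congr (_ * _); ring.
Qed.

(** A variable in [0, a] is within a/2 of the midpoint, so its second moment about a/2 is at most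
    [a^2 / 4]. *)
Lemma ent_noisy_peak_sqr f s a : 0 < s -> 0 < a -> nice f -> J f = 1 -> noisy_peak s a f ->
  ent f <= gent (Num.sqrt (s ^+ 2 + a ^+ 2 / 4)).
Proof.
move=> s0 a0 nf Jf hf; have v0 : 0 < s ^+ 2 + a ^+ 2 / 4.
  by rewrite addr_gt0 ?divr_gt0 ?exprn_gt0.
apply: (@max_entropy _ f (a / 2)) => //; first by rewrite sqrtr_gt0.
rewrite sqr_sqrtr ?(ltW v0)//; apply: hf => // [x|t /andP[t0 ta]]; first exact: sqr_ge0.
rewrite J_normal_csqr// addrC lerD2l.
have : 0 <= t * (a - t) by rewrite mulr_ge0// subr_ge0.
by rewrite !expr2; lra.
Qed.

Lemma ent_um_var b s : 0 < b -> 0 < s -> ent (um b s) <= gent (Num.sqrt (s ^+ 2 + b ^+ 2 / 12)).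
Proof.
move=> b0 s0; have v0 : 0 < s ^+ 2 + b ^+ 2 / 12.
  by rewrite addr_gt0 ?divr_gt0 ?exprn_gt0.
have n0 x : 0 <= normal_pdf 0 s x by exact: normal_pdf_ge0.
have gn : gdom (normal_pdf 0 s) := gdom_normal 0 s0.
have nu : nice (um b s) := nice_conv_Phi b0 (nice_normal 0 s0).
apply: (@max_entropy _ _ (b / 2)) => //; first by rewrite sqrtr_gt0.
  by rewrite J_conv1 ?J_normal//; [exact: lgrow_scale_Phi|exact: nu.1].
rewrite sqr_sqrtr ?(ltW v0)// -J_conv//; [|exact: lgrow_scale_Phi|exact: nu.1].
have avgE y : avg (fun y => (y - b / 2) ^+ 2) (fun x => b * Phi x) y = b ^+ 2 / 12 + 0 * y + 1 * y ^+ 2.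
  pose h u := (y - b / 2 + b * u) ^+ 2.
  pose H u := (y - b / 2) ^+ 2 * u + (y - b / 2) * b * u ^+ 2 + b ^+ 2 / 3 * u ^+ 3.
  rewrite (_ : avg _ _ y = J (fun x => phi x * h (Phi x))); last first.
    by apply: eqJ => x; rewrite /h; congr (_ * _); ring.
  have ch : continuous h.
    move=> u; apply: (@continuous_comp _ _ _ (fun u => y - b / 2 + b * u) (fun z => z ^+ 2));
      last exact: exprn_continuous.
    apply: (@cvgD _ R^o); first exact: cvg_cst.
    by apply: (@cvgM _ R^o); [exact: cvg_cst|exact: cvg_id].
  have dH u : is_derive u (1 : R) H (h u).
    pose l v : R := y - b / 2 + b * v.
    have dl : is_derive u (1 : R) l b.
      have h1 := is_deriveD (is_derive_cst (y - b / 2) u (1 : R))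
        (is_deriveZ b (is_derive_id u (1 : R))).
      by apply: (is_derive_eq h1); rewrite add0r scaler1.
    have h1 := is_deriveB (is_deriveZ (3 * b)^-1 (is_deriveX 3 dl))
      (is_derive_cst ((3 * b)^-1 * (y - b / 2) ^+ 3) u (1 : R)).
    (* H is the cubic primitive of h with H 0 = 0; this form shows its derivative, while the
       expanded one is free of division by b. *)
    have -> : H = (3 * b)^-1 \*: (l ^+ 3) - cst ((3 * b)^-1 * (y - b / 2) ^+ 3).
      apply/funext => v.
      transitivity ((3 * b)^-1 * (l v ^+ 3) - (3 * b)^-1 * (y - b / 2) ^+ 3); last by rewrite !fctE.
      by rewrite /H /l; field; rewrite gt_eqF.
    by apply: (is_derive_eq h1); rewrite /h /l /GRing.scale/=; field; rewrite gt_eqF.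
  rewrite (J_Phi_comp ch dH); last by move=> u _; exact: sqr_ge0.
  by rewrite /H; field.
under eq_fun do rewrite avgE.
by rewrite J_normal_quad// expr0n/= add0r mulr0 addr0 mul1r addrC.
Qed.

Definition step a : R -> R := fun y => (a <= y)%R%:R.

Lemma step01 a y : 0 <= step a y <= 1.
Proof. by rewrite /step; case: (a <= y); rewrite lexx ler01. Qed.

Lemma measurable_step a : measurable_fun setT (step a).
Proof.
rewrite (_ : step a = \1_(`[a, +oo[%classic)); first exact: measurable_indic.
apply/funext => y; rewrite /step indicE; congr (_%:R); congr nat_of_bool.
by apply/idP/idP; rewrite inE/= in_itv/= andbT.
Qed.

Lemma qbd_step a : qbd (step a).
Proof.
apply: (@qbd_bounded _ _ 1); first exact: measurable_step.
by move=> y; have /andP[h1 h2] := step01 a y; rewrite ger0_norm.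
Qed.

Lemma qbdM_bounded g (h : R -> R) : qbd g -> measurable_fun setT h -> (forall x, `|h x| <= 1) ->
  qbd (fun x => h x * g x).
Proof.
move=> [mg [C hC]] mh h1; split; first exact: measurable_funM.
exists C => y; rewrite normrM (le_trans _ (hC y))// ler_piMl//.
Qed.

Lemma qbdM_step a g : qbd g -> qbd (fun x => step a x * g x).
Proof.
move=> qg; apply: qbdM_bounded => //; first exact: measurable_step.
by move=> y; have /andP[h1 h2] := step01 a y; rewrite ger0_norm.
Qed.

Lemma J_phi_step a : J (fun y => phi y * step a y) = 1 - Phi a.
Proof.
rewrite -Qfun_Phi /Qfun /normal_prob /J /Rintegral; congr fine.
rewrite [RHS]integral_mkcond; apply: eq_integral => y _.
rewrite /patch /step; have -> : (y \in `[a, +oo[%classic) = (a <= y).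
  by apply/idP/idP; rewrite inE/= in_itv/= andbT.
by case: ifP => _; rewrite ?mulr1 ?mulr0.
Qed.

Lemma Phi0 : Phi 0 = 2^-1.
Proof. have := PhiN (0 : R); rewrite oppr0; lra. Qed.

(* (v^2 - 1) (exp (-c v) - exp (-c)) <= 0 for v >= 0 compares the integral with its value 0 at c = 0 *)
Lemma J_tail_le0 c : 0 <= c -> J (fun v => phi v * (step c v * ((v - c) ^+ 2 - 1))) <= 0.
Proof.
move=> c0; have gphi : gdom phi by exact: gdom_normal.
have q1 m : qbd (fun v => (v - m) ^+ 2 - 1) by apply: qbdB => //; exact: qbd_cst.
have q0 : qbd (fun v => v ^+ 2 - 1) by apply: qbdB; [exact: qbd_sqr|exact: qbd_cst].
rewrite (@J_affine _ 1 c) ?mul1r//; last by apply: gdomM => //; exact: qbdM_step.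
pose h v := phi v * (step 0 v * (v ^+ 2 - 1)).
have gh : gdom h by apply: gdomM => //; exact: qbdM_step.
apply: (@le_trans _ _ (J (fun v => expR (- c - c ^+ 2 / 2) * h v))).
  apply: leJ; [|exact: gdomZ|move=> v].
    apply: (@gdom_affine _ 1 c (fun v => phi v * (step c v * ((v - c) ^+ 2 - 1))));
      first exact: oner_neq0.
    by apply: gdomM => //; exact: qbdM_step.
  rewrite mul1r addrK /h /step lerDr.
  case: (leP 0 v) => v0; rewrite ?mul0r ?mulr0// !mul1r.
  have -> : phi (v + c) = phi v * expR (- (c * v) - c ^+ 2 / 2).
    rewrite /phi !normal_pdfE ?oner_eq0// /normal_fun -mulrA -expRD; congr (_ * expR _).
    by rewrite !subr0 expr1n; field.
  rewrite mulrCA -mulrA ler_wpM2l ?(ltW (phi_gt0 _))//.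
  have [v1|v1] := leP 1 v.
    rewrite ler_wpM2r ?subr_ge0 ?exprn_ege1// ler_expR lerD2r lerN2.
    by rewrite ler_peMr.
  rewrite ler_wnM2r ?subr_le0 ?exprn_ile1 ?(ltW v1)// ler_expR lerD2r lerN2.
  by rewrite ler_piMr// ltW.
rewrite JZ// pmulr_rle0 ?expR_gt0//.
(* By symmetry J h is half of this sum, which is compared with the integral of [phi v * (v^2 - 1)],
   namely 0. At v = 0 both steps equal 1, and the sign of [v^2 - 1] keeps the inequality. *)
have : J h + J (fun v => h (- v)) <= 0.
  have gh' : gdom (fun v => h (- v)) := gdom_opp gh.
  rewrite -JD//.
  have -> : 0 = J (fun v => phi v * (-1 + 0 * v + 1 * v ^+ 2)) by rewrite J_phi_quad addrC subrr.
  apply: leJ; [exact: gdomD|by apply: gdomM => //; exact: qbd_quad|move=> v].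
  rewrite /h sqrrN phiN -mulrDr ler_wpM2l ?(ltW (phi_gt0 _))// /step oppr_ge0.
  by case: (ltgtP v 0) => [v0|v0|->]; rewrite ?mul0r ?mul1r; lra.
rewrite J_opp//; lra.
Qed.

Lemma expR_gent s : 0 < s -> expR (gent s) = expR 2^-1 / normal_peak s.
Proof.
move=> s0; have p0 : 0 < normal_peak 1 :> R by rewrite normal_peak_gt0 ?oner_eq0.
rewrite /gent expRD expRN lnK ?posrE// expRD lnK ?posrE// (normal_peak_div s0).
by field; rewrite !gt_eqF.
Qed.

(* McKellips' test density: flat on [0, a], with Gaussian tails outside *)
Lemma ent_noisy_peak_lin f s a : 0 < s -> 0 < a -> nice f -> J f = 1 -> noisy_peak s a f ->
  ent f <= ln (a + expR (gent s)).
Proof.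
move=> s0 a0 nf Jf hf; have gf := nf.1.
(* w is minus the logarithm of the test density up to a constant: 0 strictly inside the interval,
   and [(v^2 - 1) / 2] on the tails, with v the distance in units of s. The centring by 1/2 makes
   each tail contribute a nonpositive mean by [J_tail_le0], and makes the tails weigh
   [expR (gent s)] in all. *)
pose wr a y := step a y * ((y - a) ^+ 2 / (2 * s ^+ 2) - 2^-1).
pose w y := wr a y + wr 0 (- y).
have s20 : 0 < 2 * s ^+ 2 by rewrite mulr_gt0 ?exprn_gt0.
have qwr c : qbd (wr c).
  apply: qbdM_step; apply: qbdB; last exact: qbd_cst.
  by have := qbdZ (2 * s ^+ 2)^-1 (qbd_csqr c); congr qbd; apply/funext => y; rewrite mulrC.
have qwr' c : qbd (fun y => wr c (- y)).
  by have := qbd_affine (-1) 0 (qwr c); congr qbd; apply/funext => y; rewrite mulN1r addr0.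
have qw : qbd w by apply: qbdD.
have gn m : gdom (normal_pdf m s) := gdom_normal m s0.
have wr_le0 m c : m <= c -> J (fun y => normal_pdf m s y * wr c y) <= 0.
  move=> mc; rewrite J_normalM//.
  have -> : J (fun x => phi x * wr c (s * x + m)) =
      J (fun x => 2^-1 * (phi x * (step ((c - m) / s) x * ((x - (c - m) / s) ^+ 2 - 1)))).
    apply: eqJ => x; rewrite /wr /step ler_pdivrMr// (mulrC x) lerBlDr.
    by case: (c <= _); rewrite ?mul0r ?mulr0// !mul1r; field; rewrite gt_eqF.
  rewrite JZ; last first.
    apply: gdomM; first exact: gdom_normal.
    by apply: qbdM_step; apply: qbdB; [exact: qbd_csqr|exact: qbd_cst].
  by rewrite pmulr_rle0// J_tail_le0// divr_ge0 ?subr_ge0// ltW.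
have wr_opp m y : normal_pdf m s (- y) = normal_pdf (- m) s y.
  by rewrite !normal_pdfE ?gt_eqF// /normal_fun opprK -sqrrN opprD !opprK.
have Jw : J (fun y => f y * w y) <= 0.
  (* [noisy_peak] accepts nonnegative functions, so w is raised by 1/2, its largest negative
     excursion; [J f = 1] removes this afterwards. *)
  have w0 y : 0 <= w y + 2^-1.
    rewrite /w /wr /step subr0 oppr_ge0.
    have h1 : 0 <= (y - a) ^+ 2 / (2 * s ^+ 2) by rewrite divr_ge0 ?sqr_ge0 ?(ltW s20).
    have h2 : 0 <= (- y) ^+ 2 / (2 * s ^+ 2) by rewrite divr_ge0 ?sqr_ge0 ?(ltW s20).
    case: (leP a y) => ay; case: (leP y 0) => y0; rewrite ?mul0r ?mul1r; lra.
  have q2 : qbd (fun y => w y + 2^-1) by apply: qbdD => //; exact: qbd_cst.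
  have h2 : J (fun y => f y * (w y + 2^-1)) <= 2^-1.
    apply: hf => // t /andP[t0 ta].
    rewrite (_ : J _ = J (fun y => normal_pdf t s y * wr a y) +
        J (fun y => normal_pdf t s y * wr 0 (- y)) + 2^-1 * J (normal_pdf t s)); last first.
      have g1 : gdom (fun y => normal_pdf t s y * wr a y) by exact: gdomM.
      have g2 : gdom (fun y => normal_pdf t s y * wr 0 (- y)) by exact: gdomM.
      have g3 : gdom (fun y => 2^-1 * normal_pdf t s y) by exact: gdomZ.
      rewrite -JZ// -JD// -JD//; last exact: gdomD.
      by apply: eqJ => y; rewrite /w; ring.
    rewrite J_normal mulr1.
    have h1 := wr_le0 t a ta.
    have : J (fun y => normal_pdf t s y * wr 0 (- y)) <= 0.
      rewrite -J_opp; last exact: gdomM.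
      rewrite (_ : J _ = J (fun y => normal_pdf (- t) s y * wr 0 y)); first by apply: wr_le0;
        rewrite oppr_le0.
      by apply: eqJ => y; rewrite wr_opp opprK.
    lra.
  have : J (fun y => f y * (w y + 2^-1)) = J (fun y => f y * w y) + 2^-1 * J f.
    rewrite -JZ// -JD; [|exact: gdomM|exact: gdomZ].
    by apply: eqJ => y; ring.
  rewrite Jf; lra.
pose C := a + expR (gent s).
have C0 : 0 < C by rewrite addr_gt0 ?expR_gt0.
pose r y := C^-1 * expR (- w y).
have r0 y : 0 < r y by rewrite mulr_gt0 ?invr_gt0 ?expR_gt0.
have lnr y : ln (r y) = - ln C - w y.
  by rewrite /r lnM ?posrE ?invr_gt0 ?expR_gt0// expRK lnV ?posrE.
have gr : gdom r.
  split.
    by apply: measurable_funM => //; apply: measurableT_comp => //;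
      apply: measurableT_comp => //; exact: qw.1.
  exists (C^-1 * expR (a ^+ 2 / (2 * s ^+ 2) + 2^-1)), (4 * s ^+ 2)^-1.
    by rewrite invr_gt0 mulr_gt0 ?exprn_gt0.
  move=> y; rewrite gtr0_norm// /r -mulrA ler_wpM2l ?invr_ge0 ?(ltW C0)//.
  rewrite -expRD ler_expR lerNl.
  have -> : - (a ^+ 2 / (2 * s ^+ 2) + 2^-1 + - ((4 * s ^+ 2)^-1 * y ^+ 2)) =
    (y ^+ 2 / 2 - a ^+ 2) / (2 * s ^+ 2) - 2^-1 by field; rewrite gt_eqF.
  rewrite /w /wr /step subr0 oppr_ge0.
  have k0 : 0 <= (2 * s ^+ 2)^-1 by rewrite invr_ge0 ltW.
  case: (leP a y) => ay; case: (leP y 0) => y0; rewrite ?mul0r ?mul1r ?addr0 ?add0r.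
  - by have := lt_le_trans a0 ay; rewrite ltNge y0.
  - rewrite lerD2r ler_wpM2r//; have := sqr_ge0 (y - 2 * a); rewrite !expr2; lra.
  - rewrite lerD2r ler_wpM2r// sqrrN; have := sqr_ge0 y; have := sqr_ge0 a; rewrite !expr2; lra.
  - have : (y ^+ 2 / 2 - a ^+ 2) / (2 * s ^+ 2) <= 0.
      rewrite pmulr_lle0 ?invr_gt0// subr_le0.
      apply: (@le_trans _ _ (y ^+ 2)); first by have := sqr_ge0 y; lra.
      by rewrite lerXn2r ?nnegrE ?(ltW y0) ?(ltW a0) ?(ltW ay).
    lra.
have gexp : gdom (fun y => expR (- w y)).
  by have := gdomZ C gr; congr gdom; apply/funext => y; rewrite /r mulrA divff ?mul1r// gt_eqF.
(* Each tail is bounded by [expR (gent s)] times a half-normal density of mass 1/2, the middle by an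
   indicator of mass a; together this is C. *)
have Jr : J r <= J f.
  rewrite Jf /r JZ// ler_pdivrMl// mulr1.
  pose I1 : R -> R := \1_(`[0, a]%classic).
  have gI : gdom I1.
    split; first exact: measurable_indic.
    exists (expR (a ^+ 2)), 1 => // y; rewrite /I1 indicE mul1r -expRD.
    case: (boolP (y \in _)) => [|_]; last by rewrite normr0 expR_ge0.
    rewrite inE/= in_itv/= => /andP[y0 ya]; rewrite normr1 -expR0 ler_expR subr_ge0.
    by rewrite lerXn2r ?nnegrE// ltW.
  have JI : J I1 = a.
    rewrite /J /Rintegral /I1 integral_indic//= setIT lebesgue_measure_itv/= lte_fin a0.
    by rewrite oppr0 adde0.
  have gs m c : gdom (fun y => normal_pdf m s y * step c y) by apply: gdomM => //; exact: qbd_step.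
  have gs' : gdom (fun y => normal_pdf 0 s y * step 0 (- y)).
    by have := gdom_opp (gs 0 0); congr gdom; apply/funext => v; rewrite wr_opp oppr0.
  have Js m : J (fun y => normal_pdf m s y * step m y) = 2^-1.
    rewrite J_normalM//; last exact: qbd_step.
    rewrite (_ : J _ = J (fun x => phi x * step 0 x)); first by rewrite J_phi_step Phi0; lra.
    by apply: eqJ => x; rewrite /step lerDr pmulr_rge0.
  have Js' : J (fun y => normal_pdf 0 s y * step 0 (- y)) = 2^-1.
    rewrite -J_opp// -(Js 0); apply: eqJ => y; by rewrite wr_opp opprK oppr0.
  rewrite (_ : C = J (fun y => I1 y + (expR (gent s) * (normal_pdf a s y * step a y) +
      expR (gent s) * (normal_pdf 0 s y * step 0 (- y))))); last first.
    rewrite JD//; last by apply: gdomD; exact: gdomZ.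
    rewrite JD; [|exact: gdomZ|exact: gdomZ].
    by rewrite !JZ// Js Js' JI -mulrDr -mulr2n -[_ *+ 2]mulr_natr mulVf ?mulr1 ?pnatr_eq0.
  apply: leJ.
  - exact: gexp.
  - by apply: gdomD => //; apply: gdomD; exact: gdomZ.
  move=> y.
  have nE m : expR (gent s) * normal_pdf m s y = expR (2^-1 - (y - m) ^+ 2 / (2 * s ^+ 2)).
    rewrite expR_gent// normal_pdfE ?gt_eqF// mulrA divfK;
      last by rewrite gt_eqF// normal_peak_gt0// gt_eqF.
    by rewrite /normal_fun -expRD; congr expR; rewrite mulNr -(mulr_natl (s ^+ 2)).
  rewrite !mulrA !nE /w /wr /step subr0 oppr_ge0 /I1 indicE.
  have e0 c : 0 <= expR c :> R by exact: expR_ge0.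
  case: (leP a y) => ay; case: (leP y 0) => y0;
    rewrite ?mul0r ?mul1r ?mulr0 ?mulr1 ?addr0 ?add0r ?opprB ?subr0.
  - by have := lt_le_trans a0 ay; rewrite ltNge y0.
  - by rewrite lerDr.
  - by rewrite sqrrN lerDr.
  - by rewrite oppr0 expR0 mem_set//= in_itv/= !ltW.
have := gibbs nf gr r0 _ Jr.
have -> : (fun x => ln (r x)) = fun x => - ln C - w x by apply/funext.
move=> /(_ (qbdB (qbd_cst _) qw)) h.
rewrite /ent; apply: (le_trans (_ : _ <= - J (fun x => f x * (- ln C - w x)))).
  rewrite lerN2 (_ : J (fun x => f x * (- ln C - w x)) = J (fun x => f x * ln (r x)))//.
  by apply: eqJ => x; rewrite lnr.
have -> : J (fun x => f x * (- ln C - w x)) = - ln C * J f - J (fun y => f y * w y).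
  rewrite -JZ// -JB; [|exact: gdomZ|exact: gdomM].
  by apply: eqJ => y; ring.
rewrite Jf -/C; lra.
Qed.

Lemma sum_normal_pam K d s y : (0 < K)%N ->
  \sum_(i < K) normal_pdf (d * i%:R) s y = K%:R * pam K d s y.
Proof. by move=> K0; rewrite /pam mulrA divff ?mul1r// pnatr_eq0 -lt0n. Qed.

(** Each component is at most K times the mixture, which bounds every divergence in [avg_kl] by ln K
    pointwise. *)
Lemma ent_pam_le_ln K d s : (0 < K)%N -> 0 < s -> ent (pam K d s) <= gent s + ln K%:R.
Proof.
move=> K0 s0; have K0' : 0 < K%:R :> R by rewrite ltr0n.
have np := nice_pam d K0 s0; have lp := qbd_ln np.
have := @avg_kl _ K (fun i => normal_pdf (d * i%:R) s) (pam K d s) K0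
  (fun i => nice_normal _ s0) np (fun y => erefl).
under eq_bigr do rewrite ent_normal//.
rewrite sumr_const card_ord -(mulr_natl (gent s)) mulKf ?gt_eqF// => h.
suff : K%:R^-1 * (\sum_(i < K) kl (normal_pdf (d * i%:R) s) (pam K d s)) <= ln K%:R by lra.
rewrite ler_pdivrMl// mulr_natl.
have -> : ln K%:R *+ K = \sum_(i < K) ln K%:R :> R by rewrite sumr_const card_ord.
apply: ler_sum => i _.
have gn := gdom_normal (d * i%:R) s0; have nn := nice_normal (d * i%:R) s0.
rewrite -[leRHS]mulr1 -[X in _ <= _ * X](J_normal (d * i%:R) s) -JZ//.
apply: leJ; [|exact: gdomZ|move=> y].
  by apply: gdomM => //; apply: qbdB => //; exact: qbd_ln.
have pp := nice_gt0 y np; have pn := nice_gt0 y nn.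
rewrite mulrC ler_wpM2r ?(ltW pn)// lerBlDr -lnM ?posrE//.
rewrite ler_ln ?posrE//; last exact: mulr_gt0.
rewrite -sum_normal_pam//.
by rewrite (bigD1 i)//= lerDl sumr_ge0// => j _; exact: normal_pdf_ge0.
Qed.

End UpperBounds.

(** * Fano and Renyi lower bounds, with strict inequality *)

Section LowerBounds.
Variable R : realType.
Local Notation Phi := (@Phi R).
Implicit Types (f g p q t : R -> R) (a b c d m s v x y : R) (K : nat).

(** Left of the constellation the first point outweighs the others by an exponential factor; strict
    inequalities are obtained in that region. *)
Lemma normal_pdf_left_le (i : nat) d s y : 0 < s -> 0 < d -> (0 < i)%N -> y <= 0 ->
  normal_pdf (d * i%:R) s y <= normal_pdf 0 s y * expR (y * d / s ^+ 2).
Proof.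
move=> s0 d0 i0 y0; rewrite !normal_pdfE ?gt_eqF// -[leRHS]mulrA ler_wpM2l ?normal_peak_ge0//.
rewrite /normal_fun -expRD ler_expR subr0 -(mulr_natl (s ^+ 2)).
have -> : - y ^+ 2 / (2 * s ^+ 2) + y * d / s ^+ 2 = (- y ^+ 2 + 2 * (y * d)) / (2 * s ^+ 2).
  by field; rewrite gt_eqF.
rewrite ler_pM2r ?invr_gt0 ?mulr_gt0 ?exprn_gt0// -subr_ge0.
have -> : - y ^+ 2 + 2 * (y * d) - - (y - d * i%:R) ^+ 2 =
  2 * ((- y) * d * (i%:R - 1)) + (d * i%:R) ^+ 2 by ring.
rewrite addr_ge0 ?sqr_ge0// !mulr_ge0 ?oppr_ge0 ?(ltW d0)// subr_ge0 ler1n//.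
Qed.

(** Fano's inequality for nearest-point detection, as a Gibbs bound: the posterior of i given y is
    compared with [r i y], which puts 1 - xi on the detected point and spreads xi evenly over the
    others. Far to the left the two differ, which gives strictness. *)
Lemma ent_pam_gt_fano K d s (xi := 2 * (K%:R - 1) / K%:R * Qfun (d / (2 * s))) :
  (1 < K)%N -> 0 < d -> 0 < s ->
  0 < xi < 1 /\
  ln K%:R + (1 - xi) * ln (1 - xi) + xi * ln (xi / (K%:R - 1)) < ent (pam K d s) - gent s.
Proof.
move=> K1 d0 s0; have K0 : (0 < K)%N by exact: ltnW.
have Kp : 0 < K%:R :> R by rewrite ltr0n.
have K1p : 0 < K%:R - 1 :> R by rewrite subr_gt0 ltr1n.
pose q := Qfun (d / (2 * s)).
have qE : q = 1 - Phi (d / (2 * s)) by rewrite /q Qfun_Phi.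
have q0 : 0 < q by rewrite qE subr_gt0 Phi_lt1.
have q1 : 2 * q < 1.
  have : Phi 0 < Phi (d / (2 * s)) by apply: Phi_incr; rewrite divr_gt0// mulr_gt0.
  by rewrite Phi0 qE; lra.
have xi0 : 0 < xi by rewrite /xi -/q mulr_gt0// divr_gt0// mulr_gt0.
have xi1 : xi < 1.
  apply: le_lt_trans q1; rewrite /xi -/q mulrAC ler_pdivrMr//.
  have -> : 2 * (K%:R - 1) * q = 2 * q * (K%:R - 1) by ring.
  by rewrite ler_wpM2l ?mulr_ge0 ?(ltW q0)//; lra.
split; first by rewrite xi0.
(* [chi i] indicates the decision region of point i, between the midpoints [d (i - 1/2)] and
   [d (i + 1/2)]. The values 1 at i = 0 and 0 from i = K on make the two outer regions unbounded. *)
pose cut (i : nat) y : R := if i == 0 then 1 else if (K <= i)%N then 0 else step (d * (i%:R - 2^-1)) y.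
pose chi (i : nat) y := cut i y - cut i.+1 y.
have chi01 i y : (i < K)%N -> chi i y = 0 \/ chi i y = 1.
  move=> iK; rewrite /chi /cut /= leqNgt iK /=.
  have e : d * (i%:R - 2^-1) <= d * (i.+1%:R - 2^-1) by rewrite ler_wpM2l ?(ltW d0)// lerD2r ler_nat.
  case: eqP => _; case: (K <= _)%N; rewrite ?subr0 /step; try by right.
  - by case: (_ <= y); [left|right]; rewrite ?subrr ?subr0.
  - by case: (_ <= y); [right|left].
  - case: (leP (d * (i.+1%:R - 2^-1)) y) => h1; first by rewrite (le_trans e h1); left;
    rewrite subrr.
    by case: (_ <= y); [right|left]; rewrite subr0.
have sum_chi y : \sum_(i < K) chi i y = 1.
  rewrite -(big_mkord xpredT (fun i => chi i y)) /chi.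
  under eq_bigr do rewrite -opprB.
  by rewrite sumrN telescope_sumr// /cut eqxx leqnn gtn_eqF//= opprB subr0.
have mcut i : measurable_fun setT (cut i).
  rewrite /cut; case: (i == 0) => //; case: (K <= i)%N => //; exact: measurable_step.
have mchi i : measurable_fun setT (chi i) by apply: measurable_funB.
have qcut i : qbd (cut i).
  rewrite /cut; case: (i == 0); first exact: qbd_cst.
  case: (K <= i)%N; [exact: qbd_cst|exact: qbd_step].
have qchi i : qbd (chi i) by apply: qbdB.
pose N (i : nat) := normal_pdf (d * i%:R) s.
have gN i : gdom (N i) by exact: gdom_normal.
have N0 i y : 0 < N i y by exact: normal_pdf_gt0.
have JN i : J (N i) = 1 by exact: J_normal.
have JNstep i a : J (fun y => N i y * step a y) = 1 - Phi ((a - d * i%:R) / s).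
  rewrite J_normalM//; last exact: qbd_step.
  rewrite -J_phi_step; apply: eqJ => x; congr (_ * _).
  by rewrite /step ler_pdivrMr// (mulrC x) lerBlDr.
(* Each neighbour costs an error probability q; the two end points have only one. *)
have Jchi (i : 'I_K) : J (fun y => N i y * chi i y) =
    1 - q * ((val i != 0)%:R + (i.+1 != K)%:R).
  rewrite (_ : J _ = J (fun y => N i y * cut i y) - J (fun y => N i y * cut i.+1 y)); last first.
    by rewrite -JB; [apply: eqJ => y; rewrite mulrBr|exact: gdomM..].
  have -> : J (fun y => N i y * cut i y) = 1 - q * (val i != 0)%:R.
    rewrite /cut [(K <= i)%N]leqNgt ltn_ord/=; case: eqP => [i0|i0] /=.
      by rewrite mulr0 subr0 -[RHS](JN i); apply: eqJ => y; rewrite mulr1.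
    rewrite JNstep mulr1 qE; have -> : (d * (i%:R - 2^-1) - d * i%:R) / s = - (d / (2 * s)).
      by field; rewrite gt_eqF.
    by rewrite PhiN; ring.
  have -> : J (fun y => N i y * cut i.+1 y) = q * (i.+1 != K)%:R.
    rewrite /cut /=; case: (ltngtP i.+1 K) => h /=.
    - rewrite JNstep mulr1 qE; congr (1 - Phi _); rewrite -natr1.
      by field; rewrite gt_eqF.
    - by have := ltn_ord i; rewrite leqNgt h.
    - by rewrite mulr0 -[RHS]J0; apply: eqJ => y; rewrite mulr0.
  ring.
have sumJchi : \sum_(i < K) J (fun y => N i y * chi i y) = K%:R * (1 - xi).
  under eq_bigr do rewrite Jchi.
  rewrite sumrB sumr_const card_ord -mulr_sumr big_split/=.
  have s1 : \sum_(i < K) (i != 0 :> nat)%:R = K%:R - 1 :> R.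
    case: K K0 {K1 Kp K1p xi xi0 xi1 cut chi chi01 sum_chi mcut mchi qcut qchi Jchi} => // k _.
    rewrite big_ord_recl/= add0r; under eq_bigr do rewrite /=.
    by rewrite sumr_const card_ord -[k.+1%:R]natr1 addrK.
  have s2 : \sum_(i < K) (i.+1 != K)%:R = K%:R - 1 :> R.
    case: K K0 {K1 Kp K1p xi xi0 xi1 cut chi chi01 sum_chi mcut mchi qcut qchi Jchi s1} => // k _.
    rewrite big_ord_recr/= eqxx addr0.
    rewrite (eq_bigr (fun=> 1)) => [|i _];
      first by rewrite sumr_const card_ord -[k.+1%:R]natr1 addrK.
    by rewrite eqSS ltn_eqF.
  by rewrite s1 s2 /xi -/q; field; rewrite gt_eqF.
pose r i y := chi i y * (1 - xi) + (1 - chi i y) * (xi / (K%:R - 1)).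
pose l1 := ln (1 - xi); pose l2 := ln (xi / (K%:R - 1)).
have r0 (i : 'I_K) y : 0 < r i y.
  rewrite /r; have [->|->] := chi01 i y (ltn_ord i).
    by rewrite mul0r add0r subr0 mul1r divr_gt0.
  by rewrite subrr mul0r addr0 mul1r subr_gt0.
have lnr (i : 'I_K) y : ln (r i y) = l2 + (l1 - l2) * chi i y.
  rewrite /r; have [->|->] := chi01 i y (ltn_ord i).
    by rewrite mul0r add0r subr0 mul1r mulr0 addr0.
  by rewrite subrr mul0r addr0 mul1r -/l1; ring.
have sumr1 y : \sum_(i < K) r i y = 1.
  rewrite /r big_split/= -!mulr_suml sum_chi sumrB sum_chi sumr_const card_ord mul1r.
  by rewrite mulrC divfK ?gt_eqF// subrK.
pose m := pam K d s; have nm : nice m by exact: nice_pam.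
have m0 y : 0 < m y by exact: nice_gt0.
have lm : qbd (fun y => ln (m y)) by exact: qbd_ln.
pose T i y := N i y * (ln (K%:R * m y * r i y) - ln (N i y)).
have TE (i : 'I_K) y : T i y = N i y * (ln K%:R + ln (m y) + l2 + (l1 - l2) * chi i y - ln (N i y)).
  have Km0 : 0 < K%:R * m y by rewrite mulr_gt0.
  have ri := r0 i y; rewrite /T (_ : ln (K%:R * m y * r i y) = ln (K%:R * m y) + ln (r i y));
    last by rewrite lnM ?posrE.
  by rewrite lnr lnM ?posrE// addrA.
have qT (i : 'I_K) : qbd (fun y => ln K%:R + ln (m y) + l2 + (l1 - l2) * chi i y - ln (N i y)).
  apply: qbdB; last by apply: qbd_ln; exact: nice_normal.
  by apply: qbdD; [apply: qbdD; [apply: qbdD|]|apply: qbdZ] => //; exact: qbd_cst.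
have gT (i : 'I_K) : gdom (T i).
  rewrite (_ : T i = fun y => N i y * (ln K%:R + ln (m y) + l2 + (l1 - l2) * chi i y - ln (N i y))).
    exact: gdomM.
  by apply/funext => y; exact: TE.
have T_le (i : 'I_K) y : T i y <= K%:R * m y * r i y - N i y.
  exact: mul_ln_ratio_le (N0 i y) (mulr_gt0 (mulr_gt0 Kp (m0 y)) (r0 i y)).
have sum0 y : \sum_(i < K) (K%:R * m y * r i y - N i y) = 0.
  by rewrite sumrB -mulr_sumr sumr1 mulr1 /N sum_normal_pam// subrr.
have JT : J (fun y => \sum_(i < K) T i y) < J (fun=> 0 : R).
  (* Left of y0 each of the other K - 1 components is at most [xi / (K - 1)] times the first, so
     [K m r] is at most [(1 + xi) (1 - xi) < 1] times that first component. *)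
  pose y0 := Num.min (-1) (s ^+ 2 / d * ln (xi / (K%:R - 1))).
  apply: (@ltJ _ _ _ (y0 - 1) y0).
  - by rewrite gtrBl.
  - exact: gdom_sum.
  - exact: gdom0.
  - by move=> y; rewrite -[leRHS](sum0 y); apply: ler_sum => i _.
  move=> y /andP[_ yy0]; rewrite -[ltRHS](sum0 y).
  pose i0 : 'I_K := Ordinal K0.
  rewrite (bigD1 i0)//= [ltRHS](bigD1 i0)//= ltr_leD//; last by apply: ler_sum => i _.
  have yn : y < 0 by apply: (lt_le_trans yy0); rewrite ge_min; apply/orP; left; lra.
  have yx : y * d / s ^+ 2 <= ln (xi / (K%:R - 1)).
    rewrite ler_pdivrMr ?exprn_gt0// -ler_pdivlMr//.
    apply: (le_trans (ltW yy0)); rewrite ge_min; apply/orP; right.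
    by rewrite le_eqVlt; apply/orP; left; apply/eqP; ring.
  have chi0 : chi i0 y = 1.
    rewrite /chi /cut /= leqNgt K1 /= /step leNgt.
    have -> : y < d * (1 - 2^-1) by apply: (lt_le_trans yn); rewrite mulr_ge0 ?(ltW d0)//; lra.
    by rewrite subr0.
  have Km : K%:R * m y * r i0 y < N i0 y.
    rewrite /r chi0 mul1r subrr mul0r addr0 /m -sum_normal_pam//.
    apply: (@le_lt_trans _ _ (N i0 y * (1 + xi) * (1 - xi))).
      rewrite ler_wpM2r ?subr_ge0 ?(ltW xi1)// (bigD1 i0)//= mulrDr mulr1 lerD2l.
      apply: (@le_trans _ _ (\sum_(i < K | i != i0) (N i0 y * (xi / (K%:R - 1))))).
        apply: ler_sum => i ii0.
        apply: le_trans (normal_pdf_left_le s0 d0 _ (ltW yn)) _.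
          by rewrite lt0n; apply: contra ii0 => /eqP h; apply/eqP/val_inj.
        rewrite /N /= mulr0 ler_wpM2l ?normal_pdf_ge0//.
        by rewrite -[leRHS]lnK ?posrE ?divr_gt0// ler_expR.
      rewrite sumr_const cardC1 card_ord -[leLHS]mulr_natr -[K.-1]subn1 natrB//.
      by rewrite -mulrA divfK ?gt_eqF.
    rewrite -mulrA gtr_pMr// -subr_gt0.
    have -> : 1 - (1 + xi) * (1 - xi) = xi * xi by ring.
    exact: mulr_gt0.
  apply: mul_ln_ratio_lt (N0 i0 y) (mulr_gt0 (mulr_gt0 Kp (m0 y)) (r0 i0 y)) _.
  by rewrite gt_eqF.
rewrite J0 J_sum// in JT.
have [c1 c1E] : exists c1, c1 = ln K%:R + l2 + gent s by eexists.
have JTi (i : 'I_K) : J (T i) = c1 + J (fun y => N i y * ln (m y))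
   + (l1 - l2) * J (fun y => N i y * chi i y).
  have g1 : gdom (fun y => N i y * ln (m y)) by exact: gdomM.
  have g2 : gdom (fun y => N i y * chi i y) by exact: gdomM.
  have g3 : gdom (fun y => N i y * ln (N i y)).
    by apply: gdomM => //; apply: qbd_ln; exact: nice_normal.
  rewrite c1E; have -> : gent s = - J (fun y => N i y * ln (N i y)) by rewrite -(ent_normal (d * i%:R) s0).
  rewrite (_ : J (T i) = J (fun y => (ln K%:R + l2) * N i y - N i y * ln (N i y) + N i y * ln (m y)
     + (l1 - l2) * (N i y * chi i y))); last by apply: eqJ => y; rewrite TE; ring.
  rewrite JD; [|by apply: gdomD => //; apply: gdomB => //; exact: gdomZ|exact: gdomZ].
  rewrite JD => [||//]; last by apply: gdomB => //; exact: gdomZ.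
  by rewrite JB ?JZ ?JN ?mulr1//; exact: gdomZ.
have Jm : \sum_(i < K) J (fun y => N i y * ln (m y)) = - (K%:R * ent m).
  rewrite /ent mulrN opprK -J_sum => [|i _]; last exact: gdomM.
  rewrite -JZ; last by apply: gdomM => //; exact: nm.1.
  by apply: eqJ => y; rewrite -mulr_suml /N sum_normal_pam// mulrA.
rewrite (eq_bigr _ (fun i _ => JTi i)) in JT.
rewrite !big_split/= Jm -mulr_sumr sumJchi !sumr_const card_ord in JT.
have e : K%:R * (ln K%:R + (1 - xi) * l1 + xi * l2 - (ent m - gent s)) =
  c1 *+ K + - (K%:R * ent m) + (l1 - l2) * (K%:R * (1 - xi)).
  by rewrite c1E -(mulr_natl (_ + gent s) K); ring.
by rewrite -e pmulr_rlt0// subr_lt0 in JT.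
Qed.

Lemma J_normal_prod a b s : 0 < s ->
  J (fun y => normal_pdf a s y * normal_pdf b s y) =
  normal_peak 1 / (Num.sqrt 2 * s) * expR (- ((a - b) ^+ 2 / (4 * s ^+ 2))).
Proof.
move=> s0; pose q2 : R := Num.sqrt 2; have q20 : 0 < q2 by rewrite sqrtr_gt0.
have q2E : q2 ^+ 2 = 2 by rewrite sqr_sqrtr.
have sq0 : 0 < s / q2 by rewrite divr_gt0.
(* Completing the square: the product is a multiple of the normal density centred at the midpoint
   with deviation [s / sqrt 2]. *)
rewrite -[RHS]mulr1 -[X in _ = _ * X](J_normal ((a + b) / 2) (s / q2)) -JZ; last exact: gdom_normal.
apply: eqJ => y; rewrite !normal_pdfE ?gt_eqF// (normal_peak_div s0) (normal_peak_div sq0) -/q2.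
rewrite /normal_fun.
rewrite mulrACA -expRD [RHS]mulrACA -expRD; congr (_ * expR _).
  have -> : normal_peak 1 / (q2 * s) * (normal_peak 1 / (s / q2)) =
    normal_peak 1 / s * (normal_peak 1 / s) by field; rewrite !gt_eqF.
  by [].
have e : (s / q2) ^+ 2 = s ^+ 2 / 2 by rewrite expr_div_n q2E.
by rewrite -(mulr_natl (s ^+ 2)) -(mulr_natl ((s / q2) ^+ 2)) e; field; rewrite gt_eqF.
Qed.

(** ln lies below its tangent at c, the integral of [f^2]; integrated against f the tangent term
    vanishes by the choice of c. Strictness comes from the interval where f < c. *)
Lemma ent_gt_renyi f a b : nice f -> J f = 1 -> a < b ->
  (forall y, a < y < b -> f y < J (fun y => f y * f y)) ->
  - ln (J (fun y => f y * f y)) < ent f.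
Proof.
move=> nf Jf ab hc; have gf := nf.1; have f0 y : 0 < f y := nice_gt0 y nf.
set c := J _ in hc *.
have [C C0 fC] := gdom_bounded gf.
have gff : gdom (fun y => f y * f y).
  by apply: gdomM => //; apply: (@qbd_bounded _ _ C) => //; exact: gf.1.
have c0 : 0 < c by apply: (@J_gt0 _ _ 0 1) => // y *; rewrite ?mulr_gt0// mulr_ge0// ltW.
have lf := qbd_ln nf.
have k0 y : 0 < c^-1 * f y by rewrite mulr_gt0 ?invr_gt0.
have eL y : c^-1 * f y * (c * (ln (f y) - ln c)) = f y * (ln (f y) - ln c).
  by field; rewrite gt_eqF.
have eR y : c^-1 * f y * (f y - c) = c^-1 * (f y * f y) - f y by field; rewrite gt_eqF.
have : J (fun y => f y * (ln (f y) - ln c)) < J (fun y => c^-1 * (f y * f y) - f y).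
  apply: (ltJ ab).
  - by apply: gdomM => //; apply: qbdB => //; exact: qbd_cst.
  - by apply: gdomB => //; exact: gdomZ.
  - by move=> y; rewrite -eL -eR ler_pM2l// mul_ln_ratio_le.
  - by move=> y yab; rewrite -eL -eR ltr_pM2l// mul_ln_ratio_lt// gt_eqF// hc.
rewrite JB ?JZ//; last exact: gdomZ.
rewrite -/c mulVf ?gt_eqF// Jf subrr.
rewrite (_ : J _ = J (fun y => f y * ln (f y)) - ln c * J f); last first.
  rewrite -JZ// -JB; [by apply: eqJ => y; ring|exact: gdomM|exact: gdomZ].
by rewrite Jf /ent; lra.
Qed.

Lemma pam_left_lt K d s c : (0 < K)%N -> 0 < d -> 0 < s -> 0 < c ->
  exists a, forall y, y < a -> pam K d s y < c.
Proof.
move=> K0 d0 s0 c0; have p0 : 0 < normal_peak s by rewrite normal_peak_gt0// gt_eqF.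
have k0 : 0 < 2 * s ^+ 2 by rewrite mulr_gt0// exprn_gt0.
have D0 : 0 <= 2 * s ^+ 2 * (normal_peak s / c) by rewrite mulr_ge0 ?divr_ge0 ?(ltW p0) ?(ltW c0) ?(ltW k0).
(* With y this far left, [y^2 >= - y], and [exp x >= 1 + x] makes the Gaussian factor smaller than
   [c / normal_peak s]. *)
exists (- (1 + 2 * s ^+ 2 * (normal_peak s / c))) => y hy.
have yn : y < 0 by lra.
apply: (@le_lt_trans _ _ (normal_pdf 0 s y)).
  rewrite /pam ler_pdivrMl ?ltr0n// mulr_natl.
  have -> : normal_pdf 0 s y *+ K = \sum_(i < K) normal_pdf 0 s y by rewrite sumr_const card_ord.
  apply: ler_sum => i _; case: (posnP i) => [->|i0]; first by rewrite mulr0.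
  apply: (le_trans (normal_pdf_left_le s0 d0 i0 (ltW yn))).
  rewrite ger_pMr ?normal_pdf_gt0// -expR0 ler_expR -mulrA pmulr_lle0 ?ltW//.
  by rewrite divr_gt0// exprn_gt0.
rewrite normal_pdfE ?gt_eqF// /normal_fun subr0 -(mulr_natl (s ^+ 2)) mulNr expRN.
rewrite ltr_pdivrMr ?expR_gt0// mulrC -ltr_pdivrMr//.
apply: lt_le_trans (expR_ge1Dx _).
apply: (@lt_le_trans _ _ (1 + normal_peak s / c)); first by rewrite ltrDr.
rewrite lerD2l ler_pdivlMr// mulrC.
have h : 2 * s ^+ 2 * (normal_peak s / c) <= - y by lra.
apply: (le_trans h); rewrite -sqrrN expr2 ler_peMr; lra.
Qed.

(** F1 takes the span of the constellation, which is K - 1 spacings; the factor ln 2 turns bits into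
    nats. *)
Lemma F1_lt K d s : (1 < K)%N -> 0 < d -> 0 < s ->
  F1 ((K%:R - 1) * d) K s * ln 2 < ent (pam K d s) - gent s.
Proof.
move=> K1 d0 s0; have [/andP[xi0 xi1]] := ent_pam_gt_fano K1 d0 s0.
have K1p : 0 < K%:R - 1 :> R by rewrite subr_gt0 ltr1n.
have l2 : ln 2 != 0 :> R by rewrite gt_eqF// ln_gt0// ltr1n.
have xiE : 2 * (K%:R - 1) / K%:R * Qfun (d / (2 * s)) = xi ((K%:R - 1) * d) K s.
  by rewrite /xi; congr (_ * Qfun _); field; rewrite !gt_eqF.
rewrite xiE in xi0 xi1 *; rewrite /F1; set e := xi _ _ _ in xi0 xi1 *.
have e1 : 0 < 1 - e by rewrite subr_gt0.
rewrite /Hb /xlog2 !gt_eqF// /log2 ln_div ?posrE//.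
congr (_ < _); by field.
Qed.

Lemma F3_lt K d s : (1 < K)%N -> 0 < d -> 0 < s ->
  F3 ((K%:R - 1) * d) K s * ln 2 < ent (pam K d s) - gent s.
Proof.
move=> K1 d0 s0; have K0 := ltnW K1.
have K1p : 0 < K%:R - 1 :> R by rewrite subr_gt0 ltr1n.
have Kp : 0 < K%:R :> R by rewrite ltr0n.
have l2 : ln 2 != 0 :> R by rewrite gt_eqF// ln_gt0// ltr1n.
pose m := pam K d s; have nm : nice m by exact: nice_pam.
have gm := nm.1; have m0 y : 0 < m y := nice_gt0 y nm.
have Jm : J m = 1 by exact: J_pam.
have [C C0 fC] := gdom_bounded gm.
have gmm : gdom (fun y => m y * m y).
  by apply: gdomM => //; apply: (@qbd_bounded _ _ C) => //; exact: gm.1.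
pose c := J (fun y => m y * m y).
have mm0 y : 0 < m y * m y by rewrite mulr_gt0.
have c0 : 0 < c by apply: (@J_gt0 _ _ 0 1) => // y; exact/ltW.
have [a ha] := pam_left_lt K0 d0 s0 c0.
have h : - ln c < ent m.
  apply: (@ent_gt_renyi _ (a - 1) a) => //; first by rewrite gtrBl.
  by move=> y /andP[_ ya]; exact: ha.
have gNN (i j : nat) : gdom (fun y => normal_pdf (d * i%:R) s y * normal_pdf (d * j%:R) s y).
  apply: gdomM; first exact: gdom_normal.
  apply: (@qbd_bounded _ _ (normal_peak s)); first exact: measurable_normal_pdf.
  by move=> y; rewrite ger0_norm ?normal_pdf_ge0// normal_pdf_ub// gt_eqF.
have cE : c = (K%:R ^+ 2)^-1 * \sum_(i < K) \sum_(j < K)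
    (normal_peak 1 / (Num.sqrt 2 * s) * expR (- ((d * i%:R - d * j%:R) ^+ 2 / (4 * s ^+ 2)))).
  transitivity (J (fun y => (K%:R ^+ 2)^-1 * \sum_(i < K) \sum_(j < K)
     (normal_pdf (d * i%:R) s y * normal_pdf (d * j%:R) s y))).
    apply: eqJ => y; rewrite /m /pam mulrACA -invfM -expr2; congr (_ * _).
    by rewrite mulr_suml; apply: eq_bigr => i _; rewrite mulr_sumr.
  rewrite JZ; last by apply: gdom_sum => i _; apply: gdom_sum => j _.
  congr (_ * _); rewrite J_sum => [|i _]; last exact: gdom_sum.
  apply: eq_bigr => i _; rewrite J_sum//; apply: eq_bigr => j _; exact: J_normal_prod.
have p0 : 0 < normal_peak 1 :> R by rewrite normal_peak_gt0 ?oner_eq0.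
pose S := \sum_(1 <= i < K.+1) \sum_(1 <= j < K.+1)
      Num.sqrt (eul R / 2) / (K%:R ^+ 2) *
      expR (- ((i%:R - j%:R) ^+ 2 * ((K%:R - 1) * d) ^+ 2) / (4 * (K%:R - 1) ^+ 2 * s ^+ 2)).
(* The double sum of F3, indexed from 1, is the integral of the squared density scaled by the
   exponential of the noise entropy. *)
have SE : S = expR (gent s) * c.
  rewrite cE mulrCA mulrA /S big_add1 big_mkord mulr_sumr; apply: eq_bigr => i _.
  rewrite big_add1 big_mkord mulr_sumr; apply: eq_bigr => j _.
  have -> : Num.sqrt (eul R / 2) = expR 2^-1 / Num.sqrt 2.
    rewrite sqrtrM ?expR_ge0// sqrtrV//; congr (_ / _).
    have -> : eul R = expR 2^-1 ^+ 2.
      by rewrite -expRM_natl -mulr_natl mulfV ?pnatr_eq0.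
    by rewrite sqrtr_sqr ger0_norm ?expR_ge0.
  rewrite expR_gent// (normal_peak_div s0) [RHS]mulrA; congr (_ * expR _).
    by field; rewrite !gt_eqF// sqrtr_gt0.
  by rewrite -!natr1; field; rewrite !gt_eqF.
rewrite /F3 -/S /log2 SE lnM ?posrE ?expR_gt0// expRK.
have -> : - ((gent s + ln c) / ln 2) * ln 2 = - ln c - gent s by field.
by rewrite ltrD2r.
Qed.

End LowerBounds.

(** * An entropy power inequality by monotone transport *)

Section EntropyPower.
Variable R : realType.
Local Notation mu := (@lebesgue_measure R).
Local Notation phi := (@phi R).
Local Notation Phi := (@Phi R).
Implicit Types (f g p q t : R -> R) (a b c d e m s u v x y : R) (K : nat).

(** Made for a g whose integral may be infinite; passing to the positive part of f leaves a
    comparison of nonnegative integrands. *)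
Lemma J_le_integral f (g : R -> \bar R) : gdom f -> measurable_fun setT g ->
  (forall x, 0 <= g x)%E -> (forall x, ((f x)%:E <= g x)%E) ->
  ((J f)%:E <= \int[mu]_x g x)%E.
Proof.
move=> gf mg g0 fg; have gn := gdom_norm gf.
pose h x := 2^-1 * (f x + `|f x|).
have gh : gdom h by apply: gdomZ; apply: gdomD.
have h0 x : 0 <= h x.
  by rewrite mulr_ge0// -lerBlDr sub0r lerNl -normrN ler_norm.
apply: (@le_trans _ _ (J h)%:E).
  rewrite lee_fin; apply: leJ => // x; rewrite /h; have := ler_norm (f x); lra.
rewrite EFin_J//; apply: ge0_le_integral => //.
- by move=> x _; rewrite lee_fin.
- by apply/measurable_EFinP; exact: gh.1.
move=> x _; rewrite /h; have [f0|f0] := leP 0 (f x).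
  by rewrite ger0_norm//; apply: le_trans (fg x); rewrite lee_fin; lra.
by rewrite ltr0_norm// subrr mulr0.
Qed.

Lemma continuous_comp_fun f g : continuous f -> continuous g -> continuous (fun z => g (f z)).
Proof. by move=> cf cg z; apply: (@continuous_comp _ _ _ f g); [exact: cf|exact: cg]. Qed.

(** The normal quantile function. The default 0 concerns arguments outside the range of Phi;
    [pam_cdf] stays inside it. *)
Definition Pinv : R -> R := fun u => xget 0 [set x | Phi x = u].

Lemma PhiK : cancel Phi Pinv.
Proof.
move=> x; apply: Phi_inj.
exact: (@xgetPex _ 0 [set z | Phi z = Phi x] (ex_intro _ x erefl)).
Qed.

Lemma is_derive_Pinv x : is_derive (Phi x) 1 Pinv (phi x)^-1.
Proof.
apply: is_derive_inverse.
- by near=> y; exact: PhiK.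
- by near=> y; exact: continuous_Phi.
- exact: is_derive_Phi.
- by rewrite gt_eqF// phi_gt0.
Unshelve. all: by end_near. Qed.

Section Transport.
Variables (K : nat) (d s : R).
Hypotheses (K0 : (0 < K)%N) (d0 : 0 <= d) (s0 : 0 < s).

Let m := pam K d s.
Let nm : nice m. Proof. exact: nice_pam. Qed.
Let m0 y : 0 < m y. Proof. exact: nice_gt0. Qed.

Definition pam_cdf y : R := K%:R^-1 * \sum_(i < K) Phi ((y - d * i%:R) / s).

Lemma is_derive_pam_cdf y : is_derive y (1 : R) pam_cdf (m y).
Proof.
pose l (i : nat) (z : R) := s^-1 * z + - (d * i%:R / s).
have dl i : is_derive y (1 : R) (l i) s^-1.
  have h1 := is_deriveD (is_deriveZ s^-1 (is_derive_id y (1 : R)))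
    (is_derive_cst (- (d * i%:R / s)) y (1 : R)).
  by apply: (is_derive_eq h1); rewrite addr0 scaler1.
have dP (i : 'I_K) : is_derive y (1 : R) (Phi \o l i) (normal_pdf (d * i%:R) s y).
  have h1 := is_derive_comp1 (dl i) (is_derive_Phi (l i y)).
  apply: (is_derive_eq h1); rewrite -(@normal_pdf_affine _ (d * i%:R) s)//.
  have -> : s * l i y + d * i%:R = y by rewrite /l; field; rewrite gt_eqF.
  by rewrite mulrAC divff ?mul1r// gt_eqF.
have h1 := is_deriveZ K%:R^-1 (is_derive_sum dP).
have -> : pam_cdf = K%:R^-1 \*: \sum_(i < K) (Phi \o l i).
  apply/funext => z; transitivity (K%:R^-1 * (\sum_(i < K) (Phi \o l i)) z) => [|//].
  rewrite fct_sumE /pam_cdf; congr (_ * _).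
  by apply: eq_bigr => i _; rewrite /l /=; congr Phi; ring.
exact: h1.
Qed.

Lemma pam_cdf_bounds y :
  Phi ((y - (K%:R - 1) * d) / s) <= pam_cdf y <= Phi (y / s).
Proof.
have Kp : 0 < K%:R :> R by rewrite ltr0n.
have cst (z : R) : \sum_(i < K) z = K%:R * z.
  by rewrite sumr_const card_ord -(mulr_natl z K).
rewrite /pam_cdf ler_pdivlMl// ler_pdivrMl// -!cst; apply/andP; split.
  apply: ler_sum => i _; rewrite Phi_le.
  rewrite ler_pM2r ?invr_gt0// lerB// mulrC ler_wpM2r//.
  by rewrite lerBrDr natr1 ler_nat.
apply: ler_sum => i _; rewrite Phi_le ler_pM2r ?invr_gt0//.
by rewrite gerBl mulr_ge0.
Qed.

Definition transport y : R := Pinv (pam_cdf y).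
Local Notation W := transport.

(** The outermost points of the constellation enclose W between two affine functions: this yields W
    by the intermediate value theorem and also its linear growth. *)
Lemma transport_spec y :
  Phi (W y) = pam_cdf y /\ (y - (K%:R - 1) * d) / s <= W y <= y / s.
Proof.
have /andP[h1 h2] := pam_cdf_bounds y.
have ab : (y - (K%:R - 1) * d) / s <= y / s.
  by rewrite ler_pM2r ?invr_gt0// gerBl mulr_ge0// subr_ge0 ler1n.
have cP : {within `[(y - (K%:R - 1) * d) / s, y / s], continuous Phi}.
  by apply: continuous_subspaceT; exact: continuous_Phi.
have [] := @IVT R Phi _ _ (pam_cdf y) ab cP.
  by rewrite ge_min h1 le_max h2 orbT.
by move=> x; rewrite in_itv/= => hx e; rewrite /W -e PhiK.
Qed.

Lemma is_derive_transport y : is_derive y (1 : R) W (m y / phi (W y)).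
Proof.
have [e _] := transport_spec y.
have h : is_derive (pam_cdf y) (1 : R) Pinv (phi (W y))^-1 by rewrite -e; exact: is_derive_Pinv.
have := is_derive_comp1 (is_derive_pam_cdf y) h.
by move=> h1; apply: (is_derive_eq h1); rewrite mulrC.
Qed.

Lemma continuous_transport : continuous W.
Proof. exact: is_derive_continuous is_derive_transport. Qed.

Lemma qbd_transport : qbd W.
Proof.
split; first by apply: continuous_measurable_fun; exact: continuous_transport.
have q1 : qbd (fun y => s^-1 * y + (- ((K%:R - 1) * d) / s)).
  by apply: qbdD; [apply: qbdZ; exact: qbd_id|exact: qbd_cst].
have q2 : qbd (fun y => s^-1 * y) by apply: qbdZ; exact: qbd_id.
have [C C0 hC] := qbd_bound q1; have [D D0 hD] := qbd_bound q2.
exists (C + D) => y; have [_ /andP[h1 h2]] := transport_spec y.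
have := hC y; have := hD y; rewrite !ler_norml => /andP[h3 h4] /andP[h5 h6].
have e1 : 0 <= 1 + y ^+ 2 by rewrite addr_ge0// sqr_ge0.
have e2 : 0 <= C * (1 + y ^+ 2) by rewrite mulr_ge0// ltW.
have e3 : 0 <= D * (1 + y ^+ 2) by rewrite mulr_ge0// ltW.
rewrite mulrDl; apply/andP; split.
  apply: le_trans h1; rewrite mulrDl mulNr (mulrC y); lra.
by apply: (le_trans h2); rewrite mulrC; lra.
Qed.

Variables (b c e : R) (delta : R -> R).
Hypotheses (b0 : 0 < b) (c0 : 0 < c) (e0 : 0 < e) (ce1 : c ^+ 2 + e ^+ 2 = 1).
Hypothesis qdelta : qbd delta.
Let fS := conv m (fun x => b * Phi x).
Hypothesis cfS : continuous fS.
(** Jensen's inequality for ln with weights [c^2] and [e^2], improved by a gain that depends on x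
    alone; delta = 0 is always possible. *)
Hypothesis deltaP : forall x y,
  delta x + (c ^+ 2 * ln (b * phi x / c) + e ^+ 2 * ln (phi (W y) / m y / e)) <=
  ln (c * (b * phi x) + e * (phi (W y) / m y)).

Let lt : lgrow (fun x => b * Phi x). Proof. exact: lgrow_scale_Phi. Qed.
Let nfS : nice fS. Proof. exact: nice_conv_Phi. Qed.
Let fS0 y : 0 < fS y. Proof. exact: nice_gt0. Qed.
Let JfS : J fS = 1.
Proof. by rewrite J_conv1 ?J_pam//; [exact: nm.1|move=> x; exact: ltW|exact: nfS.1]. Qed.

(* the likelihood ratio whose logarithm is averaged; it is centred by the change of
   variables u = e x - c W(y), the component orthogonal to c x + e W(y) *)
Let G x y := fS (y + b * Phi x) * (c * (b * phi x) + e * (phi (W y) / m y)) /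
  phi (c * x + e * W y).

(** With the orthogonal component u fixed, the dithered sum is a function of y alone. It is
    increasing with derivative dtheta, hence a substitution in the integral of fS. *)
Let theta u y := y + b * Phi ((u + c * W y) / e).
Let dtheta u y := 1 + b * phi ((u + c * W y) / e) * (c / e) * (m y / phi (W y)).

Let phip x : 0 < phi x := phi_gt0 x.

Let rotate x w : phi x * phi w = phi (c * x + e * w) * phi (e * x - c * w).
Proof.
rewrite /phi !normal_pdfE ?oner_eq0// /normal_fun mulrACA -expRD [RHS]mulrACA -expRD.
congr (_ * expR _); rewrite !subr0 expr1n.
have -> : x ^+ 2 = (c ^+ 2 + e ^+ 2) * x ^+ 2 by rewrite ce1 mul1r.
have -> : w ^+ 2 = (c ^+ 2 + e ^+ 2) * w ^+ 2 by rewrite ce1 mul1r.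
by field.
Qed.

(** The weighted sum in G is [e * phi (W y) / m y] times the Jacobian dtheta, and rotation
    invariance turns the remaining Gaussian factors into [phi u]. *)
Let G_subst u y : phi ((u + c * W y) / e) * m y * G ((u + c * W y) / e) y =
  e * (phi u * (fS (theta u y) * dtheta u y)).
Proof.
rewrite /G /theta /dtheta; set x := (u + c * W y) / e.
have uE : u = e * x - c * W y by rewrite /x; field; rewrite gt_eqF.
have h := rotate x (W y).
have -> : phi u = phi x * phi (W y) / phi (c * x + e * W y).
  by rewrite h mulrAC divff ?mul1r -?uE// gt_eqF.
by field; rewrite !gt_eqF.
Qed.

Let G_gt0 x y : 0 < G x y.
Proof.
exact: divr_gt0 (mulr_gt0 (fS0 _) (addr_gt0 (mulr_gt0 c0 (mulr_gt0 b0 (phip x)))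
  (mulr_gt0 e0 (divr_gt0 (phip _) (m0 y))))) (phip _).
Qed.

Let m_phi_G_ge0 x y : 0 <= phi x * m y * G x y.
Proof. exact: ltW (mulr_gt0 (mulr_gt0 (phip x) (m0 y)) (G_gt0 x y)). Qed.

Let mW : measurable_fun setT W := qbd_transport.1.
Let mm : measurable_fun setT m := nm.1.1.
Let mphi : measurable_fun setT phi := measurable_normal_pdf 0 1.
Let mPhi : measurable_fun setT Phi.
Proof. by apply: continuous_measurable_fun; exact: continuous_Phi. Qed.

Let is_derive_theta u y : is_derive y (1 : R) (theta u) (dtheta u y).
Proof.
pose l z := (u + c * W z) / e.
have dl : is_derive y (1 : R) l (c / e * (m y / phi (W y))).
  have h1 := is_deriveD (is_derive_cst (u / e) y (1 : R)) (is_deriveZ (c / e) (is_derive_transport y)).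
  rewrite (_ : l = cst (u / e) + (c / e) \*: W); last first.
    by apply/funext => z; rewrite /l /= mulrDl mulrAC.
  by apply: (is_derive_eq h1); rewrite add0r.
have h1 := is_deriveD (is_derive_id y (1 : R))
  (is_deriveZ b (is_derive_comp1 dl (is_derive_Phi (l y)))).
by apply: (is_derive_eq h1); rewrite /dtheta /GRing.scale/= !mulrA.
Qed.

Lemma continuous_pam : continuous m.
Proof.
have h (r : seq 'I_K) : continuous (fun y => \sum_(i <- r) normal_pdf (d * i%:R) s y).
  elim: r => [|i r IH].
    rewrite (_ : (fun y => _) = cst 0); first exact: cst_continuous.
    by apply/funext => y; rewrite big_nil.
  rewrite (_ : (fun y => _) = fun y => normal_pdf (d * i%:R) s y +
    \sum_(i <- r) normal_pdf (d * i%:R) s y); last by apply/funext => y; rewrite big_cons.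
  move=> y; apply: cvgD; last exact: IH.
  by apply: continuous_normal_pdf; rewrite gt_eqF.
by move=> y; apply: cvgM; [exact: cvg_cst|exact: h].
Qed.

Let continuous_dtheta u : continuous (dtheta u).
Proof.
have cl : continuous (fun z => (u + c * W z) / e).
  move=> y; apply: cvgM; last exact: cvg_cst.
  apply: cvgD; first exact: cvg_cst.
  by apply: cvgM; [exact: cvg_cst|exact: continuous_transport].
have cpl : continuous (fun z => phi ((u + c * W z) / e)).
  exact: continuous_comp_fun cl (@continuous_phi R).
have cpW : continuous (fun z => phi (W z)).
  exact: continuous_comp_fun continuous_transport (@continuous_phi R).
move=> y; apply: cvgD; first exact: cvg_cst.
apply: cvgM.
  apply: cvgM; last exact: cvg_cst.
  by apply: cvgM; [exact: cvg_cst|exact: cpl].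
apply: cvgM; first exact: continuous_pam.
by apply: cvgV; [rewrite gt_eqF|exact: cpW].
Qed.

Let dtheta_ge0 u y : 0 <= dtheta u y.
Proof.
exact: ltW (addr_gt0 ltr01 (mulr_gt0 (mulr_gt0 (mulr_gt0 b0 (phip _)) (divr_gt0 c0 e0))
  (divr_gt0 (m0 y) (phip _)))).
Qed.

Let measurable2 (F : R -> R) (g : R * R -> R) : measurable_fun setT F -> measurable_fun setT g ->
  measurable_fun setT (fun z => F (g z)).
Proof. exact: measurableT_comp. Qed.

Let mfst : measurable_fun setT (fst : R * R -> R). Proof. exact: measurable_fst. Qed.
Let msnd : measurable_fun setT (snd : R * R -> R). Proof. exact: measurable_snd. Qed.

Let measurable_H : measurable_fun setT (fun z : R * R =>
   (phi z.1 * (fS (theta z.1 z.2) * dtheta z.1 z.2))%:E).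
Proof.
have ml : measurable_fun setT (fun z : R * R => (z.1 + c * W z.2) / e).
  apply: (@measurable_funM _ _ _ _ (fun z : R * R => z.1 + c * W z.2) (cst e^-1)) => //.
  apply: measurable_funD => //.
  by apply: (@measurable_funM _ _ _ _ (cst c)) => //; exact: measurable2.
apply/measurable_EFinP; apply: measurable_funM; first exact: measurable2.
apply: measurable_funM.
  apply: (measurable2 nfS.1.1); apply: measurable_funD => //.
  by apply: (@measurable_funM _ _ _ _ (cst b)) => //; exact: measurable2.
apply: measurable_funD => //; apply: measurable_funM.
  apply: (@measurable_funM _ _ _ _ _ (cst (c / e))) => //.
  by apply: (@measurable_funM _ _ _ _ (cst b)) => //; exact: measurable2.
apply: measurable_funM; first exact: measurable2.
apply: (measurable2 (F := fun y => (phi (W y))^-1)) => //.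
apply: continuous_measurable_fun => y; apply: cvgV; first by rewrite gt_eqF.
by apply: (@continuous_comp _ _ _ W phi); [exact: continuous_transport|exact: continuous_phi].
Qed.

Let H_ge0 u y : 0 <= phi u * (fS (theta u y) * dtheta u y).
Proof. exact: mulr_ge0 (ltW (phip u)) (mulr_ge0 (ltW (fS0 _)) (dtheta_ge0 u y)). Qed.

Let measurable_G y : measurable_fun setT (fun x => (phi x * m y * G x y)%:E).
Proof.
have -> : (fun x => (phi x * m y * G x y)%:E) = fun x =>
   (e * (phi (e * x + - (c * W y)) * (fS (theta (e * x + - (c * W y)) y) * dtheta (e * x + - (c * W y)) y)))%:E.
  apply/funext => x; rewrite -G_subst; have -> // : (e * x - c * W y + c * W y) / e = x.
  by field; rewrite gt_eqF.
apply/measurable_EFinP; apply: (@measurable_funM _ _ _ _ (cst e)) => //.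
apply: (measurableT_comp (f := fun u => phi u * (fS (theta u y) * dtheta u y)));
  last exact: measurable_affine.
by have /measurable_EFinP := measurableT_comp measurable_H (measurable_pair2 y).
Qed.

Let inner y : (\int[mu]_x (phi x * m y * G x y)%:E =
  \int[mu]_u (phi u * (fS (theta u y) * dtheta u y))%:E)%E.
Proof.
have mG := measurable_G y.
rewrite (@ge0_integral_affine_pos _ e^-1 (c * W y / e)) ?invr_gt0//; last first.
  by move=> x; rewrite lee_fin.
rewrite -ge0_integralZl//; last 3 first.
- exact: (measurableT_comp mG (measurable_affine e^-1 (c * W y / e))).
- by move=> x _; rewrite lee_fin.
- by rewrite lee_fin invr_ge0 ltW.
apply: eq_integral => u _; rewrite -EFinM; congr EFin.
have -> : e^-1 * u + c * W y / e = (u + c * W y) / e by ring.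
by rewrite G_subst mulKf// gt_eqF.
Qed.

(** In the order dy du the inner integral is that of [fS (theta u y) * dtheta u y], at most the mass
    1 of fS for each u. *)
Let total_le1 : (\int[mu]_y \int[mu]_x (phi x * m y * G x y)%:E <= 1)%E.
Proof.
under eq_integral do rewrite inner.
rewrite -(@fubini_tonelli _ _ _ _ _ mu mu (fun z : R * R =>
   (phi z.1 * (fS (theta z.1 z.2) * dtheta z.1 z.2))%:E) measurable_H); last first.
  by move=> z; rewrite lee_fin.
rewrite -(integral_normal_pdf (0 : R) 1); apply: ge0_le_integral => //.
- by move=> x _; apply: integral_ge0 => y _; rewrite lee_fin.
- apply: (@measurable_fun_fubini_tonelli_F _ _ _ _ _ mu (fun z : R * R =>
     (phi z.1 * (fS (theta z.1 z.2) * dtheta z.1 z.2))%:E)) => //.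
  by move=> z; rewrite lee_fin.
- by apply/measurable_EFinP.
move=> u _; rewrite /=.
under eq_integral do rewrite EFinM.
rewrite ge0_integralZl//.
- rewrite -[leRHS]mule1; apply: lee_pmul => //.
  + by rewrite lee_fin ltW.
  + by apply: integral_ge0 => y _; rewrite lee_fin mulr_ge0// ltW.
  + rewrite -JfS; apply: integral_subst_le => //; first exact: nfS.1.
    * by move=> y; exact: ltW.
- apply/(@measurable_EFinP _ R); apply: continuous_measurable_fun => y.
  apply: cvgM; last exact: continuous_dtheta.
  apply: (@continuous_comp _ _ _ (theta u) fS); last exact: cfS.
  exact: is_derive_continuous (is_derive_theta u) y.
- by move=> y _; rewrite lee_fin mulr_ge0// ltW.
- by rewrite lee_fin ltW.
Qed.

(** [ln G <= G - 1] is averaged over the product of phi and m, where G has mean at most 1. In ln G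
    the constants and squares of the Gaussian logarithms cancel and leave the cross term
    [c * e * x * W y], which averages to 0 because X is centred. *)
Lemma epi_transport :
  c ^+ 2 * (ln b - ln c) + e ^+ 2 * (ent m - ln e) + J (fun x => phi x * delta x) <= ent fS.
Proof.
pose k := c ^+ 2 * (ln b - ln c) - e ^+ 2 * ln e.
pose L x y := ln (fS (y + b * Phi x)) + delta x + k - e ^+ 2 * ln (m y) + c * e * x * W y.
have LG x y : L x y + 1 <= G x y.
  have h1 := phip x; have h2 := phip (W y); have h3 := phip (c * x + e * W y).
  have A0 : 0 < c * (b * phi x) + e * (phi (W y) / m y).
    exact: addr_gt0 (mulr_gt0 c0 (mulr_gt0 b0 h1)) (mulr_gt0 e0 (divr_gt0 h2 (m0 y))).
  have Gp := G_gt0 x y.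
  have := ln_leB1 Gp; rewrite lerBrDr; apply: le_trans; rewrite lerD2r.
  rewrite /G ln_div ?posrE ?(mulr_gt0 (fS0 _) A0)// lnM ?posrE//.
  have := deltaP x y.
  have -> : ln (b * phi x / c) = ln b + ln (phi x) - ln c.
    by rewrite ln_div ?posrE ?mulr_gt0// lnM ?posrE.
  have -> : ln (phi (W y) / m y / e) = ln (phi (W y)) - ln (m y) - ln e.
    by rewrite !ln_div ?posrE ?divr_gt0.
  have lphi z : ln (phi z) = ln (normal_peak 1) - z ^+ 2 / 2.
    by rewrite /phi ln_normal_pdf// ln1 !subr0 expr1n mulr1.
  rewrite !lphi /L /k.
  set a := ln (normal_peak 1).
  have -> : (c * x + e * W y) ^+ 2 = c ^+ 2 * x ^+ 2 + 2 * (c * e * x * W y) + e ^+ 2 * W y ^+ 2 by ring.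
  have ea : c ^+ 2 * a + e ^+ 2 * a = a by rewrite -mulrDl ce1 mul1r.
  rewrite -{3}ea; lra.
have lfS : qbd (fun y => ln (fS y)) by exact: qbd_ln.
have lm : qbd (fun y => ln (m y)) by exact: qbd_ln.
have gphi : gdom phi by exact: gdom_normal.
have gpd : gdom (fun x => phi x * delta x) by exact: gdomM.
pose D := J (fun x => phi x * delta x).
pose A y := avg (fun y => ln (fS y)) (fun x => b * Phi x) y + D + k - e ^+ 2 * ln (m y) + 1.
have qA : qbd A.
  apply: qbdD; last exact: qbd_cst.
  apply: qbdB; last exact: qbdZ.
  apply: qbdD; last exact: qbd_cst.
  by apply: qbdD; [exact: qbd_avg|exact: qbd_cst].
have gmA : gdom (fun y => m y * A y) by apply: gdomM => //; exact: nm.1.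
have gx : gdom (fun x => phi x * x) by apply: gdomM => //; exact: qbd_id.
have gL y : gdom (fun x => phi x * m y * (L x y + 1)) /\
    J (fun x => phi x * m y * (L x y + 1)) = m y * A y.
  have g1 : gdom (fun x => phi x * ln (fS (y + b * Phi x))) by exact: (gdom_phi_comp y lfS lt).
  pose z := k - e ^+ 2 * ln (m y) + 1.
  have g2 : gdom (fun x => phi x * ln (fS (y + b * Phi x)) + phi x * delta x) by exact: gdomD.
  have g3 : gdom (fun x => z * phi x) by exact: gdomZ.
  have g4 : gdom (fun x => c * e * W y * (phi x * x)) by exact: gdomZ.
  have g5 : gdom (fun x => phi x * ln (fS (y + b * Phi x)) + phi x * delta x + z * phi x) by exact: gdomD.
  have E : (fun x => phi x * m y * (L x y + 1)) = fun x => m y *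
     (phi x * ln (fS (y + b * Phi x)) + phi x * delta x + z * phi x + c * e * W y * (phi x * x)).
    by apply/funext => x; rewrite /L /z; ring.
  rewrite E; split; first by apply: gdomZ; exact: gdomD.
  rewrite JZ; last exact: gdomD.
  congr (_ * _); rewrite JD// JD// JD// !JZ// J_phi_id J_normal mulr0 addr0 mulr1.
  by rewrite /A /z /avg /D; ring.
have step1 : ((J (fun y => m y * A y))%:E <= 1)%E.
  apply: le_trans total_le1; apply: J_le_integral => //.
  - under eq_fun do rewrite inner.
    apply: (@measurable_fun_fubini_tonelli_G _ _ _ _ _ mu (fun z : R * R =>
     (phi z.1 * (fS (theta z.1 z.2) * dtheta z.1 z.2))%:E)) => //.
    by move=> z; rewrite lee_fin.
  - by move=> y; apply: integral_ge0 => x _; rewrite lee_fin.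
  move=> y; have [g1 <-] := gL y; apply: J_le_integral => //.
  - by move=> x; rewrite lee_fin.
  - by move=> x; rewrite lee_fin ler_wpM2l// mulr_ge0// ltW.
have gm := nm.1.
have E : J (fun y => m y * A y) = - ent fS + D + k + e ^+ 2 * ent m + 1.
  have g1 : gdom (fun y => m y * avg (fun y => ln (fS y)) (fun x => b * Phi x) y).
    by apply: gdomM => //; exact: qbd_avg.
  have g2 : gdom (fun y => (D + k + 1) * m y) by exact: gdomZ.
  have g3 : gdom (fun y => e ^+ 2 * (m y * ln (m y))) by apply: gdomZ; exact: gdomM.
  transitivity (J (fun y => m y * avg (fun y => ln (fS y)) (fun x => b * Phi x) y +
     (D + k + 1) * m y - e ^+ 2 * (m y * ln (m y)))).
    by apply: eqJ => y; rewrite /A; ring.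
  rewrite JB//; last exact: gdomD.
  have Jm : J m = 1 by exact: J_pam.
  rewrite JD// (JZ _ gm) Jm (@JZ _ (e ^+ 2) (fun y => m y * ln (m y))); last exact: gdomM.
  rewrite J_conv//; [|by move=> y; exact: ltW|exact: nfS.1].
  by rewrite /ent; ring.
rewrite E lee_fin in step1.
by rewrite -/D; rewrite /k in step1; lra.
Qed.

End Transport.
End EntropyPower.

(** * Comparison of the entropies with F and G *)

Section RateBounds.
Variable R : realType.
Local Notation phi := (@phi R).
Local Notation Phi := (@Phi R).
Implicit Types (f g p q t : R -> R) (a b c d e m s u v x y : R) (K : nat).

(** The tangent of ln at the weighted mean z; strictness already occurs at p, which lies below z. *)
Lemma weighted_ln_lt c e (p q : R) : c ^+ 2 + e ^+ 2 = 1 -> 0 < p -> 0 < q ->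
  0 < c -> 0 < e -> p < q ->
  c ^+ 2 * ln p + e ^+ 2 * ln q < ln (c ^+ 2 * p + e ^+ 2 * q).
Proof.
move=> ce p0 q0 c0 e0 pq; set z := c ^+ 2 * p + e ^+ 2 * q.
have c20 : 0 < c ^+ 2 by rewrite exprn_gt0.
have e20 : 0 < e ^+ 2 by rewrite exprn_gt0.
have z0 : 0 < z by rewrite addr_gt0 ?mulr_gt0.
have pz : p < z by rewrite -[p]mul1r -ce /z mulrDl ltrD2l ltr_pM2l.
have h1 : c ^+ 2 * (ln p - ln z) < c ^+ 2 * (p / z - 1).
  rewrite ltr_pM2l// -ln_div ?posrE// ln_ltB1 ?divr_gt0//.
  by rewrite lt_eqF// ltr_pdivrMr// mul1r.
have h2 : e ^+ 2 * (ln q - ln z) <= e ^+ 2 * (q / z - 1).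
  by rewrite ler_pM2l// -ln_div ?posrE// ln_leB1 ?divr_gt0.
have h3 : c ^+ 2 * (p / z - 1) + e ^+ 2 * (q / z - 1) = 0.
  transitivity (z / z - (c ^+ 2 + e ^+ 2)); first by rewrite /z; ring.
  by rewrite ce divff ?subrr// gt_eqF.
have h4 : c ^+ 2 * ln z + e ^+ 2 * ln z = ln z by rewrite -mulrDl ce mul1r.
lra.
Qed.

Lemma weighted_ln_le c e (p q : R) : c ^+ 2 + e ^+ 2 = 1 -> 0 < p -> 0 < q ->
  0 < c -> 0 < e ->
  c ^+ 2 * ln p + e ^+ 2 * ln q <= ln (c ^+ 2 * p + e ^+ 2 * q).
Proof.
move=> ce p0 q0 c0 e0; have [pq|qp|->] := ltgtP p q.
- exact: ltW (weighted_ln_lt ce p0 q0 c0 e0 pq).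
- rewrite [leLHS]addrC [in leRHS]addrC; rewrite addrC in ce.
  exact: ltW (weighted_ln_lt ce q0 p0 e0 c0 qp).
- by rewrite -!mulrDl ce !mul1r.
Qed.

Lemma continuous_um b s : 0 < b -> 0 < s -> continuous (um b s).
Proof.
move=> b0 s0.
rewrite (_ : um b s = fun y => (Phi ((y - 0) / s) - Phi ((y - 0 - b) / s)) / b); last first.
  by apply/funext => y; rewrite /um conv_normal_Phi.
have c1 k : continuous (fun y : R => Phi ((y - k) / s)).
  apply: (@continuous_comp_fun _ (fun y => (y - k) / s)); last exact: continuous_Phi.
  move=> y; apply: cvgM; last exact: cvg_cst.
  by apply: (@cvgB _ R^o); [exact: cvg_id|exact: cvg_cst].
move=> y; apply: cvgM; last exact: cvg_cst.
apply: (@cvgB _ R^o); first exact: c1.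
rewrite (_ : (fun y => Phi ((y - 0 - b) / s)) = fun y => Phi ((y - b) / s)); last first.
  by apply/funext => z; rewrite subr0.
by rewrite subr0; exact: c1.
Qed.

(* the weights in which the entropy power inequality is tight *)
Lemma epi_weights b h (S := b ^+ 2 + expR (2 * h)) (c := b / Num.sqrt S)
    (e := expR h / Num.sqrt S) : 0 < b ->
  [/\ 0 < c, 0 < e, c ^+ 2 + e ^+ 2 = 1 &
   c ^+ 2 * (ln b - ln c) + e ^+ 2 * (h - ln e) = ln S / 2].
Proof.
move=> b0; have S0 : 0 < S by rewrite addr_gt0 ?exprn_gt0 ?expR_gt0.
have q0 : 0 < Num.sqrt S by rewrite sqrtr_gt0.
have qE : Num.sqrt S ^+ 2 = S by rewrite sqr_sqrtr// ltW.
have ce : c ^+ 2 + e ^+ 2 = 1.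
  rewrite /c /e !expr_div_n qE -mulrDl -expRM_natl -/S mulfV// gt_eqF//.
have lS : ln S = ln (Num.sqrt S) + ln (Num.sqrt S).
  by rewrite -{1}qE expr2 lnM ?posrE.
split=> //; [by rewrite divr_gt0|by rewrite divr_gt0 ?expR_gt0|].
rewrite /c /e !ln_div ?posrE ?expR_gt0// expRK -/c -/e.
have -> : c ^+ 2 * (ln b - (ln b - ln (Num.sqrt S))) + e ^+ 2 * (h - (h - ln (Num.sqrt S))) =
  (c ^+ 2 + e ^+ 2) * ln (Num.sqrt S) by ring.
by rewrite ce mul1r lS; field.
Qed.

Lemma conv_pam_um K d s : (0 < K)%N -> 0 < d -> 0 < s ->
  conv (pam K d s) (fun x => d * Phi x) = um (K%:R * d) s.
Proof. by move=> *; apply/funext => y; exact: conv_pam_Phi. Qed.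

(** The dither is exactly one spacing wide, so the sum is uniform on [[0, K d]] plus noise; plain
    Jensen, with delta = 0, is enough for G. *)
Lemma epi_pam K d s : (0 < K)%N -> 0 < d -> 0 < s ->
  ln (d ^+ 2 + expR (2 * ent (pam K d s))) / 2 <= ent (um (K%:R * d) s).
Proof.
move=> K0 d0 s0; set h := ent (pam K d s).
have [c0 e0 ce hE] := @epi_weights d h d0.
set c := d / _ in c0 ce hE; set e := expR h / _ in e0 ce hE.
clearbody c e.
have := @epi_transport R K d s K0 (ltW d0) s0 d c e (fun=> 0) d0 c0 e0 ce (qbd_cst 0).
rewrite conv_pam_um// -/h hE.
have -> : J (fun x => phi x * 0) = 0 :> R.
  by rewrite -[RHS]J0; apply: eqJ => x; rewrite mulr0.
rewrite addr0; apply; first by apply: continuous_um => //; rewrite mulr_gt0 ?ltr0n.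
move=> x y; rewrite add0r.
have p0 := phi_gt0 x; have w0 := phi_gt0 (transport K d s y).
have m0 : 0 < pam K d s y by exact: nice_gt0 (nice_pam d K0 s0).
have A0 : 0 < d * phi x / c by rewrite divr_gt0 ?mulr_gt0.
have B0 : 0 < phi (transport K d s y) / pam K d s y / e by rewrite !divr_gt0.
have := weighted_ln_le ce A0 B0 c0 e0.
have -> : c ^+ 2 * (d * phi x / c) = c * (d * phi x) by field; rewrite gt_eqF.
have -> // : e ^+ 2 * (phi (transport K d s y) / pam K d s y / e) =
  e * (phi (transport K d s y) / pam K d s y) by field; rewrite !gt_eqF.
Qed.

Lemma pam1 d s : pam 1 d s = normal_pdf 0 s.
Proof. by apply/funext => y; rewrite /pam big_ord1 mulr0 invr1 mul1r. Qed.

(** For a single point the transport is y / s, so [phi (W y) / m y] is the constant s. The Jensen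
    gap then depends on x only and can be taken as delta. *)
Lemma epi_normal_lt b s : 0 < b -> 0 < s ->
  ln (b ^+ 2 + expR (2 * gent s)) / 2 < ent (um b s).
Proof.
move=> b0 s0; set h := gent s.
have [c0 e0 ce hE] := @epi_weights b h b0.
set c := b / _ in c0 ce hE; set e := expR h / _ in e0 ce hE.
clearbody c e.
pose P x := b * phi x / c; pose q := s / e.
have P0 x : 0 < P x by rewrite divr_gt0 ?mulr_gt0 ?phi_gt0.
have q0 : 0 < q by rewrite divr_gt0.
pose delta x := ln (c ^+ 2 * P x + e ^+ 2 * q) - (c ^+ 2 * ln (P x) + e ^+ 2 * ln q).
have nphi : nice phi by exact: nice_normal.
have mP : measurable_fun setT (fun x => c ^+ 2 * P x + e ^+ 2 * q).
  apply: measurable_funD => //; apply: (@measurable_funM _ _ _ _ (cst (c ^+ 2))) => //.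
  apply: (@measurable_funM _ _ _ _ (fun x => b * phi x) (cst c^-1)) => //.
  by apply: (@measurable_funM _ _ _ _ (cst b)) => //; exact: measurable_normal_pdf.
have lnP x : ln (P x) = ln b - ln c + ln (phi x).
  by rewrite /P ln_div ?posrE ?mulr_gt0 ?phi_gt0// lnM ?posrE ?phi_gt0//; ring.
have qd : qbd delta.
  apply: qbdB.
    have eq0 : 0 < e ^+ 2 * q by rewrite mulr_gt0 ?exprn_gt0.
    pose M := c ^+ 2 * (b * normal_peak 1 / c) + e ^+ 2 * q.
    apply: (@qbd_bounded _ _ (`|ln (e ^+ 2 * q)| + `|ln M|)).
      exact: (measurableT_comp (@measurable_ln _) mP).
    move=> x; have z0 : 0 < c ^+ 2 * P x by rewrite mulr_gt0 ?exprn_gt0.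
    have l1 : ln (e ^+ 2 * q) <= ln (c ^+ 2 * P x + e ^+ 2 * q).
      by rewrite ler_ln ?posrE ?addr_gt0// lerDr ltW.
    have l2 : ln (c ^+ 2 * P x + e ^+ 2 * q) <= ln M.
      rewrite ler_ln ?posrE ?addr_gt0//; last first.
        by apply: mulr_gt0 (exprn_gt0 2 c0) (divr_gt0 (mulr_gt0 b0 _) c0);
          rewrite normal_peak_gt0 ?oner_eq0.
      rewrite lerD2r ler_pM2l ?exprn_gt0// ler_pM2r ?invr_gt0// ler_pM2l//.
      by apply: normal_pdf_ub; rewrite oner_eq0.
    rewrite ler_norml; apply/andP; split.
      apply: le_trans l1; rewrite opprD.
      have := ler_norm (- ln (e ^+ 2 * q)); rewrite normrN.
      have := normr_ge0 (ln M); lra.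
    apply: (le_trans l2); have := ler_norm (ln M); have := normr_ge0 (ln (e ^+ 2 * q)); lra.
  apply: qbdD; last exact: qbd_cst.
  apply: qbdZ; rewrite (_ : (fun x => ln (P x)) = fun x => ln b - ln c + ln (phi x)).
    by apply: qbdD; [exact: qbd_cst|exact: qbd_ln].
  by apply/funext => x; exact: lnP.
have d0 x : 0 <= delta x by rewrite subr_ge0 weighted_ln_le.
have gpd : gdom (fun x => phi x * delta x) by apply: gdomM => //; exact: nphi.1.
have Jd : 0 < J (fun x => phi x * delta x).
  have k0 : 0 < q * c / b by exact: divr_gt0 (mulr_gt0 q0 c0) b0.
  (* [pam 1 1 1] is phi, and the gap is positive wherever [P x < q], that is [phi x < q c / b]. *)
  have [a ha] := @pam_left_lt R 1 1 1 _ isT ltr01 ltr01 k0.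
  apply: (@J_gt0 _ _ (a - 1) a) => //; first by rewrite gtrBl.
    by move=> x; rewrite mulr_ge0 ?(ltW (phi_gt0 x)).
  move=> x /andP[_ xa]; rewrite mulr_gt0 ?phi_gt0// subr_gt0 weighted_ln_lt//.
  by have := ha x xa; rewrite pam1 /P -/(phi x) ltr_pdivrMr// ltr_pdivlMr// mulrC.
have := @epi_transport R 1 b s isT (ltW b0) s0 b c e delta b0 c0 e0 ce qd.
rewrite conv_pam_um// mul1r pam1 ent_normal// -/h hE => h1.
apply: lt_le_trans (h1 _ _); first by rewrite ltrDl.
  exact: continuous_um.
move=> x y.
have wE : transport 1 b s y = y / s.
  have [_ /andP[h2 h3]] := @transport_spec R 1 b s isT (ltW b0) s0 y.
  by apply/eqP; rewrite eq_le h3/=; move: h2; rewrite subrr mul0r subr0.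
have -> : phi (transport 1 b s y) / normal_pdf 0 s y = s.
  rewrite wE -(@normal_pdf_affine _ 0 s)// addr0.
  have -> : s * (y / s) = y by field; rewrite gt_eqF.
  by rewrite mulfK// gt_eqF// normal_pdf_gt0.
have -> : c * (b * phi x) = c ^+ 2 * P x by rewrite /P; field; rewrite gt_eqF.
have -> : e * s = e ^+ 2 * q by rewrite /q; field; rewrite gt_eqF.
by rewrite -/(P x) -/q /delta subrK.
Qed.

Lemma sum_ord_mul (V : zmodType) (m n : nat) (F : nat -> V) :
  \sum_(i < m * n) F i = \sum_(j < n) \sum_(i < m) F (m * j + i)%N.
Proof.
rewrite -(big_mkord xpredT F) -(big_mkord xpredT (fun j => \sum_(i < m) F (m * j + i)%N)).
elim: n => [|n IH]; first by rewrite muln0 !big_geq.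
rewrite big_nat_recr//= -IH mulnS addnC (big_cat_nat (n := (m * n)%N))//= ?leq_addr//.
congr (_ + _); rewrite -{1}[(m * n)%N]add0n big_addn addKn big_mkord.
by apply: eq_bigr => i _; rewrite addnC.
Qed.

(** The superposition structure: the fine constellation is a uniform mixture of K2 translates of the
    K1-point one, by multiples of [K1 d]. *)
Lemma pam_mul K1 K2 d s y : (0 < K1)%N -> (0 < K2)%N -> 0 < s ->
  pam (K1 * K2) d s y =
  K2%:R^-1 * \sum_(j < K2) pam K1 d s (y - K1%:R * d * j%:R).
Proof.
move=> K10 K20 s0; rewrite /pam (sum_ord_mul _ _ (fun i => normal_pdf (d * i%:R) s y)).
rewrite natrM invfM -mulrA mulrCA; congr (_ * _); rewrite mulr_sumr; apply: eq_bigr => j _.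
congr (_ * _); apply: eq_bigr => i _.
have -> : d * (K1 * j + i)%:R = d * i%:R + K1%:R * d * j%:R by rewrite natrD natrM; ring.
by rewrite normal_pdf_shift.
Qed.

Lemma conv_normal_scale m s c y : 0 < s ->
  conv (normal_pdf m s) (fun x => c * x) y = normal_pdf m (Num.sqrt (s ^+ 2 + c ^+ 2)) y.
Proof.
move=> s0; set v := Num.sqrt _.
have v20 : 0 < s ^+ 2 + c ^+ 2 by rewrite ltr_pwDl ?exprn_gt0 ?sqr_ge0.
have v0 : 0 < v by rewrite sqrtr_gt0.
have vE : v ^+ 2 = s ^+ 2 + c ^+ 2 by rewrite sqr_sqrtr// ltW.
have sv0 : 0 < s / v by rewrite divr_gt0.
(* Bayes' rule: given the sum y, X is normal with mean [c (y - m) / v^2] and deviation [s / v], so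
   the joint density factors. *)
rewrite -[RHS]mulr1 -[X in _ = _ * X](J_normal (c * (y - m) / v ^+ 2) (s / v)).
rewrite -JZ; last exact: gdom_normal.
apply: eqJ => x; rewrite /phi !normal_pdfE ?gt_eqF//.
rewrite (normal_peak_div s0) (normal_peak_div v0) (normal_peak_div sv0) /normal_fun.
rewrite mulrACA -expRD [RHS]mulrACA -expRD; congr (_ * expR _).
  by field; rewrite !gt_eqF.
rewrite subr0 expr1n -(mulr_natl 1) -(mulr_natl (s ^+ 2)) -(mulr_natl (v ^+ 2)) -(mulr_natl ((s / v) ^+ 2)).
rewrite expr_div_n vE; field.
by rewrite !gt_eqF.
Qed.

Lemma conv_pam_scale K d s c : 0 < s ->
  conv (pam K d s) (fun x => c * x) = pam K d (Num.sqrt (s ^+ 2 + c ^+ 2)).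
Proof.
move=> s0; apply/funext => y; rewrite conv_sum; last 2 first.
- by move=> i; exact: gdom_normal.
- exact: lgrow_scale.
by rewrite /pam; congr (_ * _); apply: eq_bigr => i _; exact: conv_normal_scale.
Qed.

Lemma nice_shift f a : nice f -> nice (fun y => f (y - a)).
Proof.
move=> [gf [C hC]]; have [D D0 hD] := qbd_bound (qbd_shift a (@qbd_sqr R)).
split; first exact: gdom_shift.
exists (`|C| * (1 + D)) => y; apply: le_trans (hC (y - a)); rewrite ler_expR lerN2.
apply: (@le_trans _ _ (`|C| * (1 + (y - a) ^+ 2))).
  by rewrite ler_wpM2r ?ler_norm// addr_ge0// sqr_ge0.
rewrite -mulrA ler_wpM2l//; have := hD y; rewrite ger0_norm ?sqr_ge0// mulrDl mul1r.
by have := sqr_ge0 y; lra.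
Qed.

(* degradedness: the second channel is the first one followed by additional Gaussian noise *)
Lemma ent_pam_degraded K1 K2 d s1 s2 : (0 < K1)%N -> (0 < K2)%N -> 0 < s1 -> s1 < s2 ->
  ent (pam (K1 * K2) d s2) - ent (pam K1 d s2) <=
  ent (pam (K1 * K2) d s1) - ent (pam K1 d s1).
Proof.
move=> K10 K20 s10 s12; have s20 := lt_trans s10 s12.
pose c := Num.sqrt (s2 ^+ 2 - s1 ^+ 2).
have cE : Num.sqrt (s1 ^+ 2 + c ^+ 2) = s2.
  rewrite sqr_sqrtr; last by rewrite subr_ge0 lerXn2r ?nnegrE ?(ltW s10) ?(ltW s20) ?(ltW s12).
  by rewrite addrC subrK sqrtr_sqr gtr0_norm.
have KK : (0 < K1 * K2)%N by rewrite muln_gt0 K10.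
pose p (j : 'I_K2) (y : R) := pam K1 d s1 (y - K1%:R * d * j%:R).
have np j : nice (p j) by apply: nice_shift; exact: nice_pam.
have cp j : conv (p j) (fun x => c * x) = fun y => pam K1 d s2 (y - K1%:R * d * j%:R).
  by apply/funext => y; rewrite conv_shift (conv_pam_scale K1 d c s10) cE.
have Jp j : J (p j) = 1 by rewrite /p J_shift ?J_pam//; exact: gdom_pam.
have h2 j : ent (p j) = ent (pam K1 d s1) := ent_shift _ (nice_pam d K10 s10).
have pE y : pam (K1 * K2) d s1 y = K2%:R^-1 * \sum_(j < K2) p j y := pam_mul d y K10 K20 s10.
clearbody p.
have := @data_processing R K2 p (pam (K1 * K2) d s1) (fun x => c * x) K20 (lgrow_scale c)
  np (nice_pam d KK s10).
move=> /(_ Jp); rewrite (conv_pam_scale (K1 * K2) d c s10) cE.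
have ncp j : nice (conv (p j) (fun x => c * x)).
  by rewrite cp; apply: nice_shift; exact: nice_pam.
move=> /(_ ncp (nice_pam d KK s20) pE).
have h1 j : ent (conv (p j) (fun x => c * x)) = ent (pam K1 d s2).
  by rewrite cp (ent_shift _ (nice_pam d K10 s20)).
have e1 : \sum_(j < K2) ent (conv (p j) (fun x => c * x)) = K2%:R * ent (pam K1 d s2).
  transitivity (\sum_(j < K2) ent (pam K1 d s2)); first by apply: eq_bigr.
  by rewrite big_const_ord iter_addr_0 mulr_natl.
have e2 : \sum_(j < K2) ent (p j) = K2%:R * ent (pam K1 d s1).
  transitivity (\sum_(j < K2) ent (pam K1 d s1)); first by apply: eq_bigr.
  by rewrite big_const_ord iter_addr_0 mulr_natl.
rewrite e1.
rewrite e2.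
have Kn : K2%:R != 0 :> R by rewrite pnatr_eq0 -lt0n.
have aux (x y z w : R) : x - K2%:R^-1 * (K2%:R * y) <= z - K2%:R^-1 * (K2%:R * w) ->
  x - y <= z - w by rewrite (mulKf Kn) (mulKf Kn).
exact: aux.
Qed.

Lemma expR_2gent s : 0 < s -> expR (2 * gent s) = 2 * pi * eul R * s ^+ 2.
Proof.
move=> s0; have p0 : 0 < normal_peak 1 :> R by rewrite normal_peak_gt0 ?oner_eq0.
have pE : (normal_peak 1 : R) ^- 2 = 2 * pi.
  rewrite /normal_peak expr1n mul1r exprVn invrK sqr_sqrtr ?mulr_natl//.
  by rewrite mulrn_wge0 ?pi_ge0.
have -> : expR (2 * gent s) = eul R * s ^+ 2 * (normal_peak 1) ^- 2.
  have -> : 2 * gent s = 1 + (ln s + ln s) - (ln (normal_peak 1) + ln (normal_peak 1)).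
    by rewrite /gent; field.
  by rewrite expRD expRN (expRD 1) (expRD (ln s)) (expRD (ln (normal_peak 1))) !lnK ?posrE// -!expr2.
by rewrite pE; ring.
Qed.

Lemma expR_gent_sqrt s : 0 < s -> expR (gent s) = Num.sqrt (2 * pi * eul R) * s.
Proof.
move=> s0; have h : expR (gent s) ^+ 2 = (Num.sqrt (2 * pi * eul R) * s) ^+ 2.
  rewrite -expRM_natl expR_2gent// exprMn sqr_sqrtr//.
  by rewrite !mulr_ge0 ?pi_ge0 ?expR_ge0.
apply/eqP; rewrite -(@eqrXn2 _ 2) ?h ?expR_ge0//.
by rewrite mulr_ge0 ?sqrtr_ge0// ltW.
Qed.

Lemma gent_sqrt s v : 0 < s -> 0 <= v ->
  gent (Num.sqrt (s ^+ 2 + v)) = gent s + ln (1 + v / s ^+ 2) / 2.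
Proof.
move=> s0 v0; have v20 : 0 < s ^+ 2 + v by rewrite ltr_pwDl ?exprn_gt0.
set w := Num.sqrt _; have w0 : 0 < w by rewrite sqrtr_gt0.
have r0 : 0 <= v / s ^+ 2 by rewrite divr_ge0// exprn_ge0// ltW.
have wE : ln w + ln w = ln s + ln s + ln (1 + v / s ^+ 2).
  rewrite -!lnM ?posrE ?mulr_gt0 ?ltr_pwDl//; congr ln.
  by rewrite -expr2 sqr_sqrtr ?(ltW v20)//; field; rewrite gt_eqF.
rewrite /gent; lra.
Qed.

Let l2 : 0 < ln 2 :> R. Proof. by rewrite ln_gt0// ltr1n. Qed.

Lemma log2K x : log2 x * ln 2 = ln x.
Proof. by rewrite /log2 divfK// gt_eqF. Qed.

Lemma log2K_half x : log2 x / 2 * ln 2 = ln x / 2.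
Proof. by rewrite -(log2K x); ring. Qed.

Lemma ent_le_Cup f s a : 0 < s -> 0 < a -> nice f -> J f = 1 -> noisy_peak s a f ->
  ent f - gent s <= Cup a s * ln 2.
Proof.
move=> s0 a0 nf Jf hf; rewrite -ler_pdivrMr// le_min !ler_pdivrMr//; apply/andP; split.
  have := ent_noisy_peak_sqr s0 a0 nf Jf hf.
  rewrite gent_sqrt//; last by rewrite divr_ge0// sqr_ge0.
  rewrite log2K_half.
  have -> : a ^+ 2 / 4 / s ^+ 2 = a ^+ 2 / (4 * s ^+ 2) by field; rewrite gt_eqF.
  lra.
rewrite log2K; have := ent_noisy_peak_lin s0 a0 nf Jf hf.
have g0 := expR_gt0 (gent s); have q0 : 0 < a + expR (gent s) by rewrite addr_gt0.
rewrite -expR_gent_sqrt//.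
have -> : 1 + a / expR (gent s) = (a + expR (gent s)) / expR (gent s) by field; rewrite gt_eqF.
by rewrite ln_div ?posrE// expRK; lra.
Qed.

Lemma ent_um_le_Efun b s : 0 < b -> 0 < s -> ent (um b s) - gent s <= Efun b s * ln 2.
Proof.
move=> b0 s0; have nu : nice (um b s) := nice_conv_Phi b0 (nice_normal 0 s0).
have Ju : J (um b s) = 1.
  rewrite J_conv1 ?J_normal//; [exact: gdom_normal|by move=> x;
    exact: normal_pdf_ge0|exact: lgrow_scale_Phi|exact: nu.1].
rewrite -ler_pdivrMr// le_min !ler_pdivrMr//; apply/andP; split.
  by apply: ent_le_Cup => //; exact: noisy_peak_um.
have := ent_um_var b0 s0; rewrite gent_sqrt//; last by rewrite divr_ge0// sqr_ge0.
rewrite log2K_half.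
have -> : b ^+ 2 / 12 / s ^+ 2 = b ^+ 2 / (12 * s ^+ 2) by field; rewrite gt_eqF.
lra.
Qed.

(** Data processing for the PAM index under a dither on [0, d]: the output becomes [um (K d)],
    bounded below by the strict entropy power inequality, and each conditional output a translate of
    [um d], bounded above by Efun. *)
Lemma F2_lt K d s : (1 < K)%N -> 0 < d -> 0 < s ->
  F2 ((K%:R - 1) * d) K s * ln 2 < ent (pam K d s) - gent s.
Proof.
move=> K1 d0 s0; have K0 := ltnW K1.
have Kp : 0 < K%:R :> R by rewrite ltr0n.
have K1p : 0 < K%:R - 1 :> R by rewrite subr_gt0 ltr1n.
have Kd0 : 0 < K%:R * d by rewrite mulr_gt0.
rewrite /F2.
have -> : K%:R * ((K%:R - 1) * d) / (K%:R - 1) = K%:R * d by field; rewrite gt_eqF.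
have -> : (K%:R - 1) * d / (K%:R - 1) = d by field; rewrite gt_eqF.
have h1 := ent_um_le_Efun d0 s0.
have h2 := epi_normal_lt Kd0 s0.
have h3 : Clow (K%:R * d) s * ln 2 = ln ((K%:R * d) ^+ 2 + expR (2 * gent s)) / 2 - gent s.
  rewrite /Clow log2K_half -expR_2gent//.
  have g0 := expR_gt0 (2 * gent s).
  have -> : 1 + (K%:R * d) ^+ 2 / expR (2 * gent s) =
    ((K%:R * d) ^+ 2 + expR (2 * gent s)) / expR (2 * gent s) by field; rewrite gt_eqF.
  by rewrite ln_div ?posrE ?addr_gt0 ?exprn_gt0// expRK; field.
have np := nice_pam d K0 s0.
have h4 := @data_processing R K (fun i => normal_pdf (d * i%:R) s) (pam K d s)
  (fun x => d * Phi x) K0 (lgrow_scale_Phi d0) (fun i => nice_normal _ s0) np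
  (fun i => J_normal _ _) (fun i => nice_conv_Phi d0 (nice_normal _ s0))
  (nice_conv_Phi d0 np) (fun y => erefl).
rewrite conv_pam_um// in h4.
have e1 : \sum_(i < K) ent (conv (normal_pdf (d * i%:R) s) (fun x => d * Phi x)) = K%:R * ent (um d s).
  transitivity (\sum_(i < K) ent (um d s)); last by rewrite big_const_ord iter_addr_0 mulr_natl.
  apply: eq_bigr => i _.
  transitivity (ent (fun y => um d s (y - d * i%:R))); last first.
    exact: ent_shift (nice_conv_Phi d0 (nice_normal 0 s0)).
  have -> : normal_pdf (d * i%:R) s = fun y => normal_pdf 0 s (y - d * i%:R).
    by apply/funext => y; rewrite -[in RHS]normal_pdf_shift// add0r.
  have -> : (fun y => um d s (y - d * i%:R)) =
      conv (fun y => normal_pdf 0 s (y - d * i%:R)) (fun x => d * Phi x).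
    by apply/funext => y; rewrite conv_shift.
  by [].
have e2 : \sum_(i < K) ent (normal_pdf (d * i%:R) s) = K%:R * gent s.
  transitivity (\sum_(i < K) gent s); last by rewrite big_const_ord iter_addr_0 mulr_natl.
  by apply: eq_bigr => i _; rewrite ent_normal.
rewrite e1 e2 in h4.
have Kn : K%:R != 0 :> R by rewrite gt_eqF.
have {}h4 : ent (um (K%:R * d) s) - ent (um d s) <= ent (pam K d s) - gent s.
  have aux (x y z w : R) : x - K%:R^-1 * (K%:R * y) <= z - K%:R^-1 * (K%:R * w) ->
    x - y <= z - w by rewrite (mulKf Kn) (mulKf Kn).
  exact: aux.
rewrite mulrBl h3; apply: lt_le_trans h4.
by rewrite -addrA -opprD; apply: ltr_leB h2 _; rewrite -lerBlDl.
Qed.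

Lemma F_lt K d s : (1 < K)%N -> 0 < d -> 0 < s ->
  Ffun ((K%:R - 1) * d) K s * ln 2 < ent (pam K d s) - gent s.
Proof.
move=> K1 d0 s0; rewrite -ltr_pdivlMr// !gt_max !ltr_pdivlMr//.
by rewrite F1_lt// F2_lt// F3_lt.
Qed.

(** For the last term of G, [epi_pam] is read backwards: the entropy power of the PAM output is at
    most that of [um (K d)] minus [d^2], and Efun bounds the latter. *)
Lemma G_ge K d s : (1 < K)%N -> 0 < d -> 0 < s ->
  ent (pam K d s) - gent s <= Gfun ((K%:R - 1) * d) K s * ln 2.
Proof.
move=> K1 d0 s0; have K0 := ltnW K1.
have Kp : 0 < K%:R :> R by rewrite ltr0n.
have K1p : 0 < K%:R - 1 :> R by rewrite subr_gt0 ltr1n.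
have Kd0 : 0 < K%:R * d by rewrite mulr_gt0.
have np := nice_pam d K0 s0.
have l20 := l2; rewrite -ler_pdivrMr// le_min; apply/andP; split; last (rewrite le_min;
  apply/andP; split);
  rewrite ler_pdivrMr//.
- by rewrite log2K; have := ent_pam_le_ln d K0 s0; lra.
- apply: ent_le_Cup => //; [by rewrite mulr_gt0|exact: J_pam|].
  by apply: noisy_peak_pam => //; exact: ltW.
rewrite log2K_half.
have -> : K%:R * ((K%:R - 1) * d) / (K%:R - 1) = K%:R * d by field; rewrite gt_eqF.
have -> : ((K%:R - 1) * d) ^+ 2 / (2 * pi * eul R * (K%:R - 1) ^+ 2 * s ^+ 2) =
    d ^+ 2 / expR (2 * gent s).
  have aux (P k : R) : P != 0 -> k != 0 -> (k * d) ^+ 2 / (P * k ^+ 2 * s ^+ 2) = d ^+ 2 / (P * s ^+ 2).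
    by move=> P0 k0; field; rewrite k0 P0 gt_eqF.
  by rewrite expR_2gent// aux// gt_eqF// mulr_gt0 ?expR_gt0// mulr_gt0 ?pi_gt0.
have h1 := ent_um_le_Efun Kd0 s0; have h2 := epi_pam K0 d0 s0.
set hp := ent (pam K d s) in h2 *; set hu := ent (um _ s) in h1 h2 *; set g := gent s in h1 *.
have h3 : d ^+ 2 + expR (2 * hp) <= expR (2 * hu).
  rewrite -[leLHS]lnK ?posrE ?addr_gt0 ?exprn_gt0 ?expR_gt0// ler_expR; lra.
have h4 : expR (2 * (hu - g)) <= 2 `^ (2 * Efun (K%:R * d) s).
  rewrite /powR pnatr_eq0/= ler_expR -mulrA; lra.
have h5 : expR (2 * (hp - g)) <= 2 `^ (2 * Efun (K%:R * d) s) - d ^+ 2 / expR (2 * g).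
  apply: (@le_trans _ _ (expR (2 * (hu - g)) - d ^+ 2 / expR (2 * g))); last by rewrite lerD2r.
  have eE v : expR (2 * (v - g)) * expR (2 * g) = expR (2 * v).
    by rewrite -expRD; congr expR; ring.
  have g0 : expR (2 * g) != 0 by rewrite gt_eqF ?expR_gt0.
  by rewrite -(ler_pM2r (expR_gt0 (2 * g))) mulrBl !eE (divfK g0) lerBrDl.
have : 2 * (hp - g) <= ln (2 `^ (2 * Efun (K%:R * d) s) - d ^+ 2 / expR (2 * g)).
  rewrite -[leLHS]expRK ler_ln ?posrE ?expR_gt0//; exact: lt_le_trans (expR_gt0 _) h5.
lra.
Qed.

End RateBounds.

(** * Upper bounds for probabilities under block noise *)

Section ProductNoise.
Variable R : realType.
Local Notation mu := (@lebesgue_measure R).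
Import HBNNSimple.

Lemma sintegral_normal_prob s (h : {nnsfun measurableTypeR R >-> R}) :
  (sintegral (normal_prob 0 s) h = \int[mu]_x (h x * normal_pdf 0 s x)%:E)%E.
Proof.
rewrite sintegralE.
have p0 (r x : R) : (0 <= (r * \1_(h @^-1` [set r]) x)%:E * (normal_pdf 0 s x)%:E)%E.
  by apply: mule_ge0; [rewrite EFinM nnfun_muleindic_ge0|rewrite lee_fin normal_pdf_ge0].
under [RHS]eq_integral.
  move=> x _; rewrite EFinM fimfunE -fsumEFin// ge0_mule_fsuml; last first.
    by move=> r; rewrite EFinM nnfun_muleindic_ge0.
  over.
have mI (r : R) : measurable_fun setT (fun x => (r * \1_(h @^-1` [set r]) x)%:E * (normal_pdf 0 s x)%:E)%E.
  apply: emeasurable_funM; apply/measurable_EFinP; last exact: measurable_normal_pdf.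
  exact: measurableT_comp.
rewrite [RHS]ge0_integral_fsum//.
apply: eq_fsbigr => r /[!inE] -[x0 _ rE].
rewrite /normal_prob -ge0_integralZl//.
- rewrite [LHS]integral_mkcond; apply: eq_integral => x _; rewrite patchE indicE.
  by case: ifPn => _; rewrite ?mulr1 ?mulr0 ?mul0e.
- by apply: measurable_funTS; apply/measurable_EFinP; exact: measurable_normal_pdf.
- by move=> x _; rewrite lee_fin normal_pdf_ge0.
- by rewrite lee_fin -rE.
Qed.

(** Made for a g of unknown measurability: its integral is the supremum over simple functions below
    it, and each of these lies below f. *)
Lemma normal_integral_le s (g : R -> \bar R) (f : R -> R) :
  (forall z, 0 <= g z <= (f z)%:E)%E -> gdom (fun z => normal_pdf 0 s z * f z) ->
  (\int[normal_prob 0 s]_z g z <= (J (fun z => normal_pdf 0 s z * f z))%:E)%E.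
Proof.
move=> gf gd; have g0 z : (0 <= g z)%E by have /andP[] := gf z.
rewrite ge0_integralTE//; apply/ge_ereal_sup => /= _ [h /= hg <-].
rewrite sintegral_normal_prob EFin_J//; apply: ge0_le_integral => //.
- by move=> x _; rewrite lee_fin mulr_ge0// normal_pdf_ge0.
- apply/measurable_EFinP; apply: measurable_funM => //; exact: measurable_normal_pdf.
- by apply/measurable_EFinP; exact: gd.1.
- move=> x _; rewrite lee_fin mulrC ler_wpM2l ?normal_pdf_ge0//.
  by rewrite -lee_fin; apply: le_trans (hg x) _; have /andP[] := gf x.
Qed.

Lemma gauss_iint_ge0 s n (g : (nat -> R) -> \bar R) :
  (forall v, 0 <= g v)%E -> (0 <= gauss_iint s n g)%E.
Proof.
elim: n g => [|n IH] g g0 /=; first exact: g0.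
by apply: integral_ge0 => z _; apply: IH => v; exact: g0.
Qed.

(** The induction freezes the first coordinate at z and moves its factor into the coefficients c, so
    a sum of products is reproduced at every level. *)
Lemma gauss_iint_le s n (T : finType) (F : T -> 'I_n -> R -> R) (c : T -> R)
    (g : (nat -> R) -> \bar R) :
  (forall a, 0 <= c a) -> (forall a t z, 0 <= F a t z) ->
  (forall a t, gdom (fun z => normal_pdf 0 s z * F a t z)) ->
  (forall v, 0 <= g v <= (\sum_a c a * \prod_t F a t (v t))%:E)%E ->
  (gauss_iint s n g <=
   (\sum_a c a * \prod_t J (fun z => normal_pdf 0 s z * F a t z))%:E)%E.
Proof.
elim: n F c g => [|n IH] F c g c0 F0 gF hg /=.
  have /andP[_ h] := hg (fun=> 0); apply: (le_trans h); rewrite lee_fin.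
  by apply: ler_sum => a _; rewrite !big_ord0.
pose P a := \prod_(t < n) J (fun z => normal_pdf 0 s z * F a (lift ord0 t) z).
have FE : (fun z => normal_pdf 0 s z * (\sum_a c a * F a ord0 z * P a)) =
    fun z => \sum_a (c a * P a) * (normal_pdf 0 s z * F a ord0 z).
  by apply/funext => z; rewrite mulr_sumr; apply: eq_bigr => a _; ring.
have gd : gdom (fun z => normal_pdf 0 s z * (\sum_a c a * F a ord0 z * P a)).
  by rewrite FE; apply: gdom_sum => a _; apply: gdomZ.
apply: (@le_trans _ _ (J (fun z => normal_pdf 0 s z * (\sum_a c a * F a ord0 z * P a)))%:E).
  apply: normal_integral_le gd => z; apply/andP; split.
    by apply: gauss_iint_ge0 => v; have /andP[] := hg (vcons z v).
  apply: (IH (fun a t => F a (lift ord0 t)) (fun a => c a * F a ord0 z)) => //.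
    by move=> a; rewrite mulr_ge0.
  move=> v; have := hg (vcons z v); rewrite (eq_bigr (fun a =>
    c a * F a ord0 z * \prod_(t < n) F a (lift ord0 t) (v t)))// => a _.
  by rewrite big_ord_recl mulrA.
rewrite lee_fin FE J_sum => [|a _]; last exact: gdomZ.
by apply: ler_sum => a _; rewrite JZ// big_ord_recl /P [leRHS]mulrCA [leLHS]mulrC mulrA.
Qed.

Lemma noise_prob_le s n (T : finType) (F : T -> 'I_n -> R -> R) (c : T -> R)
    (x : 'I_n -> R) (S : set 'rV[R]_n) : 0 < s -> (forall a, 0 <= c a) -> (forall a t y, 0 <= F a t y) ->
  (forall a t, gdom (fun y => normal_pdf (x t) s y * F a t y)) ->
  (forall y, S y -> 1 <= \sum_a c a * \prod_t F a t (y ord0 t)) ->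
  (noise_prob s [set z | S (\row_t x t + z)%R] <=
   (\sum_a c a * \prod_t J (fun y => normal_pdf (x t) s y * F a t y))%:E)%E.
Proof.
move=> s0 c0 F0 gF SF; pose G a t z := F a t (z + x t).
have GE a t : (fun z => normal_pdf 0 s z * G a t z) =
    fun z => (fun y => normal_pdf (x t) s y * F a t y) (1 * z + x t).
  apply/funext => z; rewrite /G mul1r; congr (_ * _).
  by rewrite -[x t in RHS]add0r normal_pdf_shift// add0r addrK.
have gG a t : gdom (fun z => normal_pdf 0 s z * G a t z).
  by rewrite GE; exact: gdom_affine (oner_neq0 _) (gF a t).
apply: (@le_trans _ _ (\sum_a c a * \prod_t J (fun z => normal_pdf 0 s z * G a t z))%:E).
  apply: gauss_iint_le => //; first by move=> a t z; exact: F0.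
  move=> v; rewrite !lee_fin indicE ler0n/=; case: (boolP (_ \in _)) => [/set_mem/= /SF h|_];
    last first.
    by apply: sumr_ge0 => a _; rewrite mulr_ge0//; apply: prodr_ge0 => t _; exact: F0.
  apply: (le_trans h); rewrite le_eqVlt; apply/orP; left; apply/eqP.
  by apply: eq_bigr => a _; congr (_ * _); apply: eq_bigr => t _; rewrite /G !mxE addrC.
rewrite lee_fin le_eqVlt; apply/orP; left; apply/eqP; apply: eq_bigr => a _; congr (_ * _).
by apply: eq_bigr => t _; rewrite GE [RHS](J_affine (x t) ltr01 (gF a t)) mul1r.
Qed.

End ProductNoise.

(** * Uniform averages over finite sets and random functions *)

Section Averages.
Variable R : realFieldType.

Definition mean (T : finType) (f : T -> R) : R := #|T|%:R^-1 * \sum_x f x.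

Lemma eq_mean (T : finType) (f g : T -> R) : f =1 g -> mean f = mean g.
Proof. by move=> fg; rewrite /mean (eq_bigr g). Qed.

Lemma mean_cst (T : finType) (k : R) : (0 < #|T|)%N -> mean (fun _ : T => k) = k.
Proof.
move=> T0; rewrite /mean sumr_const -[k *+ _]mulr_natl mulKf//.
by rewrite pnatr_eq0 -lt0n.
Qed.

Lemma le_mean (T : finType) (f g : T -> R) : (forall x, f x <= g x) -> mean f <= mean g.
Proof. by move=> fg; rewrite /mean ler_wpM2l ?invr_ge0// ler_sum. Qed.

Lemma meanD (T : finType) (f g : T -> R) : mean (fun x => f x + g x) = mean f + mean g.
Proof. by rewrite /mean big_split mulrDr. Qed.

Lemma meanZ (T : finType) k (f : T -> R) : mean (fun x => k * f x) = k * mean f.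
Proof. by rewrite /mean -mulr_sumr mulrCA. Qed.

Lemma mean_sum (T I : finType) (P : pred I) (F : I -> T -> R) :
  mean (fun x => \sum_(i | P i) F i x) = \sum_(i | P i) mean (F i).
Proof. by rewrite /mean exchange_big -mulr_sumr. Qed.

Lemma mean_swap (T U : finType) (F : T -> U -> R) :
  mean (fun x => mean (F x)) = mean (fun y => mean (fun x => F x y)).
Proof. by rewrite /mean -!mulr_sumr mulrCA exchange_big. Qed.

Lemma mean_le_ex (T : finType) (f : T -> R) B : (0 < #|T|)%N -> mean f <= B ->
  exists x, f x <= B.
Proof.
move=> T0 fB; apply: contrapT => /forallNP h; have /card_gt0P[x0 _] := T0.
have : mean (fun _ : T => B) < mean f.
  rewrite /mean ltr_pM2l ?invr_gt0 ?ltr0n//; apply: ltr_sum.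
    by apply/hasP; exists x0; rewrite ?mem_index_enum.
  by move=> x _; rewrite ltNge; apply/negP; exact: h.
by rewrite mean_cst// ltNge fB.
Qed.

Lemma mean_prod (I X : finType) (f : I -> X -> R) :
  mean (fun w : {ffun I -> X} => \prod_t f t (w t)) = \prod_t mean (f t).
Proof.
rewrite /mean card_ffun big_split/= prodr_const natrX exprVn; congr (_ * _).
by rewrite bigA_distr_bigA.
Qed.

Lemma mean_eq1 (T : finType) (x : T) (f : T -> R) :
  mean (fun y => (y == x)%:R * f y) = #|T|%:R^-1 * f x.
Proof.
rewrite /mean (bigD1 x)//= eqxx mul1r big1 ?addr0// => y /negbTE ->.
by rewrite mul0r.
Qed.

Lemma mean_eval (I W : finType) (m : I) (F : W -> R) : (0 < #|W|)%N ->
  mean (fun c : {ffun I -> W} => F (c m)) = mean F.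
Proof.
move=> W0; rewrite (eq_mean (g := fun c : {ffun I -> W} =>
    \prod_i (if i == m then F (c i) else 1))); last first.
  by move=> c; rewrite (bigD1 m)//= eqxx big1 ?mulr1// => i /negbTE ->.
rewrite (mean_prod (fun i w => if i == m then F w else 1)) (bigD1 m)//= eqxx.
by rewrite big1 ?mulr1// => i /negbTE ->; rewrite mean_cst.
Qed.

(** Two values of a uniformly random function are independent: an indicator fixes [c m = w], and
    [mean_prod] factorises the rest. *)
Lemma mean_eval2 (I W : finType) (m m' : I) (F : W -> W -> R) : (0 < #|W|)%N -> m != m' ->
  mean (fun c : {ffun I -> W} => F (c m) (c m')) = mean (fun w => mean (F w)).
Proof.
move=> W0 mm; have mm' : (m' == m) = false by rewrite eq_sym (negbTE mm).
rewrite (eq_mean (g := fun c : {ffun I -> W} => \sum_w F w (c m') * (c m == w)%:R)); last first.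
  move=> c; rewrite (bigD1 (c m))//= eqxx mulr1 big1 ?addr0// => w.
  by rewrite eq_sym => /negbTE ->; rewrite mulr0.
rewrite mean_sum [RHS]/mean mulr_sumr; apply: eq_bigr => w _.
rewrite (eq_mean (g := fun c : {ffun I -> W} => \prod_i
    (if i == m then (c i == w)%:R else if i == m' then F w (c i) else 1))); last first.
  move=> c; rewrite (bigD1 m)//= eqxx (bigD1 m')/= ?mm'// eqxx.
  by rewrite big1 ?mulr1 1?mulrC// => i /andP[/negbTE -> /negbTE ->].
rewrite (mean_prod (fun i v => if i == m then (v == w)%:R else if i == m' then F w v else 1)).
rewrite (bigD1 m)//= eqxx (bigD1 m')/= ?mm'// eqxx.
rewrite big1 ?mulr1; last by move=> i /andP[/negbTE -> /negbTE ->]; rewrite mean_cst.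
by have := mean_eq1 w (fun=> 1); rewrite mulr1 => <-; congr (_ * _); apply: eq_mean => v;
  rewrite mulr1.
Qed.

End Averages.

(** * Exponential moments of likelihood-ratio tests *)

Section ThresholdTest.
Variable R : realType.
Implicit Types (f g p q u : R -> R) (L s x y : R).

Lemma gdom_le f g : measurable_fun setT f -> (forall y, 0 <= f y <= g y) -> gdom g -> gdom f.
Proof.
move=> mf fg gg; split=> //; have [C C0 [c c0 hC]] := gdom_bound gg.
exists C, c => // y; apply: le_trans (hC y); have /andP[f0 fg0] := fg y.
by rewrite !ger0_norm// (le_trans f0).
Qed.

(** A second-order expansion whose remainder is integrable as soon as [exp u] and [exp (- u)] are.
    For s <= 1/2 the remainder is at most [(s u)^2 exp (|u| / 2)], and the other half of the
    exponent absorbs [u^2 <= 16 exp (|u| / 2)]. *)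
Lemma expR_quad_le s (u : R) : 0 <= s <= 2^-1 ->
  expR (s * u) <= 1 + s * u + 16 * s ^+ 2 * (expR u + expR (- u)).
Proof.
move=> /andP[s0 s1]; set v := s * u.
have sq (t : R) : t ^+ 2 <= 4 * expR `|t|.
  have h : 1 + `|t| / 2 <= expR (`|t| / 2) by exact: expR_ge1Dx.
  have h2 : (1 + `|t| / 2) ^+ 2 <= expR `|t|.
    have -> : expR `|t| = expR (`|t| / 2) ^+ 2 by rewrite -expRM_natl; congr expR; field.
    by rewrite lerXn2r ?nnegrE ?expR_ge0// addr_ge0// divr_ge0.
  rewrite -real_normK ?num_real//; have := normr_ge0 t; nra.
have e1 (t : R) : expR t - 1 <= t * expR t.
  have h : 1 - t <= expR (- t) by exact: expR_ge1Dx.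
  have := ler_wpM2r (expR_ge0 t) h; rewrite -expRD addNr expR0; lra.
have e2 (t : R) : expR t <= 1 + t + t ^+ 2 * expR `|t|.
  have [t0|t0] := leP 0 t.
    rewrite ger0_norm//; have h := e1 t.
    have := ler_wpM2l t0 h; lra.
  have h : 1 + t <= expR t by exact: expR_ge1Dx.
  have h2 : t * (expR t - 1) <= t ^+ 2.
    by rewrite expr2; apply: ler_wnM2l; [exact: ltW|lra].
  have h3 : t ^+ 2 <= t ^+ 2 * expR `|t|.
    by rewrite ler_peMr ?sqr_ge0// -expR0 ler_expR.
  by have := e1 t; lra.
apply: (le_trans (e2 v)); rewrite lerD2l.
have h1 : expR `|v| <= expR (`|u| / 2).
  by rewrite ler_expR /v normrM ger0_norm// mulrC ler_wpM2l.
have h2 : u ^+ 2 <= 16 * expR (`|u| / 2).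
  have := sq (u / 2); rewrite normrM (ger0_norm (_ : 0 <= 2^-1))// expr_div_n; lra.
have h3 : expR (`|u| / 2) * expR (`|u| / 2) <= expR u + expR (- u).
  rewrite -expRD -splitr; have [u0|u0] := leP 0 u.
    by rewrite ger0_norm// lerDl expR_ge0.
  by rewrite ltr0_norm// lerDr expR_ge0.
rewrite {1}/v exprMn -[leLHS]mulrA [16 * _]mulrC -[leRHS]mulrA; apply: ler_wpM2l;
  first exact: sqr_ge0.
apply: (@le_trans _ _ (16 * expR (`|u| / 2) * expR (`|u| / 2))).
  by apply: ler_pM; rewrite ?sqr_ge0 ?expR_ge0.
by rewrite -mulrA ler_wpM2l.
Qed.

Lemma J_chernoff f u s : (forall y, 0 <= f y) -> gdom f -> measurable_fun setT u ->
  gdom (fun y => f y * u y) -> gdom (fun y => f y * expR (u y)) ->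
  gdom (fun y => f y * expR (- u y)) -> 0 <= s <= 2^-1 ->
  gdom (fun y => f y * expR (s * u y)) /\
  J (fun y => f y * expR (s * u y)) <= J f + s * J (fun y => f y * u y) +
    16 * s ^+ 2 * (J (fun y => f y * expR (u y)) + J (fun y => f y * expR (- u y))).
Proof.
move=> f0 gf mu gfu gp gm s12; have gs := gdomD gp gm.
have gE : gdom (fun y => f y * expR (s * u y)).
  apply: gdom_le gs => [|y].
    apply: measurable_funM; first exact: gf.1.
    by apply: measurableT_comp => //; apply: measurable_funM.
  rewrite mulr_ge0 ?expR_ge0//= -mulrDr ler_wpM2l//.
  move: s12 => /andP[s0 s1]; have [u0|u0] := leP 0 (u y).
    rewrite (@le_trans _ _ (expR (u y))) ?lerDl ?expR_ge0// ler_expR ler_piMl//; lra.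
  rewrite (@le_trans _ _ (expR (- u y))) ?lerDr ?expR_ge0// ler_expR.
  have : s * u y <= 0 by rewrite mulr_ge0_le0// ltW.
  lra.
split=> //; rewrite -JD// -!JZ// -JD//; last exact: gdomZ.
rewrite -JD; [|by apply: gdomD => //; exact: gdomZ|exact: gdomZ].
apply: leJ => //; first by apply: gdomD; [apply: gdomD => //|]; exact: gdomZ.
move=> y; have := ler_wpM2l (f0 y) (expR_quad_le (u y) s12); lra.
Qed.

(* A codeword passes a test when the sum of its llr's is at most 0, so that
   exp (s * sum) and exp (- sum) dominate the indicators of failing and of passing. *)
Definition llr L p q y : R := L + ln (q y) - ln (p y).

Section Family.
Variables (m : nat) (p : 'I_m -> R -> R) (q : R -> R).
Hypotheses (m0 : (0 < m)%N) (np : forall j, nice (p j)) (nq : nice q).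
Hypotheses (Jp : forall j, J (p j) = 1) (qE : forall y, q y = mean (fun j => p j y)).

Let p_gt0 j y : 0 < p j y. Proof. exact: nice_gt0. Qed.
Let q_gt0 y : 0 < q y. Proof. exact: nice_gt0. Qed.
Let mR : 0 < m%:R :> R. Proof. by rewrite ltr0n. Qed.

Lemma expR_llrN L j y : expR (- llr L (p j) q y) = expR (- L) * (p j y / q y).
Proof.
rewrite /llr opprB addrC expRD -(lnK (p_gt0 j y)) -{2}(lnK (q_gt0 y)) !expRK.
rewrite opprD expRD -expRN; ring.
Qed.

Lemma expR_llr L j y : expR (llr L (p j) q y) = expR L * (q y / p j y).
Proof. by rewrite -[llr _ _ _ _]opprK expRN expR_llrN !invfM invrK expRN invrK; ring. Qed.

(** A symbol drawn independently of y passes with this exponential moment whatever y is, because the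
    ratios [p j y / q y] average to 1. *)
Lemma mean_llrN L y : mean (fun j => expR (- llr L (p j) q y)) = expR (- L).
Proof.
rewrite (eq_mean (g := fun j => expR (- L) / q y * p j y)); last first.
  by move=> j; rewrite expR_llrN mulrCA mulrC.
by rewrite meanZ -qE divfK// gt_eqF.
Qed.

Lemma family_le j y : p j y <= m%:R * q y.
Proof.
rewrite qE /mean card_ord mulVKf ?gt_eqF// (bigD1 j)//= lerDl.
by apply: sumr_ge0 => i _; exact: ltW.
Qed.

Lemma expR_llrN_le L j y : expR (- llr L (p j) q y) <= expR (- L) * m%:R.
Proof. by rewrite expR_llrN ler_wpM2l ?expR_ge0// ler_pdivrMr// family_le. Qed.

Lemma qbd_llr L j : qbd (llr L (p j) q).
Proof. by apply: qbdB; [apply: qbdD; [exact: qbd_cst|]|]; exact: qbd_ln. Qed.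

Lemma gdom_expR_llrN L f j : gdom f -> gdom (fun y => f y * expR (- llr L (p j) q y)).
Proof.
move=> gf; apply: gdomM => //; apply: qbd_bounded (expR (- L) * m%:R) _ _.
  by apply: measurableT_comp => //; apply: measurableT_comp => //; exact: (qbd_llr L j).1.
by move=> y; rewrite ger0_norm ?expR_ge0// expR_llrN_le.
Qed.

(** The averaged mean of the log-ratio is L minus the mutual information, a negative number - d; for
    small s the exponential moment is 1 - s d up to a term of order [s^2]. *)
Lemma ex_chernoff L : L < ent q - mean (fun j => ent (p j)) ->
  exists s, [/\ 0 <= s, forall j, gdom (fun y => p j y * expR (s * llr L (p j) q y)) &
    mean (fun j => J (fun y => p j y * expR (s * llr L (p j) q y))) < 1].
Proof.
move=> hL.
have g0 j : gdom (p j) by exact: (np j).1.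
have gu j : gdom (fun y => p j y * llr L (p j) q y) by apply: gdomM => //; exact: qbd_llr.
have gp j : gdom (fun y => p j y * expR (llr L (p j) q y)).
  rewrite (_ : (fun y => _) = fun y => expR L * q y); first by apply: gdomZ; exact: nq.1.
  by apply/funext => y; rewrite expR_llr; field; rewrite gt_eqF.
have gm j : gdom (fun y => p j y * expR (- llr L (p j) q y)) by exact: gdom_expR_llrN.
pose D := mean (fun j => J (fun y => p j y * expR (llr L (p j) q y)) +
                         J (fun y => p j y * expR (- llr L (p j) q y))).
have D0 : 0 <= D.
  rewrite /D /mean mulr_ge0 ?invr_ge0//; apply: sumr_ge0 => j _.
  by apply: addr_ge0; apply: J_ge0 => // y; rewrite mulr_ge0 ?expR_ge0 ?ltW.
pose d := ent q - mean (fun j => ent (p j)) - L.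
have d0 : 0 < d by rewrite subr_gt0.
have mu : mean (fun j => J (fun y => p j y * llr L (p j) q y)) = - d.
  have gl j : gdom (fun y => p j y * ln (q y)) by apply: gdomM => //; exact: qbd_ln.
  have ge j : gdom (fun y => p j y * ln (p j y)) by apply: gdomM => //; exact: qbd_ln.
  transitivity (mean (fun j => L + (J (fun y => p j y * ln (q y)) + ent (p j)))).
    apply: eq_mean => j; rewrite -[X in X + _]mulr1 -[X in _ * X + _](Jp j) -JZ// /ent.
    rewrite -JB// -JD//; [|exact: gdomZ|exact: gdomB].
    by apply: eqJ => y; rewrite /llr; ring.
  rewrite !meanD mean_cst ?card_ord//.
  have -> : mean (fun j => J (fun y => p j y * ln (q y))) = - ent q.
    rewrite /ent opprK /mean -J_sum// -JZ; last exact: gdom_sum.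
    by apply: eqJ => y; rewrite -mulr_suml mulrA qE.
  by rewrite /d; ring.
(* The second bound makes the remainder [16 s^2 D] at most [s d / 2]. *)
pose s := Num.min 2^-1 (d / (32 * (D + 1))).
have D1 : 0 < D + 1 by rewrite ltr_wpDl.
have s0 : 0 < s by rewrite lt_min invr_gt0 ltr0n/= divr_gt0// mulr_gt0.
have s12 : 0 <= s <= 2^-1 by rewrite ltW//= ge_min lexx.
have sd : s * (32 * (D + 1)) <= d by rewrite -ler_pdivlMr ?mulr_gt0// ge_min lexx orbT.
have hC j := @J_chernoff (p j) (llr L (p j) q) s (fun y => ltW (p_gt0 j y)) (g0 j)
  (qbd_llr L j).1 (gu j) (gp j) (gm j) s12.
exists s; split; [exact: ltW|by move=> j; have [] := hC j|].
apply: (@le_lt_trans _ _ (1 + s * - d + 16 * s ^+ 2 * D)).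
  rewrite -mu /D -!meanZ -[X in X + _ + _](@mean_cst _ 'I_m 1) ?card_ord// -!meanD.
  by apply: le_mean => j; have [_] := hC j; rewrite Jp.
have h1 : s * (s * (32 * (D + 1))) <= s * d by rewrite ler_pM2l.
have h2 : 0 < s * s by rewrite mulr_gt0.
have h3 : 0 <= s * s * D by rewrite mulr_ge0// ltW.
rewrite expr2; nra.
Qed.

End Family.
End ThresholdTest.

(** * Measurability of threshold decoders *)

Section Decoders.
Variables (R : realType) (n : nat).
Local Notation T := (g_sigma_algebraType (@boxes R n)).

Lemma measurable_coord (t : 'I_n) : measurable_fun setT (fun y : T => (y : 'rV[R]_n) ord0 t).
Proof.
move=> _ B mB; rewrite setTI; apply: sub_gen_smallest => /=.
exists (fun i => if i == t then B else setT) => [i|]; first by case: ifP.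
apply/seteqP; split => y /= h; first by have := h t; rewrite eqxx.
by move=> i; case: eqP => [->|].
Qed.

Lemma borel_sum_le0 (u : 'I_n -> R -> R) : (forall t, measurable_fun setT (u t)) ->
  borel_rV [set y : 'rV[R]_n | \sum_t u t (y ord0 t) <= 0].
Proof.
move=> mu; have mf : measurable_fun setT (fun y : T => \sum_t u t ((y : 'rV[R]_n) ord0 t)).
  by apply: measurable_sum => t; apply: (measurableT_comp (mu t)); exact: measurable_coord.
have := mf measurableT `]-oo, 0]%classic (measurable_itv _).
by rewrite setTI; congr borel_rV; apply/seteqP; split => y /=; rewrite in_itv.
Qed.

Lemma borel_exists k (P Q : 'I_k -> 'rV[R]_n -> bool) :
  (forall i, borel_rV [set y | P i y]) -> (forall i, borel_rV [set y | Q i y]) ->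
  borel_rV [set y | [exists i, P i y && Q i y]].
Proof.
move=> bP bQ; have h : measurable (\bigcup_(i in [set: 'I_k]) ([set y | P i y] `&` [set y | Q i y]) : set T).
  by apply: fin_bigcup_measurable => // i _; apply: measurableI; [exact: bP|exact: bQ].
move: h; congr borel_rV; apply/seteqP; split=> y /=.
  by move=> [i _ [Pi Qi]]; apply/existsP; exists i; rewrite Pi Qi.
by move=> /existsP[i /andP[]]; exists i.
Qed.

Definition decode k (P : 'I_k.+1 -> 'rV[R]_n -> bool) (y : 'rV[R]_n) : 'I_k.+1 :=
  odflt ord0 [pick m | P m y].

(** The output depends on y only through the set of messages that pass, so each preimage is a finite
    union of the sets [E A]. *)
Lemma measurable_decode k (P : 'I_k.+1 -> 'rV[R]_n -> bool) :
  (forall m, borel_rV [set y | P m y]) -> measurable_decoder (decode P).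
Proof.
move=> bP m.
pose E (A : {set 'I_k.+1}) : set T := [set y | forall i, P i y = (i \in A)].
have mE A : measurable (E A).
  have -> : E A = \bigcap_(i in [set: 'I_k.+1])
      (if i \in A then [set y | P i y] else ~` [set y | P i y]).
    apply/seteqP; split => y /= h.
      by move=> i _; have := h i; case: ifP => _ /=; [|move=> /negbT/negP].
    by move=> i; have := h i Logic.I; case: ifP => //= _ /negP/negbTE.
  apply: fin_bigcap_measurable => // i _; case: ifP => _; first exact: bP.
  by apply: measurableC; exact: bP.
have h : measurable (\bigcup_(A in [set A : {set 'I_k.+1} | odflt ord0 [pick i in A] = m]) E A).
  by apply: fin_bigcup_measurable => //; exact: finite_finset.
move: h; congr borel_rV; apply/seteqP; split => y /=.
  by move=> [A Am EA]; rewrite /decode -Am; congr odflt; exact: eq_pick.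
move=> dm; exists (finset (P^~ y)) => /=; last by move=> i; rewrite inE.
by rewrite -dm /decode; congr odflt; apply: eq_pick => i; rewrite inE.
Qed.

Lemma decode_neq k (P : 'I_k.+1 -> 'rV[R]_n -> bool) m y : decode P y != m ->
  ~~ P m y \/ exists2 m', m' != m & P m' y.
Proof.
rewrite /decode; case: pickP => [m' Pm' mm|Pn _] /=; first by right; exists m'.
by left; rewrite Pn.
Qed.

End Decoders.

(** * The union bound for one decoding stage *)

Section Stage.
Variables (R : realType) (n k : nat).
Implicit Types (v : 'I_k -> 'I_n -> R -> R) (m : 'I_k) (s : R) (y : 'I_n -> R).

(* [inl] stands for the true codeword m failing its test, [inr m'] for m' <> m passing *)
Definition stage_coef m (a : 'I_1 + 'I_k) : R :=
  match a with inl _ => 1 | inr m' => (m' != m)%:R end.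

Definition stage_fun s v m (a : 'I_1 + 'I_k) t (z : R) : R :=
  match a with inl _ => expR (s * v m t z) | inr m' => expR (- v m' t z) end.

Lemma stage_coef_ge0 m a : 0 <= stage_coef m a.
Proof. by case: a => // m' /=. Qed.

Lemma stage_fun_ge0 s v m a t z : 0 <= stage_fun s v m a t z.
Proof. by case: a => ? /=; exact: expR_ge0. Qed.

Lemma stage_sum_ge0 s v m y :
  0 <= \sum_a stage_coef m a * \prod_t stage_fun s v m a t (y t).
Proof.
apply: sumr_ge0 => a _; apply: mulr_ge0; first exact: stage_coef_ge0.
by apply: prodr_ge0 => t _; exact: stage_fun_ge0.
Qed.

(** Each failure event makes one exponential at least 1, and the other terms are nonnegative:
    Markov's inequality and the union bound in one sum. *)
Lemma stage_ge1 s v m y : 0 <= s ->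
  ~~ (\sum_t v m t (y t) <= 0) \/ (exists2 m', m' != m & \sum_t v m' t (y t) <= 0) ->
  1 <= \sum_a stage_coef m a * \prod_t stage_fun s v m a t (y t).
Proof.
move=> s0 h; have [a ha] : exists a, 1 <= stage_coef m a * \prod_t stage_fun s v m a t (y t).
  case: h => [|[m' mm h]].
    rewrite -ltNge => h; exists (inl ord0); rewrite /= mul1r -expR_sum -mulr_sumr.
    by rewrite -expR0 ler_expR mulr_ge0// ltW.
  exists (inr m'); rewrite /= mm mul1r -expR_sum sumrN.
  by rewrite -expR0 ler_expR oppr_ge0.
apply: (le_trans ha); rewrite (bigD1 a)//= lerDl; apply: sumr_ge0 => b _.
apply: mulr_ge0; first exact: stage_coef_ge0.
by apply: prodr_ge0 => t _; exact: stage_fun_ge0.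
Qed.

Lemma stage_sum m (G : 'I_1 + 'I_k -> R) :
  \sum_a stage_coef m a * G a = G (inl ord0) + \sum_(m' | m' != m) G (inr m').
Proof.
rewrite big_sumType big_ord1 mul1r; congr (_ + _); rewrite [RHS]big_mkcond.
by apply: eq_bigr => m' _ /=; case: ifP => _; rewrite ?mul1r ?mul0r.
Qed.

Lemma sum_neq_le m (b : R) : 0 <= b -> \sum_(m' | m' != m) b <= k%:R * b.
Proof.
move=> b0; rewrite -[leRHS](_ : \sum_(m' < k) b = _).
  by rewrite [leRHS](bigD1 m)//= lerDr.
by rewrite big_const_ord iter_addr_0 mulr_natl.
Qed.

End Stage.

Arguments stage_coef {R k}.

(** * Random superposition codes *)

Section RandomCode.
Variable R : realType.
Implicit Types (X : finType) (k n : nat).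

Lemma card_codeword_gt0 X n : (0 < #|X|)%N -> (0 < #|{ffun 'I_n -> X}|)%N.
Proof. by move=> X0; rewrite card_ffun expn_gt0 X0. Qed.

Lemma card_codebook_gt0 X k n : (0 < #|X|)%N -> (0 < #|{ffun 'I_k -> {ffun 'I_n -> X}}|)%N.
Proof. by move=> X0; rewrite card_ffun expn_gt0 card_codeword_gt0. Qed.

Lemma mean_correct (X1 X2 : finType) k1 k2 n (A : X1 -> X2 -> R) (m1 : 'I_k1) (m2 : 'I_k2) :
  (0 < #|X1|)%N -> (0 < #|X2|)%N ->
  mean (fun c1 : {ffun 'I_k1 -> {ffun 'I_n -> X1}} =>
    mean (fun c2 : {ffun 'I_k2 -> {ffun 'I_n -> X2}} => \prod_t A (c1 m1 t) (c2 m2 t))) =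
  mean (fun i => mean (A i)) ^+ n.
Proof.
move=> X10 X20.
have W1 := card_codeword_gt0 n X10; have W2 := card_codeword_gt0 n X20.
rewrite (mean_eval m1 (fun w : {ffun 'I_n -> X1} => mean (fun c2 : {ffun 'I_k2 -> {ffun 'I_n -> X2}} =>
  \prod_t A (w t) (c2 m2 t))) W1).
rewrite (eq_mean (g := fun w : {ffun 'I_n -> X1} => \prod_t mean (A (w t)))); last first.
  move=> w; rewrite (mean_eval m2 (fun w2 : {ffun 'I_n -> X2} => \prod_t A (w t) (w2 t)) W2).
  by rewrite (mean_prod (fun t => A (w t))).
by rewrite (mean_prod (fun _ i => mean (A i))) prodr_const card_ord.
Qed.

(** The wrong codeword is independent of the sent one, and its average is the same b for every sent
    symbol. *)
Lemma mean_wrong X k n (B : 'I_n -> X -> X -> R) b (m m' : 'I_k) :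
  (0 < #|X|)%N -> m' != m -> (forall t w, mean (B t w) = b) ->
  mean (fun c : {ffun 'I_k -> {ffun 'I_n -> X}} => \prod_t B t (c m t) (c m' t)) = b ^+ n.
Proof.
move=> X0 mm Bb; have W0 := card_codeword_gt0 n X0.
rewrite (mean_eval2 (fun w w' : {ffun 'I_n -> X} => \prod_t B t (w t) (w' t)) W0); last first.
  by rewrite eq_sym.
rewrite (eq_mean (g := fun=> b ^+ n)) ?mean_cst// => w.
by rewrite (mean_prod (fun t => B t (w t))) (eq_bigr (fun=> b)) ?prodr_const ?card_ord.
Qed.

Variables (s : R) (K1 K2 k1 k2 n : nat) (x : 'I_K1 -> 'I_K2 -> R).
Variables (u1 : 'I_K1 -> 'I_K2 -> R -> R) (u2 : 'I_K2 -> R -> R) (sg1 sg2 b1 b2 : R).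
Hypotheses (s0 : 0 < s) (K10 : (0 < K1)%N) (K20 : (0 < K2)%N).
Hypotheses (sg10 : 0 <= sg1) (sg20 : 0 <= sg2) (b10 : 0 <= b1) (b20 : 0 <= b2).
Local Notation N i j := (normal_pdf (x i j) s).
Hypothesis gN2 : forall i j, gdom (fun y => N i j y * expR (sg2 * u2 j y)).
Hypothesis gW2 : forall i j j', gdom (fun y => N i j y * expR (- u2 j' y)).
Hypothesis hW2 : forall i j, mean (fun j' => J (fun y => N i j y * expR (- u2 j' y))) = b2.
Hypothesis gN1 : forall i j, gdom (fun y => N i j y * expR (sg1 * u1 i j y)).
Hypothesis gW1 : forall i j i', gdom (fun y => N i j y * expR (- u1 i' j y)).
Hypothesis hW1 : forall i j, mean (fun i' => J (fun y => N i j y * expR (- u1 i' j y))) = b1.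
Let M1 := mean (fun i => mean (fun j => J (fun y => N i j y * expR (sg1 * u1 i j y)))).
Let M2 := mean (fun i => mean (fun j => J (fun y => N i j y * expR (sg2 * u2 j y)))).

Local Notation C1 := {ffun 'I_k1.+1 -> {ffun 'I_n -> 'I_K1}}.
Local Notation C2 := {ffun 'I_k2.+1 -> {ffun 'I_n -> 'I_K2}}.
Implicit Types (c : C1) (e : C2) (l : 'I_k1.+1) (m : 'I_k2.+1).

Definition superpose c e l m : 'rV[R]_n := \row_t x (c l t) (e m t).

Definition pass2 e m (y : 'rV[R]_n) : bool := \sum_t u2 (e m t) (y ord0 t) <= 0.
Definition pass1 c e l m (y : 'rV[R]_n) : bool := \sum_t u1 (c l t) (e m t) (y ord0 t) <= 0.

Definition dec2 e := decode (pass2 e).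
Definition dec1 c e :=
  decode (fun l y => [exists m, pass2 e m y && pass1 c e l m y]).

Let v2 e m t := u2 (e m t).
Let v1 c e m l t := u1 (c l t) (e m t).

Definition bound2 c e l m : R := \sum_a stage_coef m a *
  \prod_t J (fun y => N (c l t) (e m t) y * stage_fun sg2 (v2 e) m a t y).

Definition bound1 c e l m : R := \sum_a stage_coef l a *
  \prod_t J (fun y => N (c l t) (e m t) y * stage_fun sg1 (v1 c e m) l a t y).

Lemma noise_prob_dec2 c e l m :
  (noise_prob s [set z | dec2 e (superpose c e l m + z)%R != m] <=
   (bound2 c e l m)%:E)%E.
Proof.
apply: (@noise_prob_le _ s n _ (stage_fun sg2 (v2 e) m) (stage_coef m)
  (fun t => x (c l t) (e m t)) [set y | dec2 e y != m] s0).
- exact: stage_coef_ge0.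
- exact: stage_fun_ge0.
- by move=> [a|m'] t; [exact: gN2|exact: gW2].
- move=> y /= /decode_neq h; exact: (@stage_ge1 _ _ _ _ (v2 e) m (fun t => y ord0 t)).
Qed.

(** Either the second-message test errs at m, which [bound2] pays for, or m alone passes it and only
    pairs (l', m) with the true m remain. Hence pairs wrong in both messages have no term of their
    own. *)
Lemma noise_prob_dec1 c e l m :
  (noise_prob s [set z | dec1 c e (superpose c e l m + z)%R != l] <=
   (bound2 c e l m + bound1 c e l m)%:E)%E.
Proof.
pose F (a : ('I_1 + 'I_k2.+1) + ('I_1 + 'I_k1.+1)) := match a with
  | inl b => stage_fun sg2 (v2 e) m b | inr b => stage_fun sg1 (v1 c e m) l b end.
pose w (a : ('I_1 + 'I_k2.+1) + ('I_1 + 'I_k1.+1)) : R := match a with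
  | inl b => stage_coef m b | inr b => stage_coef l b end.
have bE : bound2 c e l m + bound1 c e l m = \sum_a w a *
    \prod_t J (fun y => N (c l t) (e m t) y * F a t y) by rewrite big_sumType.
rewrite bE.
apply: (@noise_prob_le _ s n _ F w (fun t => x (c l t) (e m t)) [set y | dec1 c e y != l] s0).
- by case=> a; exact: stage_coef_ge0.
- by case=> a; exact: stage_fun_ge0.
- by move=> [[a|m']|[a|m']] t; [exact: gN2|exact: gW2|exact: gN1|exact: gW1].
move=> y /= hy; rewrite big_sumType.
set S2 := (X in _ <= X + _); set S1 := (X in _ <= _ + X).
have S20 : 0 <= S2 by exact: (stage_sum_ge0 _ _ _ (fun t => y ord0 t)).
have S10 : 0 <= S1 by exact: (stage_sum_ge0 _ _ _ (fun t => y ord0 t)).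
have [h2|h2] := pselect (~~ pass2 e m y \/ exists2 m', m' != m & pass2 e m' y).
  have h := @stage_ge1 _ _ _ _ (v2 e) m (fun t => y ord0 t) sg20 h2.
  by apply: (le_trans (h : 1 <= S2)); rewrite lerDl.
move/not_orP: h2 => [/negP/negPn p2 h2].
have h := @stage_ge1 _ _ _ _ (v1 c e m) l (fun t => y ord0 t) sg10.
apply: (le_trans (h _ : 1 <= S1)); last by rewrite lerDr.
have [h1|[m' mm /existsP[m'' /andP[p2' p1]]]] := decode_neq hy.
  by left; apply: contra h1 => p1; apply/existsP; exists m; rewrite p2.
right; exists m' => //; have [<-//|mm'] := eqVneq m'' m.
by case: h2; exists m''.
Qed.

Lemma mean_bound2 l m :
  mean (fun c => mean (fun e => bound2 c e l m)) <= M2 ^+ n + k2.+1%:R * b2 ^+ n.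
Proof.
have X1 : (0 < #|'I_K1|)%N by rewrite card_ord.
have X2 : (0 < #|'I_K2|)%N by rewrite card_ord.
rewrite (eq_mean (g := fun c => mean (fun e : C2 => \prod_t J (fun y => N (c l t) (e m t) y *
      expR (sg2 * u2 (e m t) y))) + \sum_(m' | m' != m) b2 ^+ n)); last first.
  move=> c; rewrite (eq_mean (fun e => stage_sum _ _)) meanD; congr (_ + _).
  rewrite mean_sum; apply: eq_bigr => m' mm.
  apply: (mean_wrong (B := fun t j j' => J (fun y => N (c l t) j y * expR (- u2 j' y)))) => //.
rewrite meanD (mean_correct n (fun i j => J (fun y => N i j y * expR (sg2 * u2 j y))) l m)//.
rewrite lerD2l mean_cst ?card_codebook_gt0//.
by rewrite sum_neq_le// exprn_ge0.
Qed.

Lemma mean_bound1 l m :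
  mean (fun c => mean (fun e => bound1 c e l m)) <= M1 ^+ n + k1.+1%:R * b1 ^+ n.
Proof.
have X1 : (0 < #|'I_K1|)%N by rewrite card_ord.
have X2 : (0 < #|'I_K2|)%N by rewrite card_ord.
rewrite (eq_mean (g := fun c => mean (fun e : C2 => \prod_t J (fun y => N (c l t) (e m t) y *
      expR (sg1 * u1 (c l t) (e m t) y))) + mean (fun e : C2 => \sum_(m' | m' != l)
      \prod_t J (fun y => N (c l t) (e m t) y * expR (- u1 (c m' t) (e m t) y))))); last first.
  by move=> c; rewrite (eq_mean (fun e => stage_sum _ _)) meanD.
rewrite meanD (mean_correct n (fun i j => J (fun y => N i j y * expR (sg1 * u1 i j y))) l m)//.
(* With the codebook e held fixed first, the codewords of l and m' in c are independent. *)
rewrite lerD2l mean_swap (eq_mean (g := fun e : C2 => \sum_(m' | m' != l) b1 ^+ n)); last first.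
  move=> e; rewrite mean_sum; apply: eq_bigr => m' mm.
  by apply: (mean_wrong (B := fun t i i' => J (fun y => N i (e m t) y * expR (- u1 i' (e m t) y)))).
rewrite mean_cst ?card_codebook_gt0//.
by rewrite sum_neq_le// exprn_ge0.
Qed.

End RandomCode.

(** * The two tests for superposed PAM *)

Section PamTests.
Variables (R : realType) (s d L1 L2 : R) (K1 K2 : nat).
Hypotheses (s0 : 0 < s) (K10 : (0 < K1)%N) (K20 : (0 < K2)%N).
Implicit Types (i : 'I_K1) (j : 'I_K2).

Definition symbol i j : R := d * i%:R + K1%:R * d * j%:R.

Definition cloud j : R -> R := fun y => pam K1 d s (y - K1%:R * d * j%:R).

(** Subtracting the offset of cloud j reduces the test to the K1-point constellation, so one family
    of densities serves all j. *)
Definition test1 i j : R -> R :=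
  fun y => llr L1 (normal_pdf (d * i%:R) s) (pam K1 d s) (y - K1%:R * d * j%:R).

Definition test2 j : R -> R := llr L2 (cloud j) (pam (K1 * K2) d s).

Local Notation N i j := (normal_pdf (symbol i j) s).

Let KK : (0 < K1 * K2)%N. Proof. by rewrite muln_gt0 K10. Qed.

Lemma normal_symbol i j y : N i j y = normal_pdf (d * i%:R) s (y - K1%:R * d * j%:R).
Proof. exact: normal_pdf_shift. Qed.

Lemma pam_mean K y : pam K d s y = mean (fun i : 'I_K => normal_pdf (d * i%:R) s y).
Proof. by rewrite /mean card_ord. Qed.

Lemma cloud_mean j y : cloud j y = mean (fun i => N i j y).
Proof. by rewrite /cloud pam_mean; apply: eq_mean => i; rewrite normal_symbol. Qed.

Lemma pam_cloud y : pam (K1 * K2) d s y = mean (fun j => cloud j y).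
Proof. by rewrite pam_mul// /mean card_ord. Qed.

Lemma nice_cloud j : nice (cloud j).
Proof. by apply: nice_shift; exact: nice_pam. Qed.

Lemma J_cloud j : J (cloud j) = 1.
Proof. by rewrite J_shift ?J_pam//; exact: gdom_pam. Qed.

Lemma normal_le_cloud i j y : N i j y <= K1%:R * cloud j y.
Proof.
rewrite cloud_mean /mean card_ord mulVKf ?pnatr_eq0 -?lt0n// (bigD1 i)//= lerDl.
by apply: sumr_ge0 => k _; exact: normal_pdf_ge0.
Qed.

Lemma mean_J (T : finType) (F : T -> R -> R) : (forall a, gdom (F a)) ->
  mean (fun a => J (F a)) = J (fun y => mean (fun a => F a y)).
Proof. by move=> gF; rewrite /mean JZ ?J_sum//; exact: gdom_sum. Qed.

Let nN i : nice (normal_pdf (d * i%:R) s) := nice_normal _ s0.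
Let nq1 := nice_pam d K10 s0.
Let nq2 := nice_pam d KK s0.

Lemma measurable_test1 i j : measurable_fun setT (test1 i j).
Proof.
rewrite (_ : test1 i j = fun y => llr L1 (normal_pdf (d * i%:R) s) (pam K1 d s)
    (1 * y + - (K1%:R * d * j%:R))); last by apply/funext => y; rewrite mul1r.
apply: (measurableT_comp (qbd_llr (fun i => nN i) nq1 L1 i).1).
exact: measurable_affine.
Qed.

Lemma measurable_test2 j : measurable_fun setT (test2 j).
Proof. exact: (qbd_llr nice_cloud nq2 L2 j).1. Qed.

Lemma gdom_wrong1 i j (i' : 'I_K1) : gdom (fun y => N i j y * expR (- test1 i' j y)).
Proof.
under eq_fun do rewrite normal_symbol.
apply: (@gdom_shift _ (K1%:R * d * j%:R) (fun y => normal_pdf (d * i%:R) s y *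
  expR (- llr L1 (normal_pdf (d * i'%:R) s) (pam K1 d s) y))).
by apply: (gdom_expR_llrN (p := fun i => normal_pdf (d * i%:R) s)) => //;
  [exact: pam_mean|exact: gdom_normal].
Qed.

Lemma gdom_wrong2 i j (j' : 'I_K2) : gdom (fun y => N i j y * expR (- test2 j' y)).
Proof.
by apply: (gdom_expR_llrN K20 nice_cloud nq2 pam_cloud); exact: gdom_normal.
Qed.

Lemma mean_wrong1 i j :
  mean (fun i' : 'I_K1 => J (fun y => N i j y * expR (- test1 i' j y))) = expR (- L1).
Proof.
rewrite mean_J; last by move=> i'; exact: gdom_wrong1.
transitivity (J (fun y => expR (- L1) * N i j y)); last first.
  by rewrite JZ ?J_normal ?mulr1//; exact: gdom_normal.
apply: eqJ => y; rewrite meanZ mulrC; congr (_ * _).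
exact: (mean_llrN (fun i => nN i) nq1 (pam_mean K1) L1 _).
Qed.

Lemma mean_wrong2 i j :
  mean (fun j' : 'I_K2 => J (fun y => N i j y * expR (- test2 j' y))) = expR (- L2).
Proof.
rewrite mean_J; last by move=> j'; exact: gdom_wrong2.
transitivity (J (fun y => expR (- L2) * N i j y)); last first.
  by rewrite JZ ?J_normal ?mulr1//; exact: gdom_normal.
by apply: eqJ => y; rewrite meanZ mulrC (mean_llrN nice_cloud nq2 pam_cloud).
Qed.

Lemma ex_test1 : L1 < ent (pam K1 d s) - gent s -> exists sg, [/\ 0 <= sg,
  forall i j, gdom (fun y => N i j y * expR (sg * test1 i j y)) &
  mean (fun i => mean (fun j => J (fun y => N i j y * expR (sg * test1 i j y)))) < 1].
Proof.
move=> hL.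
have [|sg [sg0 gsg hsg]] := ex_chernoff K10 (fun i => nN i) nq1 (fun i => J_normal (d * i%:R) s)
  (pam_mean K1) (L := L1).
  have X1 : (0 < #|'I_K1|)%N by rewrite card_ord.
  by rewrite (eq_mean (fun i => ent_normal (d * i%:R) s0)) (mean_cst (gent s) X1).
exists sg; split=> //.
  move=> i j; under eq_fun do rewrite normal_symbol.
  exact: (gdom_shift _ (gsg i)).
apply: le_lt_trans hsg; rewrite le_eqVlt; apply/orP; left; apply/eqP; apply: eq_mean => i.
have h j : J (fun y => N i j y * expR (sg * test1 i j y)) = J (fun y => normal_pdf (d * i%:R) s y *
    expR (sg * llr L1 (normal_pdf (d * i%:R) s) (pam K1 d s) y)).
  rewrite -[RHS](J_shift (K1%:R * d * j%:R) (gsg i)).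
  by apply: eqJ => y; rewrite normal_symbol /test1.
by rewrite (eq_mean h) mean_cst// card_ord.
Qed.

Lemma ex_test2 : L2 < ent (pam (K1 * K2) d s) - ent (pam K1 d s) -> exists sg, [/\ 0 <= sg,
  forall i j, gdom (fun y => N i j y * expR (sg * test2 j y)) &
  mean (fun i => mean (fun j => J (fun y => N i j y * expR (sg * test2 j y)))) < 1].
Proof.
move=> hL.
have [|sg [sg0 gsg hsg]] := ex_chernoff K20 nice_cloud nq2 J_cloud pam_cloud (L := L2).
  have h j : ent (cloud j) = ent (pam K1 d s) := ent_shift _ nq1.
  have X2 : (0 < #|'I_K2|)%N by rewrite card_ord.
  rewrite (eq_mean h) (mean_cst (ent (pam K1 d s)) X2); exact: hL.
(* The moment is known to be dominated under the cloud density, and a single symbol is at most K1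
   times its cloud. *)
have gN i j : gdom (fun y => N i j y * expR (sg * test2 j y)).
  apply: gdom_le (gdomZ K1%:R (gsg j)) => [|y].
    apply: measurable_funM; first exact: measurable_normal_pdf.
    by apply: measurableT_comp => //; apply: measurable_funM => //; exact: measurable_test2.
  rewrite mulr_ge0 ?normal_pdf_ge0 ?expR_ge0//= mulrA ler_wpM2r ?expR_ge0//.
  exact: normal_le_cloud.
exists sg; split=> //.
apply: le_lt_trans hsg; rewrite mean_swap le_eqVlt; apply/orP; left; apply/eqP.
(* The test does not depend on i, so averaging over i replaces the symbol density by the cloud. *)
apply: eq_mean => j; rewrite mean_J//; apply: eqJ => y; rewrite cloud_mean [RHS]mulrC -[RHS]meanZ.
by apply: eq_mean => i; rewrite mulrC.
Qed.

End PamTests.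

Arguments symbol {R} d {K1 K2} i j.
Arguments test1 {R} s d L1 {K1 K2} i j y.
Arguments test2 {R} s d L2 K1 {K2} j y.

(** * From random codes to the rate region *)

Section Achievability.
Variable R : realType.
Implicit Types (d s th eps : R).

(** [k.+1] is the ceiling of x, in successor form because [decode] falls back on message [ord0]. *)
Lemma ex_message_count (x : R) : 1 <= x -> exists k, x <= k.+1%:R < x + 1.
Proof.
move=> x1; have x0 : 0 <= x by apply: le_trans x1.
have := truncn_itv x0; set t := Num.truncn x => /andP[tx xt].
have [xE|xN] := eqVneq x t%:R; last first.
  by exists t; rewrite ltW//= -natr1 ltrD2r lt_neqAle eq_sym xN.
have t0 : (0 < t)%N by rewrite -(ltr_nat R) -xE (lt_le_trans ltr01).
by exists t.-1; rewrite prednK// -xE lexx ltrDl ltr01.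
Qed.

Lemma eventually_pow_le c th eps : 0 <= th < 1 -> 0 < eps ->
  exists N, forall n, (N <= n)%N -> c * th ^+ n <= eps.
Proof.
move=> /andP[t0 t1] e0; have tn : `|th| < 1 by rewrite ger0_norm.
have h : c * th ^+ n @[n --> \oo] --> c * 0 by apply: cvgMr; exact: cvg_expr.
rewrite mulr0 in h; have /cvgrPdist_le/(_ _ e0)[N _ hN] := h.
exists N => n Nn; have := hN n Nn; rewrite /= sub0r normrN => hn.
exact: le_trans (ler_norm _) hn.
Qed.

(** To be applied to the sum of the error bounds of both receivers, so that one pair of codebooks
    serves both. *)
Lemma ex_code (C E L M : finType) (W : C -> E -> L -> M -> R) (B : R) :
  (0 < #|C|)%N -> (0 < #|E|)%N -> (0 < #|L|)%N -> (0 < #|M|)%N ->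
  (forall l m, mean (fun c => mean (fun e => W c e l m)) <= B) ->
  exists c e, mean (fun l => mean (fun m => W c e l m)) <= B.
Proof.
move=> C0 E0 L0 M0 hW.
have [c hc] : exists c, mean (fun e => mean (fun l => mean (fun m => W c e l m))) <= B.
  apply: mean_le_ex => //.
  rewrite (eq_mean (g := fun c => mean (fun l => mean (fun m => mean (fun e => W c e l m))))).
    rewrite mean_swap (eq_mean (g := fun l => mean (fun m => mean (fun c => mean (fun e => W c e l m))))).
      rewrite -(mean_cst B L0); apply: le_mean => l.
      by rewrite -(mean_cst B M0); apply: le_mean => m.
    by move=> l; rewrite mean_swap.
  by move=> c; rewrite mean_swap; apply: eq_mean => l; rewrite mean_swap.
by exists c; exact: mean_le_ex.
Qed.

Lemma avg_err_le s n k1 k2 k (enc : 'I_k1 -> 'I_k2 -> 'rV[R]_n)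
    (pick : 'I_k1 -> 'I_k2 -> 'I_k) (g : 'rV[R]_n -> 'I_k) (U : 'I_k1 -> 'I_k2 -> R) :
  (forall l m, noise_prob s [set z | g (enc l m + z)%R != pick l m] <= (U l m)%:E)%E ->
  (avg_err s enc pick g <= (mean (fun l => mean (U l)))%:E)%E.
Proof.
move=> hU; rewrite /mean !card_ord -mulr_sumr mulrA -invfM -natrM mulnC EFinM.
rewrite mulnC; apply: lee_wpmul2l; first by rewrite lee_fin invr_ge0.
rewrite -sumEFin; apply: lee_sum => l _; rewrite -sumEFin.
by apply: lee_sum => m _; exact: hU.
Qed.

Lemma symbol_itv K1 K2 d (i : 'I_K1) (j : 'I_K2) : 0 <= d ->
  0 <= symbol d i j <= ((K1 * K2)%:R - 1) * d.
Proof.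
move=> d0.
have -> : symbol d i j = (i + K1 * j)%:R * d by rewrite /symbol natrD natrM; ring.
rewrite mulr_ge0//=; apply: ler_wpM2r => //.
rewrite lerBrDr natr1 ler_nat.
have := ltn_ord i; have := ltn_ord j => jK iK.
apply: (@leq_trans (K1 + K1 * j)); first by rewrite ltn_add2r.
by rewrite -mulnS leq_mul2l jK orbT.
Qed.

Lemma mean_ge0 (T : finType) (f : T -> R) : (forall a, 0 <= f a) -> 0 <= mean f.
Proof. by move=> f0; rewrite /mean mulr_ge0 ?invr_ge0// sumr_ge0. Qed.

Lemma stage_bound_ge0 s n k (x : 'I_n -> R) sg (v : 'I_k -> 'I_n -> R -> R) m :
  0 <= \sum_a stage_coef m a * \prod_t J (fun y => normal_pdf (x t) s y * stage_fun sg v m a t y).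
Proof.
apply: sumr_ge0 => a _; apply: mulr_ge0; first exact: stage_coef_ge0.
apply: prodr_ge0 => t _; apply: J_ge0 => y; rewrite mulr_ge0 ?normal_pdf_ge0//.
exact: stage_fun_ge0.
Qed.

Lemma ex_common_bound (p q r u v : R) : 0 <= p -> p < 1 -> q < 1 -> r < 1 -> u < 1 -> v < 1 ->
  exists th, 0 <= th < 1 /\ [/\ p <= th, q <= th, r <= th, u <= th & v <= th].
Proof.
move=> p0 p1 q1 r1 u1 v1; exists (Num.max p (Num.max q (Num.max r (Num.max u v)))); split.
  by rewrite le_max p0 !gt_max p1 q1 r1 u1 v1.
by rewrite !le_max !lexx !orbT.
Qed.

Lemma two_powR_ge1 n (r : R) : 0 <= r -> 1 <= 2 `^ (n%:R * r) :> R.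
Proof.
move=> r0; have l20 : 0 < ln 2 :> R by rewrite ln_gt0// ltr1n.
rewrite /powR pnatr_eq0/= -[leLHS]expR0 ler_expR.
exact: mulr_ge0 (mulr_ge0 (ler0n _ _) r0) (ltW l20).
Qed.

(** As r >= 0, the rounding term 1 is at most [2 ^ (n r)], which explains the factor 2. *)
Lemma message_count_le n k (r L : R) : 0 <= r -> k.+1%:R < 2 `^ (n%:R * r) + 1 ->
  k.+1%:R * expR (- L) ^+ n <= 2 * expR (r * ln 2 - L) ^+ n.
Proof.
move=> r0; have := two_powR_ge1 n r0; rewrite /powR pnatr_eq0/= => e1 hk.
apply: (@le_trans _ _ (2 * expR (n%:R * r * ln 2) * expR (- L) ^+ n)).
  by apply: ler_wpM2r; [rewrite exprn_ge0// expR_ge0|lra].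
by rewrite -!expRM_natl -mulrA -expRD mulrBr mulrN mulrA.
Qed.

Lemma pam_achievable (K1 K2 : nat) (d s1 s2 R1 R2 : R) : (0 < K1)%N -> (0 < K2)%N -> 0 <= d ->
  0 < s1 -> s1 < s2 -> 0 <= R1 -> 0 <= R2 ->
  R1 * ln 2 < ent (pam K1 d s1) - gent s1 ->
  R2 * ln 2 < ent (pam (K1 * K2) d s2) - ent (pam K1 d s2) ->
  achievable (((K1 * K2)%:R - 1) * d) s1 s2 R1 R2.
Proof.
have aux (x y z w : R) : x <= w -> y <= w -> z <= w ->
  y + 2 * w + (x + 2 * w) + (z + 2 * w) <= 9 * w by lra.
move=> K10 K20 d0 s10 s12 R10 R20 hR1 hR2; have s20 := lt_trans s10 s12.
(* A threshold strictly between rate and entropy difference makes both kinds of error decay: wrong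
   messages passing and the true one failing. *)
have [L1 RL1 hL1] : exists2 L1, R1 * ln 2 < L1 & L1 < ent (pam K1 d s1) - gent s1.
  by exists ((R1 * ln 2 + (ent (pam K1 d s1) - gent s1)) / 2);
    [exact: (midf_lt hR1).1|exact: (midf_lt hR1).2].
have [L2 RL2 hL2] : exists2 L2, R2 * ln 2 < L2 & L2 < ent (pam (K1 * K2) d s2) - ent (pam K1 d s2).
  by exists ((R2 * ln 2 + (ent (pam (K1 * K2) d s2) - ent (pam K1 d s2))) / 2);
    [exact: (midf_lt hR2).1|exact: (midf_lt hR2).2].
(* Degradedness lets receiver 1 run the test for the second message at noise s1 with the same
   threshold L2. *)
have hL2' := lt_le_trans hL2 (ent_pam_degraded d K10 K20 s10 s12).
have [a1 [a10 ga1 M1]] := ex_test1 (K2 := K2) s10 K10 K20 hL1.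
have [a2 [a20 ga2 M2]] := ex_test2 s10 K10 K20 hL2'.
have [a3 [a30 ga3 M3]] := ex_test2 s20 K10 K20 hL2.
have nJ (x s u y : R) : 0 <= normal_pdf x s y * expR u.
  by rewrite mulr_ge0 ?normal_pdf_ge0 ?expR_ge0.
set m1 := mean _ in M1; set m2 := mean _ in M2; set m3 := mean _ in M3.
have m10 : 0 <= m1 by do 2 (apply: mean_ge0 => ?); apply: J_ge0 => y; exact: nJ.
have m20 : 0 <= m2 by do 2 (apply: mean_ge0 => ?); apply: J_ge0 => y; exact: nJ.
have m30 : 0 <= m3 by do 2 (apply: mean_ge0 => ?); apply: J_ge0 => y; exact: nJ.
have t11 : expR (R1 * ln 2 - L1) < 1 by rewrite expR_lt1 subr_lt0.
have t21 : expR (R2 * ln 2 - L2) < 1 by rewrite expR_lt1 subr_lt0.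
have [th [th01 [h1 h2 h3 h4 h5]]] := ex_common_bound m10 M1 M2 M3 t11 t21.
(* Three stages are used, two at receiver 1 and one at receiver 2; each costs one power for the true
   codeword and two for the wrong ones, hence 9. *)
move=> eps eps0; have [N hN] := eventually_pow_le 9 th01 eps0.
exists N => n Nn; have {}hN := hN n Nn.
have pow_le p : 0 <= p -> p <= th -> p ^+ n <= th ^+ n.
  by move=> p0 pt; rewrite lerXn2r// nnegrE// (le_trans p0).
have [k1 hk1] := ex_message_count (two_powR_ge1 n R10).
have [k2 hk2] := ex_message_count (two_powR_ge1 n R20).
have /andP[_ /(message_count_le L1 R10) kb1] := hk1.
have /andP[_ /(message_count_le L2 R20) kb2] := hk2.
pose X (c : {ffun 'I_k1.+1 -> {ffun 'I_n -> 'I_K1}})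
    (e : {ffun 'I_k2.+1 -> {ffun 'I_n -> 'I_K2}}) (l : 'I_k1.+1) (m : 'I_k2.+1) := bound2 s1 (symbol d) (test2 s1 d L2 K1) a2 c e l m +
  bound1 s1 (symbol d) (test1 s1 d L1) a1 c e l m.
pose Y (c : {ffun 'I_k1.+1 -> {ffun 'I_n -> 'I_K1}})
    (e : {ffun 'I_k2.+1 -> {ffun 'I_n -> 'I_K2}}) (l : 'I_k1.+1) (m : 'I_k2.+1) := bound2 s2 (symbol d) (test2 s2 d L2 K1) a3 c e l m.
have X0 c e l m : 0 <= X c e l m by rewrite addr_ge0// stage_bound_ge0.
have Y0 c e l m : 0 <= Y c e l m by exact: stage_bound_ge0.
have C0 : (0 < #|{: {ffun 'I_k1.+1 -> {ffun 'I_n -> 'I_K1}}}|)%N by rewrite card_codebook_gt0// card_ord.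
have E0 : (0 < #|{: {ffun 'I_k2.+1 -> {ffun 'I_n -> 'I_K2}}}|)%N by rewrite card_codebook_gt0// card_ord.
have [] := @ex_code _ _ _ _ (fun c e l m => X c e l m + Y c e l m) eps C0 E0.
- by rewrite card_ord.
- by rewrite card_ord.
- move=> l m.
  have b1 := mean_bound1 n a1 K10 K20 (expR_ge0 (- L1)) (mean_wrong1 d L1 s10 K10) l m.
  have b2 := mean_bound2 n a2 K10 K20 (expR_ge0 (- L2)) (mean_wrong2 d L2 s10 K10 K20) l m.
  have b3 := mean_bound2 n a3 K10 K20 (expR_ge0 (- L2)) (mean_wrong2 d L2 s20 K10 K20) l m.
  have bX : mean (fun c => mean (fun e => X c e l m)) <= m2 ^+ n + 2 * th ^+ n + (m1 ^+ n + 2 * th ^+ n).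
    rewrite (eq_mean (fun c => meanD _ _)) meanD; apply: lerD.
      by apply: (le_trans b2); rewrite lerD2l (le_trans kb2)// ler_wpM2l// pow_le// expR_ge0.
    by apply: (le_trans b1); rewrite lerD2l (le_trans kb1)// ler_wpM2l// pow_le// expR_ge0.
  have bY : mean (fun c => mean (fun e => Y c e l m)) <= m3 ^+ n + 2 * th ^+ n.
    by apply: (le_trans b3); rewrite lerD2l (le_trans kb2)// ler_wpM2l// pow_le// expR_ge0.
  rewrite (eq_mean (fun c => meanD _ _)) meanD; apply: le_trans hN.
  apply: (le_trans (lerD bX bY)).
  exact: aux (pow_le _ m10 h1) (pow_le _ m20 h2) (pow_le _ m30 h3).
move=> c [e hce].
exists k1.+1, k2.+1, (superpose (symbol d) c e), (dec1 (test1 s1 d L1) (test2 s1 d L2 K1) c e),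
  (dec2 (test2 s2 d L2 K1) e); split=> //.
- by move=> l m t; rewrite mxE; exact: symbol_itv.
- have mp2 s m : 0 < s -> borel_rV [set y : 'rV[R]_n | pass2 (test2 s d L2 K1) e m y].
    move=> s0; apply: (borel_sum_le0 (u := fun t => test2 s d L2 K1 (e m t))) => t.
    exact: measurable_test2.
  split; apply: measurable_decode => m; last exact: mp2.
  apply: borel_exists => m'; first exact: mp2.
  apply: (borel_sum_le0 (u := fun t => test1 s1 d L1 (c m t) (e m' t))) => t.
  exact: measurable_test1.
have XYle (Z : 'I_k1.+1 -> 'I_k2.+1 -> R) : (forall l m, Z l m <= X c e l m + Y c e l m) ->
    mean (fun l => mean (Z l)) <= eps.
  by move=> h; apply: le_trans hce; apply: le_mean => l; exact: le_mean.
split.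
  apply: (@le_trans _ _ (mean (fun l => mean (X c e l)))%:E); last first.
    by rewrite lee_fin; apply: XYle => l m; rewrite lerDl.
  apply: avg_err_le => l m.
  exact: (noise_prob_dec1 s10 a10 a20 ga2 (gdom_wrong2 d L2 s10 K10 K20) ga1
    (gdom_wrong1 d L1 s10 K10) c e l m).
apply: (@le_trans _ _ (mean (fun l => mean (Y c e l)))%:E); last first.
  by rewrite lee_fin; apply: XYle => l m; rewrite lerDr.
apply: avg_err_le => l m.
exact: (noise_prob_dec2 s20 a30 ga3 (gdom_wrong2 d L2 s20 K10 K20) c e l m).
Qed.

Lemma achievable_of_F_G (A s1 s2 : R) (K1 K2 : nat) (R1 R2 : R) :
  0 < A -> 0 < s1 -> s1 < s2 -> (2 <= K1)%N -> (1 <= K2)%N ->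
  0 <= R1 -> 0 <= R2 ->
  R1 <= Ffun ((K1%:R - 1) * A / ((K1 * K2)%:R - 1)) K1 s1 ->
  R2 <= Ffun A (K1 * K2) s2 - Gfun ((K1%:R - 1) * A / ((K1 * K2)%:R - 1)) K1 s2 ->
  achievable A s1 s2 R1 R2.
Proof.
have aux (x y z w g : R) : x < y - g -> w - g <= z -> x - z < y - w by lra.
move=> A0 s10 s12 K1_gt1 K20 R10 R20 hR1 hR2.
have s20 := lt_trans s10 s12; have K10 : (0 < K1)%N by exact: ltnW.
have KK1 : (1 < K1 * K2)%N by rewrite (leq_trans K1_gt1)// leq_pmulr.
have KK0 : 0 < (K1 * K2)%:R - 1 :> R by rewrite subr_gt0 ltr1n.
(* In units of d, the first argument of F at receiver 1 and of G is the span K1 - 1 of one cloud,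
   and A is the span of all [K1 * K2] points. *)
pose d := A / ((K1 * K2)%:R - 1); have d0 : 0 < d by rewrite divr_gt0.
have AE : A = ((K1 * K2)%:R - 1) * d by rewrite /d mulrC divfK// gt_eqF.
have l2 : 0 < ln 2 :> R by rewrite ln_gt0// ltr1n.
rewrite -mulrA -/d in hR1 hR2; rewrite AE in hR2 *.
apply: (pam_achievable K10 K20 (ltW d0) s10 s12 R10 R20).
  by apply: le_lt_trans (F_lt K1_gt1 d0 s10); rewrite ler_pM2r.
apply: (@le_lt_trans _ _ ((Ffun (((K1 * K2)%:R - 1) * d) (K1 * K2) s2 -
  Gfun ((K1%:R - 1) * d) K1 s2) * ln 2)); first by rewrite ler_pM2r.
(* Both bounds are relative to the same noise entropy [gent s2], which cancels in the difference. *)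
rewrite mulrBl; have hF := F_lt KK1 d0 s20; have hG := G_ge K1_gt1 d0 s20.
exact: aux hF hG.
Qed.

End Achievability.

Theorem theorem1 (R : realType) (A s1 s2 : R) (K1 K2 : nat) (R1 R2 : R) :
  0 < A -> 0 < s1 -> s1 < s2 -> (2 <= K1)%N -> (1 <= K2)%N ->
  0 <= R1 -> 0 <= R2 ->
  R1 <= Ffun ((K1%:R - 1) * A / ((K1 * K2)%:R - 1)) K1 s1 ->
  R2 <= Ffun A (K1 * K2) s2 - Gfun ((K1%:R - 1) * A / ((K1 * K2)%:R - 1)) K1 s2 ->
  achievable A s1 s2 R1 R2.
Proof. exact: achievable_of_F_G. Qed.
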